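(* Let $A$ be a separable $C^*$-algebra with $T(A)$ non-empty and compact. The following are equivalent. (i) $A$ has uniform property $\Gamma$. (ii) For some $0<\lambda<1$, there exists a projection $p\in A^\omega\cap A'$ such that $$\tau(ap)=\lambda\tau(a),\quad a\in A,\ \tau\in T_\omega(A).$$ (iii) For any $\|\cdot\|_{2,T_\omega(A)}$-separable subalgebra $S\subset A^\omega$, there is a unital $^*$-homomorphism $\phi:L^\infty([0,1])\to A^\omega\cap S'$ such that $$\tau(a\phi(f))=\tau(a)\int_0^1 f(t)\,dt,\quad a\in S,\ f\in L^\infty([0,1]),\ \tau\in T_\omega(A).$$
   Context: A trace on a $C^*$-algebra $A$ means a tracial state; $T(A)$ is the set of traces with the weak$^*$-topology. For a non-empty set $X$ of traces, $\|a\|_{2,X}=\sup_{\tau\in X}\tau(a^*a)^{1/2}$. Fix a free ultrafilter $\omega$ on $\mathbb N$. When $T(A)\neq\emptyset$, the uniform tracial ultrapower is $A^\omega=\ell^\infty(A)/\{(a_n)_n:\lim_{n\to\omega}\|a_n\|_{2,T(A)}=0\}$. A limit trace is a trace on $A^\omega$ induced by $(a_n)_n\mapsto\lim_{n\to\omega}\tau_n(a_n)$ for some sequence $(\tau_n)_n$ in $T(A)$; $T_\omega(A)$ denotes the set of limit traces. There is a canonical map $\iota:A\to A^\omega$ by constant sequences (which need not be injective); $A^\omega\cap A'$ means $A^\omega\cap\iota(A)'$, and in products in $A^\omega$ an element $a\in A$ means $\iota(a)$. If $A$ is separable and $T(A)$ is compact and non-empty, then $A^\omega$ is unital. Uniform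 property $\Gamma$: a separable $C^*$-algebra $A$ with $T(A)$ non-empty and compact has uniform property $\Gamma$ if for all $n\in\mathbb N$ there exist projections $p_1,\dots,p_n\in A^\omega\cap A'$ summing to $1_{A^\omega}$ such that $\tau(ap_i)=\frac1n\tau(a)$ for all $a\in A$, $\tau\in T_\omega(A)$, $i=1,\dots,n$. $L^\infty([0,1])$ is taken with respect to Lebesgue measure. *)

(* Defs.v *)
From HB Require Import structures.
From mathcomp Require Import all_boot all_order all_algebra.
From mathcomp Require Import all_classical all_reals all_analysis.
From mathcomp Require Import measurable_realfun complex ring lra.

Set Implicit Arguments.
Unset Strict Implicit.
Unset Printing Implicit Defensive.

Import Order.TTheory GRing.Theory Num.Theory.
Import numFieldNormedType.Exports.

Local Open Scope classical_set_scope.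
Local Open Scope ring_scope.

HB.instance Definition _ (R : realType) := NormedModule.copy R[i] R[i]^o.

(* Algebras need not have a unit, so the product cannot be the one of a
   MathComp ring. *)
HB.mixin Record Lmodule_isStarAlgebra (R : realType) A & GRing.Lmodule R[i] A := {
  smul : A -> A -> A;
  star : A -> A;
  smulA : associative smul;
  smulDl : left_distributive smul +%R;
  smulDr : right_distributive smul +%R;
  smulZl : forall (k : R[i]) x y, smul (k *: x) y = k *: smul x y;
  smulZr : forall (k : R[i]) x y, smul x (k *: y) = k *: smul x y;
  starK : involutive star;
  starD : {morph star : x y / x + y};
  starZ : forall (k : R[i]) x, star (k *: x) = (k^*)%C *: star x;
  starM : forall x y, star (smul x y) = smul (star y) (star x)
}.

#[short(type="starAlgType")]
HB.structure Definition StarAlgebra (R : realType) :=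
  {A of GRing.Lmodule R[i] A & Lmodule_isStarAlgebra R A}.

HB.mixin Record StarAlgebra_isCstarAlgebra (R : realType) A
    & CompleteNormedModule R[i] A & StarAlgebra R A := {
  ler_normM : forall x y : A, `|smul x y| <= `|x| * `|y|;
  normM_star : forall x : A, `|smul (star x) x| = `|x| ^+ 2
}.

#[short(type="cstarAlgType")]
HB.structure Definition CstarAlgebra (R : realType) :=
  {A of CompleteNormedModule R[i] A & StarAlgebra R A
      & StarAlgebra_isCstarAlgebra R A}.

Declare Scope star_scope.
Delimit Scope star_scope with star.
Notation "x ** y" := (smul x y) (at level 40, left associativity) : star_scope.
Notation "x ^#" := (star x) (at level 2, format "x ^#") : star_scope.
Local Open Scope star_scope.

Section StarAlgebraTheory.
Context {R : realType} {A : starAlgType R}.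
Implicit Types (x y : A) (k : R[i]).

Lemma smul0l x : 0 ** x = 0.
Proof. by have := smulZl 0 0 x; rewrite !scale0r. Qed.
Lemma smul0r x : x ** 0 = 0.
Proof. by have := smulZr 0 x 0; rewrite !scale0r. Qed.
Lemma smulNl x y : (- x) ** y = - (x ** y).
Proof. by rewrite -scaleN1r smulZl scaleN1r. Qed.
Lemma smulNr x y : x ** (- y) = - (x ** y).
Proof. by rewrite -scaleN1r smulZr scaleN1r. Qed.
Lemma smulBl x y z : (x - y) ** z = x ** z - y ** z.
Proof. by rewrite smulDl smulNl. Qed.
Lemma smulBr x y z : x ** (y - z) = x ** y - x ** z.
Proof. by rewrite smulDr smulNr. Qed.
Lemma star0 : (0 : A)^# = 0.
Proof. by have := starZ 0 (0 : A); rewrite !scale0r conjc0 scale0r. Qed.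
Lemma starN x : (- x)^# = - x^#.
Proof. by apply/eqP; rewrite -addr_eq0 -starD addNr star0. Qed.
Lemma starB x y : (x - y)^# = x^# - y^#.
Proof. by rewrite starD starN. Qed.

Definition is_identity (u : A) := forall x, u ** x = x /\ x ** u = x.

Definition is_projection (p : A) := p^# = p /\ p ** p = p.

Definition commutant (S : set A) : set A :=
  [set x | forall s, S s -> x ** s = s ** x].

(* Closure under the involution and norm-closedness are not required. *)
Definition is_subalgebra (S : set A) :=
  [/\ S 0, forall k x y, S x -> S y -> S (k *: x + y)
    & forall x y, S x -> S y -> S (x ** y)].

(* ||a||_{2,X}; the real supremum is the actual one whenever X is non-empty
   and the set is bounded, as it is for tracial states and for limit traces, see
   [norm2_has_sup] and [limit_traces_has_sup]. *)
Definition norm2 (X : set (A -> R[i])) (a : A) : R :=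
  sup [set Num.sqrt (complex.Re (tau (a^# ** a))) | tau in X].

Definition norm2_separable (X : set (A -> R[i])) (S : set A) :=
  exists D : set A, [/\ countable D, D `<=` S &
    forall s (e : R), S s -> 0 < e -> exists2 d, D d & norm2 X (s - d) < e].

End StarAlgebraTheory.

Definition is_star_morphism (R : realType) (A B : starAlgType R) (f : A -> B) :=
  [/\ linear f, {morph f : x y / x ** y} & {morph f : x / x^#}].

Section Complex.
Variable R : realType.
Let mulCA : associative (fun x y : R[i] => x * y). Proof. exact: mulrA. Qed.
Let mulCDl : left_distributive (fun x y : R[i] => x * y) +%R.
Proof. exact: mulrDl. Qed.
Let mulCDr : right_distributive (fun x y : R[i] => x * y) +%R.
Proof. exact: mulrDr. Qed.
Let mulCZl (k x y : R[i]) : (k *: x) * y = k *: (x * y).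
Proof. by rewrite -scalerAl. Qed.
Let mulCZr (k x y : R[i]) : x * (k *: y) = k *: (x * y).
Proof. exact: mulrCA. Qed.
Let conjCK : involutive (@conjc R). Proof. exact: conjcK. Qed.
Let conjCD : {morph @conjc R : x y / x + y}. Proof. exact: rmorphD. Qed.
Let conjCZ (k x : R[i]) : ((k *: x)^*)%C = (k^*)%C *: (x^*)%C.
Proof. exact: rmorphM. Qed.
Let conjCM (x y : R[i]) : ((x * y)^*)%C = (y^*)%C * (x^*)%C.
Proof. by rewrite mulrC; exact: rmorphM. Qed.
HB.instance Definition _ := @Lmodule_isStarAlgebra.Build R R[i]
  (fun x y => x * y) (@conjc R) mulCA mulCDl mulCDr mulCZl mulCZr
  conjCK conjCD conjCZ conjCM.
End Complex.

Section Functions.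
Variables (R : realType) (T : Type) (A : starAlgType R).
Implicit Types f g h : T -> A.
Let fmul f g : T -> A := fun t => f t ** g t.
Let fstar f : T -> A := fun t => (f t)^#.
Let fmulA : associative fmul.
Proof. by move=> f g h; apply/funext => t; exact: smulA. Qed.
Let fmulDl : left_distributive fmul +%R.
Proof. by move=> f g h; apply/funext => t; exact: smulDl. Qed.
Let fmulDr : right_distributive fmul +%R.
Proof. by move=> f g h; apply/funext => t; exact: smulDr. Qed.
Let fmulZl (k : R[i]) f g : fmul (k *: f) g = k *: fmul f g.
Proof. by apply/funext => t; exact: smulZl. Qed.
Let fmulZr (k : R[i]) f g : fmul f (k *: g) = k *: fmul f g.
Proof. by apply/funext => t; exact: smulZr. Qed.
Let fstarK : involutive fstar.
Proof. by move=> f; apply/funext => t; exact: starK. Qed.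
Let fstarD : {morph fstar : f g / f + g}.
Proof. by move=> f g; apply/funext => t; exact: starD. Qed.
Let fstarZ (k : R[i]) f : fstar (k *: f) = (k^*)%C *: fstar f.
Proof. by apply/funext => t; exact: starZ. Qed.
Let fstarM f g : fstar (fmul f g) = fmul (fstar g) (fstar f).
Proof. by apply/funext => t; exact: starM. Qed.
HB.instance Definition _ := @Lmodule_isStarAlgebra.Build R (T -> A)
  fmul fstar fmulA fmulDl fmulDr fmulZl fmulZr fstarK fstarD fstarZ fstarM.
End Functions.

Record starSubalg (R : realType) (A : starAlgType R) := StarSubalg {
  ssub_set :> set A;
  ssub_sub : is_subalgebra ssub_set;
  ssub_star : forall x, ssub_set x -> ssub_set x^#
}.

Section Subalgebra.
Variables (R : realType) (A : starAlgType R) (S : starSubalg A).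

Definition ssub_pred : {pred A} := mem (S : set A).

Let ssub_closed : submod_closed ssub_pred.
Proof.
have [S0 SL _] := ssub_sub S.
by split=> [|k x y]; rewrite !inE //; exact: SL.
Qed.
HB.instance Definition _ := GRing.isSubmodClosed.Build R[i] A ssub_pred ssub_closed.

Record subalg := Subalg { subalg_val :> A; subalg_valP : subalg_val \in ssub_pred }.
HB.instance Definition _ := [isSub for subalg_val].
HB.instance Definition _ := [Choice of subalg by <:].
HB.instance Definition _ := [SubChoice_isSubLmodule of subalg by <:].

Implicit Types x y : subalg.
Let mulP x y : subalg_val x ** subalg_val y \in ssub_pred.
Proof.
have [_ _ SM] := ssub_sub S.
by move: (subalg_valP x) (subalg_valP y); rewrite !inE; exact: SM.
Qed.
Let starP x : (subalg_val x)^# \in ssub_pred.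
Proof. by move: (subalg_valP x); rewrite !inE; exact: ssub_star. Qed.
Let bmul x y := Subalg (mulP x y).
Let bstar x := Subalg (starP x).
Let bmulA : associative bmul.
Proof. by move=> x y z; apply/val_inj; exact: smulA. Qed.
Let bmulDl : left_distributive bmul +%R.
Proof. by move=> x y z; apply/val_inj; exact: smulDl. Qed.
Let bmulDr : right_distributive bmul +%R.
Proof. by move=> x y z; apply/val_inj; exact: smulDr. Qed.
Let bmulZl (k : R[i]) x y : bmul (k *: x) y = k *: bmul x y.
Proof. by apply/val_inj; exact: smulZl. Qed.
Let bmulZr (k : R[i]) x y : bmul x (k *: y) = k *: bmul x y.
Proof. by apply/val_inj; exact: smulZr. Qed.
Let bstarK : involutive bstar.
Proof. by move=> x; apply/val_inj; exact: starK. Qed.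
Let bstarD : {morph bstar : x y / x + y}.
Proof. by move=> x y; apply/val_inj; exact: starD. Qed.
Let bstarZ (k : R[i]) x : bstar (k *: x) = (k^*)%C *: bstar x.
Proof. by apply/val_inj; exact: starZ. Qed.
Let bstarM x y : bstar (bmul x y) = bmul (bstar y) (bstar x).
Proof. by apply/val_inj; exact: starM. Qed.
HB.instance Definition _ := @Lmodule_isStarAlgebra.Build R subalg
  bmul bstar bmulA bmulDl bmulDr bmulZl bmulZr bstarK bstarD bstarZ bstarM.

Lemma subalg_valM x y : subalg_val (x ** y) = subalg_val x ** subalg_val y.
Proof. by []. Qed.
Lemma subalg_val_star x : subalg_val x^# = (subalg_val x)^#.
Proof. by []. Qed.

End Subalgebra.

Record starIdeal (R : realType) (A : starAlgType R) := StarIdeal {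
  sid_set :> set A;
  sid0 : sid_set 0;
  sid_linear : forall k x y, sid_set x -> sid_set y -> sid_set (k *: x + y);
  sid_mull : forall x y, sid_set y -> sid_set (x ** y);
  sid_star : forall x, sid_set x -> sid_set x^#
}.

Section QuotientAlgebra.
Variables (R : realType) (A : starAlgType R) (I : starIdeal A).

Definition sid_pred : {pred A} := mem (I : set A).

Let sid_closed : submod_closed sid_pred.
Proof.
by split=> [|k x y]; rewrite !inE; [exact: sid0|exact: sid_linear].
Qed.
HB.instance Definition _ := GRing.isSubmodClosed.Build R[i] A sid_pred sid_closed.

Definition starQuot := Quotient.quot sid_pred.
HB.instance Definition _ := GRing.Zmodule.on starQuot.

Definition quot_pi (x : A) : starQuot := (\pi_(starQuot) x)%qT.

Lemma quot_piP x y : quot_pi x = quot_pi y <-> sid_set I (x - y).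
Proof.
split=> [/eqP|Ixy]; rewrite /quot_pi.
  by rewrite -Quotient.idealrBE inE.
by apply/eqP; rewrite -Quotient.idealrBE inE.
Qed.

Lemma quot_piK (x : starQuot) : quot_pi (repr x) = x.
Proof. exact: reprK. Qed.

Lemma quot_piD x y : quot_pi (x + y) = quot_pi x + quot_pi y.
Proof. exact: (Quotient.pi_add sid_pred). Qed.

Let sid_mulr x y : sid_set I x -> sid_set I (x ** y).
Proof.
by move=> Ix; rewrite -[_ ** _]starK starM; apply/sid_star/sid_mull/sid_star.
Qed.

Let qmul (x y : starQuot) := quot_pi (repr x ** repr y).
Let qstar (x : starQuot) := quot_pi (repr x)^#.
Let qscale (k : R[i]) (x : starQuot) := quot_pi (k *: repr x).

Let sidZ k x : sid_set I x -> sid_set I (k *: x).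
Proof. by move=> Ix; rewrite -[_ *: _]addr0; apply: sid_linear => //; exact: sid0. Qed.

Let sidD x y : sid_set I x -> sid_set I y -> sid_set I (x + y).
Proof. by move=> Ix Iy; rewrite -[x]scale1r; exact: sid_linear. Qed.

Let I_repr x : sid_set I (repr (quot_pi x) - x).
Proof. by apply/quot_piP; rewrite quot_piK. Qed.

Let piM x y : quot_pi (x ** y) = qmul (quot_pi x) (quot_pi y).
Proof.
apply/esym/quot_piP; set x' := repr _; set y' := repr _.
rewrite (_ : _ - _ = (x' - x) ** y' + x ** (y' - y)); last first.
  by rewrite smulBl smulBr addrA subrK.
by apply: sidD; [apply: sid_mulr|apply: sid_mull]; exact: I_repr.
Qed.

Let pi_star x : quot_pi x^# = qstar (quot_pi x).
Proof.
by apply/esym/quot_piP; rewrite -starB; apply: sid_star; exact: I_repr.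
Qed.

Let piZ k x : quot_pi (k *: x) = qscale k (quot_pi x).
Proof.
by apply/esym/quot_piP; rewrite -scalerBr; apply: sidZ; exact: I_repr.
Qed.

Let quot_ind (P : starQuot -> Prop) : (forall x, P (quot_pi x)) -> forall x, P x.
Proof. by move=> H x; rewrite -[x]quot_piK. Qed.

Let qscaleA (a b : R[i]) x : qscale a (qscale b x) = qscale (a * b) x.
Proof. by elim/quot_ind: x => x; rewrite -!piZ scalerA. Qed.
Let qscale1 : left_id 1 qscale.
Proof. by elim/quot_ind => x; rewrite -!piZ scale1r. Qed.
Let qscaleDr : right_distributive qscale +%R.
Proof.
move=> k; elim/quot_ind => x; elim/quot_ind => y.
by rewrite -quot_piD -!piZ scalerDr quot_piD.
Qed.
Let qscaleDl x : {morph qscale^~ x : a b / a + b}.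
Proof. by elim/quot_ind: x => x a b; rewrite -!piZ scalerDl quot_piD. Qed.
HB.instance Definition _ := @GRing.Zmodule_isLmodule.Build R[i] starQuot
  qscale qscaleA qscale1 qscaleDr qscaleDl.

Lemma quot_piZ k x : quot_pi (k *: x) = k *: quot_pi x.
Proof. exact: piZ. Qed.

Let qmulA : associative qmul.
Proof.
elim/quot_ind => x; elim/quot_ind => y; elim/quot_ind => z.
by rewrite -!piM smulA.
Qed.
Let qmulDl : left_distributive qmul +%R.
Proof.
elim/quot_ind => x; elim/quot_ind => y; elim/quot_ind => z.
by rewrite -quot_piD -!piM smulDl quot_piD.
Qed.
Let qmulDr : right_distributive qmul +%R.
Proof.
elim/quot_ind => x; elim/quot_ind => y; elim/quot_ind => z.
by rewrite -quot_piD -!piM smulDr quot_piD.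
Qed.
Let qmulZl (k : R[i]) x y : qmul (k *: x) y = k *: qmul x y.
Proof.
elim/quot_ind: x => x; elim/quot_ind: y => y.
by rewrite -(quot_piZ k x) -!piM -quot_piZ smulZl.
Qed.
Let qmulZr (k : R[i]) x y : qmul x (k *: y) = k *: qmul x y.
Proof.
elim/quot_ind: x => x; elim/quot_ind: y => y.
by rewrite -(quot_piZ k y) -!piM -quot_piZ smulZr.
Qed.
Let qstarK : involutive qstar.
Proof. by elim/quot_ind => x; rewrite -!pi_star starK. Qed.
Let qstarD : {morph qstar : x y / x + y}.
Proof.
elim/quot_ind => x; elim/quot_ind => y.
by rewrite -quot_piD -!pi_star starD quot_piD.
Qed.
Let qstarZ (k : R[i]) x : qstar (k *: x) = (k^*)%C *: qstar x.
Proof.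
elim/quot_ind: x => x.
by rewrite -(quot_piZ k x) -!pi_star -quot_piZ starZ.
Qed.
Let qstarM x y : qstar (qmul x y) = qmul (qstar y) (qstar x).
Proof.
elim/quot_ind: x => x; elim/quot_ind: y => y.
by rewrite -(piM x y) -pi_star starM piM !pi_star.
Qed.
HB.instance Definition _ := @Lmodule_isStarAlgebra.Build R starQuot
  qmul qstar qmulA qmulDl qmulDr qmulZl qmulZr qstarK qstarD qstarZ qstarM.

Lemma quot_piM x y : quot_pi (x ** y) = quot_pi x ** quot_pi y.
Proof. exact: piM. Qed.

Lemma quot_pi_star x : quot_pi x^# = (quot_pi x)^#.
Proof. exact: pi_star. Qed.

End QuotientAlgebra.
Section Traces.
Variables (R : realType) (A : cstarAlgType R).
Implicit Types (a b x y : A) (tau : A -> R[i]).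

Definition opnorm (f : A -> R[i]) : \bar R :=
  ereal_sup [set (complex.Re `|f a|)%:E | a in [set a | `|a| <= 1]].

Definition is_tracial_state tau :=
  [/\ scalar tau, forall a, 0 <= tau (a^# ** a), opnorm tau = 1%E
    & forall a b, tau (a ** b) = tau (b ** a)].

Definition traces : set (A -> R[i]) := [set tau | is_tracial_state tau].

(* Compactness for the topology of pointwise convergence, that is weak-*. *)
Definition traces_compact := compact (traces : set {ptws A -> R[i]}).

Let Rnorm_ge0 (x : A) : 0 <= complex.Re `|x|.
Proof. by have := normr_ge0 x; rewrite lecE => /andP[]. Qed.

Section OneTrace.
Variable tau : A -> R[i].
Hypothesis tauP : is_tracial_state tau.

Let tau_lin : scalar tau. Proof. by case: tauP. Qed.
Let tau_ge0 a : 0 <= tau (a^# ** a). Proof. by case: tauP. Qed.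
Let tau_tr a b : tau (a ** b) = tau (b ** a). Proof. by case: tauP. Qed.
Let tau0 : tau 0 = 0.
Proof. by have := tau_lin (-1) 0 0; rewrite scaler0 addr0 mulN1r addNr. Qed.
Let tauD a b : tau (a + b) = tau a + tau b.
Proof. by have := tau_lin 1 a b; rewrite scale1r mul1r. Qed.
Let tauZ k a : tau (k *: a) = k * tau a.
Proof. by have := tau_lin k a 0; rewrite !addr0 tau0 addr0. Qed.

Let Cval (z : R[i]) : 0 <= z -> z = (complex.Re z)%:C%C.
Proof. by case: z => u v; rewrite lecE /= => /andP[/eqP-> _]. Qed.

Let normRe (z : R[i]) : `|z| = (complex.Re `|z|)%:C%C.
Proof. exact/Cval/normr_ge0. Qed.
Let anormRe (x : A) : `|x| = (complex.Re `|x|)%:C%C.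
Proof. exact/Cval/normr_ge0. Qed.

Let q a := complex.Re (tau (a^# ** a)).
Let qE a : tau (a^# ** a) = (q a)%:C%C. Proof. exact: Cval. Qed.
Let q_ge0 a : 0 <= q a.
Proof. by rewrite -ler0c -qE. Qed.

Lemma trace_le_norm a : `|tau a| <= `|a|.
Proof.
have [->|a0] := eqVneq a 0; first by rewrite tau0 !normr0.
have : complex.Re `|tau (`|a|^-1 *: a)| <= 1.
  have [_ _ tau1 _] := tauP.
  rewrite -lee_fin -tau1; apply: ereal_sup_ubound => /=.
  exists (`|a|^-1 *: a) => //=.
  by rewrite normrZ normfV normr_id mulVf // normr_eq0.
rewrite -lecR -normRe tauZ normrM normfV normr_id mulrC ler_pdivrMr ?mul1r //.
by rewrite normr_gt0.
Qed.

Let tau_herm a b : tau (b^# ** a) = ((tau (a^# ** b))^*)%C.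
Proof.
have h1 := tau_ge0 (a + b).
have h2 := tau_ge0 (a + (Complex 0 1) *: b).
move: h1 h2; rewrite !starD !starZ !smulDl !smulDr !smulZl !smulZr.
rewrite !tauD !tauZ !qE.
case: (tau (b^# ** a)) => u v; case: (tau (a^# ** b)) => u' v'.
rewrite !lecE /= => /andP[/eqP h1 _] /andP[/eqP h2 _].
by apply/eqP; rewrite eq_complex /=; apply/andP; split; apply/eqP; lra.
Qed.

Let qD a b : q (a + b) = q a + q b + complex.Re (tau (b^# ** a)) *+ 2.
Proof.
rewrite /q starD !smulDl !smulDr !tauD !raddfD /= [tau (a^# ** b)]tau_herm.
by case: (tau (b^# ** a)) => u v /=; ring.
Qed.

Let qZ k a : q (k *: a) = (complex.Re k ^+ 2 + complex.Im k ^+ 2) * q a.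
Proof.
rewrite /q starZ smulZl smulZr !tauZ qE.
by case: k => u v /=; ring.
Qed.

Lemma trace_CauchySchwarz a b :
  complex.Re (tau (b^# ** a)) ^+ 2 + complex.Im (tau (b^# ** a)) ^+ 2
  <= q a * q b.
Proof.
set t := tau (b^# ** a); pose x := complex.Re t; pose y := complex.Im t.
have H u v : 0 <= q a + (u ^+ 2 + v ^+ 2) * q b + (u * x + v * y) *+ 2.
  have := q_ge0 (a + (Complex u v) *: b).
  rewrite qD qZ starZ smulZl tauZ -/t /= /x /y.
  by clearbody t; case: t @x @y => s r /=; rewrite mulNr opprK.
rewrite -/x -/y.
have [qb0|qb0] := eqVneq (q b) 0.
  have [->|/eqP n0] := eqVneq (x ^+ 2 + y ^+ 2) 0; first by rewrite mulr_ge0.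
  pose k := (q a + 1) / (x ^+ 2 + y ^+ 2).
  have := H (- k * x) (- k * y); rewrite qb0 mulr0 addr0.
  have -> : - k * x * x + - k * y * y = - (q a + 1).
    by rewrite -!mulrA -!expr2 -mulrDr mulNr divfK //; apply/eqP.
  by have := q_ge0 a; lra.
have qb_gt0 : 0 < q b by rewrite lt_def qb0 q_ge0.
have := H (- x / q b) (- y / q b).
have -> : q a + ((- x / q b) ^+ 2 + (- y / q b) ^+ 2) * q b +
  (- x / q b * x + - y / q b * y) *+ 2 = q a - (x ^+ 2 + y ^+ 2) / q b.
  by field.
by rewrite subr_ge0 ler_pdivrMr.
Qed.

Definition tnorm a : R := Num.sqrt (q a).

Lemma tnorm_ge0 a : 0 <= tnorm a. Proof. exact: sqrtr_ge0. Qed.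

Lemma tnorm_sqr a : tnorm a ^+ 2 = q a. Proof. by rewrite sqr_sqrtr. Qed.

Lemma tnormD a b : tnorm (a + b) <= tnorm a + tnorm b.
Proof.
rewrite -(@ler_pXn2r _ 2) ?nnegrE ?addr_ge0 ?tnorm_ge0 //.
rewrite tnorm_sqr qD sqrrD !tnorm_sqr.
have -> : q a + tnorm a * tnorm b *+ 2 + q b
  = q a + q b + tnorm a * tnorm b *+ 2 by ring.
rewrite lerD2l lerMn2r /=.
apply: le_trans (ler_norm _) _.
rewrite -(@ler_pXn2r _ 2) ?nnegrE ?mulr_ge0 ?tnorm_ge0 //.
rewrite real_normK ?num_real // exprMn !tnorm_sqr.
by apply: le_trans (trace_CauchySchwarz a b); rewrite lerDl sqr_ge0.
Qed.

Lemma tnormZ k a : tnorm (k *: a) = complex.Re `|k| * tnorm a.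
Proof.
rewrite /tnorm qZ sqrtrM ?addr_ge0 ?sqr_ge0 //.
by case: k => u v; rewrite normc_def.
Qed.

Lemma tnorm_star a : tnorm a^# = tnorm a.
Proof. by rewrite /tnorm /q starK tau_tr. Qed.

Lemma norm_star a : `|a^#| = `|a|.
Proof.
suff le_star b : `|b| <= `|b^#| by apply/eqP; rewrite eq_le -{2}[a]starK !le_star.
have [->|b0] := eqVneq b 0; first by rewrite star0.
have := ler_normM b^# b; rewrite normM_star expr2 ler_pM2r ?normr_gt0 //.
Qed.

Lemma tnorm_le_norm a : tnorm a <= complex.Re `|a|.
Proof.
rewrite -(@ler_pXn2r _ 2) ?nnegrE ?tnorm_ge0 ?Rnorm_ge0 // tnorm_sqr.
have := trace_le_norm (a^# ** a); rewrite normM_star ger0_norm // qE anormRe.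
by rewrite -rmorphXn lecR.
Qed.

Let tnorm_le_sup b x : `|x| <= 1 -> q (x ** b) <= q b.
Proof.
move=> x1; pose E := [set q (x ** b) | x in [set x | `|x| <= 1]].
have Esup : has_sup E.
  split; first by exists (q (0 ** b)), 0 => //=; rewrite normr0.
  exists (complex.Re `|b| ^+ 2) => _ [y /= y1 <-].
  rewrite -tnorm_sqr ler_pXn2r ?nnegrE ?tnorm_ge0 ?Rnorm_ge0 //.
  apply: le_trans (tnorm_le_norm _) _; rewrite -lecR -!anormRe.
  by apply: le_trans (ler_normM _ _) _; rewrite ler_piMl.
have Eub v : E v -> v <= sup E by apply: sup_upper_bound.
have E0 : 0 <= sup E.
  by apply: le_trans (q_ge0 (x ** b)) (Eub _ _); exists x.
have key v : E v -> v ^+ 2 <= sup E * q b.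
  move=> [y /= y1 <-].
  have -> : q (y ** b) = complex.Re (tau (b^# ** (y^# ** y ** b))).
    by rewrite /q starM !smulA.
  apply: le_trans (_ : _ <= q (y^# ** y ** b) * q b) _.
    apply: le_trans (trace_CauchySchwarz (y^# ** y ** b) b).
    by rewrite lerDl sqr_ge0.
  apply: ler_wpM2r => //; apply: Eub; exists (y^# ** y) => //=.
  by rewrite normM_star exprn_ile1.
have supE : sup E <= Num.sqrt (sup E * q b).
  apply: ge_sup; first by case: Esup.
  move=> v Ev; rewrite -[leLHS]ger0_norm; last by case: Ev => y _ <-.
  by rewrite -sqrtr_sqr ler_wsqrtr // key.
have {}supE : sup E <= q b.
  move: supE; rewrite -(@ler_pXn2r _ 2) ?nnegrE ?sqrtr_ge0 //.
  rewrite sqr_sqrtr ?mulr_ge0 // expr2.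
  have [->|n0] := eqVneq (sup E) 0; first by rewrite q_ge0.
  by rewrite ler_pM2l // lt_def n0.
by apply: le_trans (Eub _ _) supE; exists x.
Qed.

Lemma tnormM a b : tnorm (a ** b) <= complex.Re `|a| * tnorm b.
Proof.
have [->|a0] := eqVneq a 0.
  by rewrite smul0l normr0 mul0r /tnorm /q smul0r tau0 sqrtr0.
have {1}-> : a = `|a| *: (`|a|^-1 *: a).
  by rewrite scalerA mulfV ?normr_eq0 // scale1r.
rewrite smulZl tnormZ normr_id ler_wpM2l ?Rnorm_ge0 //.
rewrite ler_wsqrtr //; apply: tnorm_le_sup.
by rewrite normrZ normfV normr_id mulVf // normr_eq0.
Qed.

End OneTrace.

Lemma norm2_has_sup a : traces !=set0 ->
  has_sup [set Num.sqrt (complex.Re (tau (a^# ** a))) | tau in traces].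
Proof.
move=> [tau0 tau0P]; split; first by eexists; exists tau0.
by exists (complex.Re `|a|) => _ [tau tauP <-]; exact: tnorm_le_norm.
Qed.

Let tnorm_le_norm2 tau a : traces tau -> tnorm tau a <= norm2 traces a.
Proof.
move=> tauP; apply: sup_upper_bound; last by exists tau.
by apply: norm2_has_sup; exists tau.
Qed.

Lemma norm2_ge0 a : 0 <= norm2 traces a.
Proof.
have [T0|/set0P[tau tauP]] := eqVneq (traces : set (A -> R[i])) set0.
  by rewrite /norm2 T0 image_set0 sup0.
exact: le_trans (tnorm_ge0 tau a) (tnorm_le_norm2 _ tauP).
Qed.

Let norm2_le a (M : R) : 0 <= M ->
  (forall tau, traces tau -> tnorm tau a <= M) -> norm2 traces a <= M.
Proof.
move=> M0 H; have [T0|/set0P[tau tauP]] := eqVneq (traces : set (A -> R[i])) set0.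
  by rewrite /norm2 T0 image_set0 sup0.
apply: ge_sup; first by eexists; exists tau.
by move=> _ [tau' tau'P <-]; exact: H.
Qed.

Lemma norm2D a b : norm2 traces (a + b) <= norm2 traces a + norm2 traces b.
Proof.
apply: norm2_le; first by rewrite addr_ge0 ?norm2_ge0.
move=> tau tauP; apply: le_trans (tnormD tauP _ _) _.
by apply: lerD; exact: tnorm_le_norm2.
Qed.

Lemma norm2Z k a : norm2 traces (k *: a) <= complex.Re `|k| * norm2 traces a.
Proof.
have k0 : 0 <= complex.Re `|k|.
  by have := normr_ge0 k; rewrite lecE => /andP[].
apply: norm2_le; first by rewrite mulr_ge0 ?norm2_ge0.
by move=> tau tauP; rewrite tnormZ // ler_wpM2l // tnorm_le_norm2.
Qed.

Lemma norm2M a b : norm2 traces (a ** b) <= complex.Re `|a| * norm2 traces b.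
Proof.
apply: norm2_le; first by rewrite mulr_ge0 ?Rnorm_ge0 ?norm2_ge0.
move=> tau tauP; apply: le_trans (tnormM tauP _ _) _.
by rewrite ler_wpM2l ?Rnorm_ge0 ?tnorm_le_norm2.
Qed.

Lemma norm2_star a : norm2 traces a^# = norm2 traces a.
Proof.
by congr sup; apply: eq_imagel => tau tauP; exact: (tnorm_star tauP).
Qed.

Lemma norm2_0 : norm2 traces 0 = 0.
Proof.
apply/eqP; rewrite eq_le norm2_ge0 andbT.
by have := norm2Z 0 0; rewrite scaler0 normr0 mul0r.
Qed.

End Traces.
Arguments traces {R} A _.

Definition separable_space (T : topologicalType) :=
  exists D : set T, countable D /\ dense D.

Record freeUltrafilter := FreeUltrafilter {
  ultra_set :> set_system nat;
  ultra_ultra : UltraFilter ultra_set;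
  ultra_free : \bigcap_(U in ultra_set) U = set0
}.
#[export] Existing Instance ultra_ultra.

Section TracialUltrapower.
Variables (R : realType) (omega : freeUltrafilter) (A : cstarAlgType R).
Implicit Types a b : nat -> A.

Definition bounded_seqs : set (nat -> A) :=
  [set a : nat -> A | exists M : R[i], forall n, `|a n| <= M].

Let bounded_sub : is_subalgebra bounded_seqs.
Proof.
split=> [|k a b [M aM] [N bN]|a b [M aM] [N bN]].
- by exists 0 => n; rewrite normr0.
- exists (`|k| * M + N) => n; apply: le_trans (ler_normD _ _) _.
  by rewrite normrZ lerD // ler_wpM2l.
- exists (M * N) => n; apply: le_trans (ler_normM _ _) _.
  by rewrite ler_pM.
Qed.

Let bounded_star a : bounded_seqs a -> bounded_seqs a^#.
Proof. by move=> [M aM]; exists M => n; rewrite norm_star. Qed.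

Definition linfty_subalg := StarSubalg bounded_sub bounded_star.

Definition linfty := subalg linfty_subalg.

Definition mk_linfty a (aB : bounded_seqs a) : linfty :=
  @Subalg R _ linfty_subalg a (mem_set aB).

Definition null_seqs : set linfty :=
  [set a | norm2 (traces A) (subalg_val a n) @[n --> ultra_set omega] --> (0 : R)].

Let null0 : null_seqs 0.
Proof.
rewrite /null_seqs /=; under eq_fun do rewrite norm2_0.
exact: cvg_cst.
Qed.

Let null_linear k (a b : linfty) :
  null_seqs a -> null_seqs b -> null_seqs (k *: a + b).
Proof.
move=> a0 b0; rewrite /null_seqs /=.
apply: (@squeeze_cvgr _ _ _ _ (cst 0)
  (fun n => complex.Re `|k| * norm2 (traces A) (subalg_val a n) +
            norm2 (traces A) (subalg_val b n))).
- apply: nearW => n; rewrite norm2_ge0 /=.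
  by apply: le_trans (norm2D _ _) _; rewrite lerD2r norm2Z.
- exact: cvg_cst.
- rewrite -(addr0 (0 : R)); apply: cvgD => //.
  by rewrite -(mulr0 (complex.Re `|k|)); apply: cvgMr.
Qed.

Let null_mull (a b : linfty) : null_seqs b -> null_seqs (a ** b).
Proof.
move=> b0; rewrite /null_seqs /=.
have /set_mem[M aM] := subalg_valP a.
apply: (@squeeze_cvgr _ _ _ _ (cst 0)
  (fun n => complex.Re M * norm2 (traces A) (subalg_val b n))).
- apply: nearW => n; rewrite norm2_ge0 /=.
  apply: le_trans (norm2M _ _) _; rewrite ler_wpM2r ?norm2_ge0 //.
  by have := aM n; rewrite lecE => /andP[].
- exact: cvg_cst.
- by rewrite -(mulr0 (complex.Re M)); apply: cvgMr.
Qed.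

Let null_star (a : linfty) : null_seqs a -> null_seqs a^#.
Proof.
have E : (fun n => norm2 (traces A) (subalg_val a^# n)) =
         (fun n => norm2 (traces A) (subalg_val a n)).
  by apply/funext => n; exact: norm2_star.
by rewrite /null_seqs /= E.
Qed.

Definition null_ideal := StarIdeal null0 null_linear null_mull null_star.

Definition ultrapower := starQuot null_ideal.

Definition ultra_pi (a : linfty) : ultrapower := quot_pi null_ideal a.

Let const_bounded (x : A) : bounded_seqs (fun=> x).
Proof. by exists `|x|. Qed.

Definition const_embed (x : A) : ultrapower := ultra_pi (mk_linfty (const_bounded x)).

Definition limit_traces : set (ultrapower -> R[i]) :=
  [set tau | exists tau_ : nat -> A -> R[i],
    (forall n, traces A (tau_ n)) /\
    forall a : linfty,
      tau_ n (subalg_val a n) @[n --> ultra_set omega] --> tau (ultra_pi a)].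

Lemma limit_traces_has_sup x : limit_traces !=set0 ->
  has_sup [set Num.sqrt (complex.Re (tau (x^# ** x))) | tau in limit_traces].
Proof.
move=> [tau0 tau0P]; split; first by eexists; exists tau0.
rewrite -[x]quot_piK; move: (repr x) => a {x}.
have /set_mem[M aM] := subalg_valP a.
exists (Num.sqrt (complex.Re (M ^+ 2 + 1))) => _ [tau [tau_ [tau_P tauE]] <-].
rewrite ler_wsqrtr //.
suff : `|tau ((ultra_pi a)^# ** ultra_pi a)| <= M ^+ 2 + 1.
  move=> h; have : complex.Re `|tau ((ultra_pi a)^# ** ultra_pi a)|
      <= complex.Re (M ^+ 2 + 1) by move: h; rewrite lecE => /andP[].
  apply: le_trans; case: (tau _) => u v; rewrite normc_def /=.
  apply: le_trans (ler_norm u) _.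
  by rewrite -sqrtr_sqr ler_wsqrtr // lerDl sqr_ge0.
have -> : (ultra_pi a)^# ** ultra_pi a = ultra_pi (a^# ** a).
  by rewrite /ultra_pi quot_piM quot_pi_star.
have /cvgr_dist_lt/(_ 1 ltr01) near1 := tauE (a^# ** a).
have [n /= tau1] := filter_ex near1.
rewrite -[tau _](subrK (tau_ n (subalg_val (a^# ** a) n))) addrC.
apply: le_trans (ler_normD _ _) _; apply: lerD; last exact: ltW.
apply: le_trans (trace_le_norm (tau_P n) _) _; rewrite normM_star.
by rewrite ler_pXn2r ?nnegrE // (le_trans _ (aM n)).
Qed.

(* The ambient assumptions on A (separability, T(A) non-empty and compact) are
   left to the user of the definition. *)
Definition uniform_property_Gamma :=
  forall n, (0 < n)%N -> exists p : 'I_n -> ultrapower,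
    [/\ forall i, is_projection (p i) /\ commutant (range const_embed) (p i),
        is_identity (\sum_(i < n) p i) &
        forall (a : A) tau i, limit_traces tau ->
          tau (const_embed a ** p i) = n%:R^-1 * tau (const_embed a)].

End TracialUltrapower.

Section LinftyUnitInterval.
Variable R : realType.
Implicit Types f g : R -> R[i].
Local Notation mu := (@lebesgue_measure R).
Local Notation I01 := (`[0, 1]%classic : set R).

#[local] Instance ae01_filter : Filter (nbhs (almost_everywhere mu)).
Proof. exact: ae_filter_ringOfSetsType. Qed.

(* Representatives are defined on the whole line, but only their restriction
   to [0, 1] matters. *)
Definition ess_bounded_funs : set (R -> R[i]) :=
  [set f : R -> R[i] | [/\ measurable_fun I01 (fun t => complex.Re (f t)),
    measurable_fun I01 (fun t => complex.Im (f t)) &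
    exists M : R[i], \forall t \ae mu, I01 t -> `|f t| <= M]].

Let ReM (z w : R[i]) : complex.Re (z * w) =
  complex.Re z * complex.Re w - complex.Im z * complex.Im w.
Proof. by case: z w => ? ? []. Qed.

Let ImM (z w : R[i]) : complex.Im (z * w) =
  complex.Re z * complex.Im w + complex.Im z * complex.Re w.
Proof. by case: z w => ? ? []. Qed.

Let ess_bounded_sub : is_subalgebra ess_bounded_funs.
Proof.
split=> [|k f g [mRf mIf [M fM]] [mRg mIg [N gN]]
  |f g [mRf mIf [M fM]] [mRg mIg [N gN]]].
- split; [exact: measurable_cst|exact: measurable_cst|].
  by exists 0; apply: nearW => t _; rewrite normr0.
- split.
  + rewrite (_ : (fun t => _) = (fun t => complex.Re k * complex.Re (f t)
      - complex.Im k * complex.Im (f t) + complex.Re (g t))); last first.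
      by apply/funext => t; rewrite -ReM -raddfD.
    apply: measurable_funD => //; apply: measurable_funB.
      by apply: measurable_funM => //; exact: measurable_cst.
    by apply: measurable_funM => //; exact: measurable_cst.
  + rewrite (_ : (fun t => _) = (fun t => complex.Re k * complex.Im (f t)
      + complex.Im k * complex.Re (f t) + complex.Im (g t))); last first.
      by apply/funext => t; rewrite -ImM -raddfD.
    apply: measurable_funD => //; apply: measurable_funD.
      by apply: measurable_funM => //; exact: measurable_cst.
    by apply: measurable_funM => //; exact: measurable_cst.
  + exists (`|k| * M + N); apply: filterS (filterI fM gN) => t [{}fM {}gN] t01.
    apply: le_trans (ler_normD _ _) _.
    by rewrite normrM lerD ?gN// ler_wpM2l ?fM.
- split.
  + rewrite (_ : (fun t => _) = (fun t => complex.Re (f t) * complex.Re (g t)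
      - complex.Im (f t) * complex.Im (g t))); last first.
      by apply/funext => t; rewrite -ReM.
    by apply: measurable_funB; apply: measurable_funM.
  + rewrite (_ : (fun t => _) = (fun t => complex.Re (f t) * complex.Im (g t)
      + complex.Im (f t) * complex.Re (g t))); last first.
      by apply/funext => t; rewrite -ImM.
    by apply: measurable_funD; apply: measurable_funM.
  + exists (M * N); apply: filterS (filterI fM gN) => t [{}fM {}gN] t01.
    by rewrite normrM ler_pM ?fM ?gN.
Qed.

Let ess_bounded_star f : ess_bounded_funs f -> ess_bounded_funs f^#.
Proof.
move=> [mRf mIf [M fM]]; split.
- rewrite (_ : (fun t => _) = (fun t => complex.Re (f t))) //.
  by apply/funext => t; rewrite /star /=; case: (f t).
- rewrite (_ : (fun t => _) = (fun t => - complex.Im (f t))).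
    exact: measurableT_comp.
  by apply/funext => t; rewrite /star /=; case: (f t).
- by exists M; apply: filterS fM => t fM t01; rewrite normcJ fM.
Qed.

Definition ess_bounded := subalg (StarSubalg ess_bounded_sub ess_bounded_star).

Definition null_funs : set ess_bounded :=
  [set f | \forall t \ae mu, I01 t -> subalg_val f t = 0].

Let null0 : null_funs 0.
Proof. exact: nearW. Qed.

Let null_linear k (f g : ess_bounded) :
  null_funs f -> null_funs g -> null_funs (k *: f + g).
Proof.
move=> f0 g0; apply: filterS (filterI f0 g0) => t [{}f0 {}g0] t01.
by rewrite /= -[LHS]/(k * subalg_val f t + subalg_val g t) f0 ?g0 ?mulr0 ?addr0.
Qed.

Let null_mull (f g : ess_bounded) : null_funs g -> null_funs (f ** g).
Proof.
move=> g0; apply: filterS g0 => t g0 t01.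
by rewrite -[LHS]/(subalg_val f t * subalg_val g t) g0 ?mulr0.
Qed.

Let null_star (f : ess_bounded) : null_funs f -> null_funs f^#.
Proof.
move=> f0; apply: filterS f0 => t f0 t01.
by rewrite -[LHS]/(((subalg_val f t)^*)%C) f0 // conjc0.
Qed.

Definition Linfty := starQuot (StarIdeal null0 null_linear null_mull null_star).

Definition Linfty_pi (f : ess_bounded) : Linfty := quot_pi _ f.

Let cst1_ess_bounded : ess_bounded_funs (cst 1).
Proof.
split; [exact: measurable_cst|exact: measurable_cst|].
by exists 1; apply: nearW => t _; rewrite normr1.
Qed.

Definition Linfty1 : Linfty :=
  Linfty_pi (@Subalg R _ (StarSubalg ess_bounded_sub ess_bounded_star)
    (cst 1) (mem_set cst1_ess_bounded)).

Lemma Linfty1_identity : is_identity Linfty1.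
Proof.
move=> x; rewrite -[x]quot_piK /Linfty1 /Linfty_pi -!quot_piM.
split; congr quot_pi; apply/val_inj/funext => t.
- exact: mul1r.
- exact: mulr1.
Qed.

Definition integral01 (f : R -> R[i]) : R[i] :=
  Complex (\int[mu]_(t in I01) complex.Re (f t))
          (\int[mu]_(t in I01) complex.Im (f t)).

End LinftyUnitInterval.

(* Main.v *)
Require Import Defs.
From HB Require Import structures.
From mathcomp Require Import all_boot all_order all_algebra.
From mathcomp Require Import all_classical all_reals all_analysis.
From mathcomp Require Import measurable_realfun complex ring lra.

Set Implicit Arguments.
Unset Strict Implicit.
Unset Printing Implicit Defensive.

Import Order.TTheory GRing.Theory Num.Theory.
Import numFieldNormedType.Exports.
Local Open Scope classical_set_scope.
Local Open Scope ring_scope.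
Local Open Scope star_scope.

(** Only one implication has content: a projection p which commutes with A and
satisfies tau(a p) = lambda tau(a) yields, over every separable S, an increasing
family of projections Q_t (0 <= t <= 1) commuting with S such that
tau(a Q_t) = t tau(a). Cutting at the points i/n gives the projections required
by uniform property Gamma, and integrating against Q_t gives the homomorphism
phi; conversely phi of the indicator function of [0, 1/2[ is a projection with
lambda = 1/2.

Reindexing ([reindexed_projection]). The properties of p are asymptotic
properties of any sequence that lifts it. So, for finitely many elements of A and
any tolerance, they hold for a single entry of that sequence. Given elements d_k of
the ultrapower, choose for each n such an entry for the n-th entries of
d_0, ..., d_(n-1): the chosen entries form a projection q that commutes with every
d_k and satisfies tau(d_k q) = lambda tau(d_k). Iterating while adding to the d_k
the products d_k q gives projections p_0, p_1, ... that are independent over S.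

The chain ([projection_chain]). Divide [0, 1] in the ratio lambda : 1 - lambda,
then each part in the same ratio, and so on. Reading p_j and its complement as the
left and right choices of the j-th division, the interval [0, t[ becomes a
2-norm limit of projections, and independence says that its trace is t.

The homomorphism ([represents], [Linfty_hom]). Finite linear combinations of the
Q_t multiply like the step functions they stand for, and the squared 2-norm of
such a combination is the integral of the square of the step function. Bounded
measurable functions are L1-limits of uniformly bounded step functions, and
bounded parts of the ultrapower are complete for the 2-norm ([n2_complete]).

Both the reindexing and the completeness argument need lifts with a norm that does
not depend on the element lifted. This is where the C*-identity enters, through
truncated exponentials instead of functional calculus. For a self-adjoint and
N t^2 |a|^2 small, (1 + i t a)^N is almost unitary, and the C*-identity alone
bounds its norm, however large |a| is. With t = tan(pi / N) the number
(1 + i t)^N is real and negative, so that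
f(a) = ((1 + i t a)^N - 1) / ((1 + i t)^N - 1) has norm at most 1 + rho while
f(0) = 0 and f(1) = 1 ([nrm_nexp]). Applied to a lift of a projection, f gives a
bounded lift of it ([liftable_proj]). Applied to a rough approximate unit, it gives
one of norm at most 1 + eps ([approx_unit]), which makes up for the missing unit of
A in Cauchy-Schwarz arguments ([tr_le_tnorm], [tnorm_dist1]).

The ultrapower has a unit ([ultrapower_unit]) because T(A) is compact: every trace
has norm one, hence is close to 1 at some contraction, so finitely many
contractions a_1, ..., a_k suffice for all traces. The maps x |-> (1 - a_i# a_i) x
contract all tracial 2-norms, so a product of the 1 - a_i# a_i is small for every
trace at once; f makes the corresponding element of A bounded. *)

(** * Identities in algebras, by computation in a commutative ring *)

(** The square-zero extension of the scalars by a module V. It is a commutative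
ring in which V embeds, scaling becoming a product, so that the [ring] tactic
proves identities between linear combinations of elements of V. *)
Definition sqz (R : realType) (V : lmodType R[i]) := (R[i] * V)%type.
Section Sqz.
Variables (R : realType) (V : lmodType R[i]).
HB.instance Definition _ := GRing.Zmodule.on (sqz V).
Let mul (x y : sqz V) : sqz V := (x.1 * y.1, x.1 *: y.2 + y.1 *: x.2).
Let one : sqz V := (1, 0).
Let mulA : associative mul.
Proof.
move=> [a x] [b y] [c z]; congr pair => /=; first exact: mulrA.
by rewrite !scalerDr !scalerA addrA [c * a]mulrC [c * b]mulrC.
Qed.
Let mulC : commutative mul.
Proof. by move=> [a x] [b y]; rewrite /mul /= mulrC addrC. Qed.
Let mul1 : left_id one mul.
Proof. by move=> [a x]; rewrite /mul /= mul1r scale1r scaler0 addr0. Qed.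
Let mulD : left_distributive mul +%R.
Proof.
by move=> [a x] [b y] [c z]; congr pair => /=; rewrite ?mulrDl // scalerDl scalerDr addrACA.
Qed.
Let one0 : one != 0.
Proof. by apply/eqP => -[/eqP]; rewrite oner_eq0. Qed.
HB.instance Definition _ := GRing.Zmodule_isComNzRing.Build (sqz V)
  mulA mulC mul1 mulD one0.
Definition sqz_scal (k : R[i]) : sqz V := (k, 0).
Definition sqz_vec (x : V) : sqz V := (0, x).
Let scalB : {morph sqz_scal : x y / x - y}.
Proof. by move=> a b; congr pair => /=; rewrite subrr. Qed.
Let scalM : {morph sqz_scal : x y / x * y}.
Proof. by move=> a b; congr pair => /=; rewrite !scaler0 addr0. Qed.
HB.instance Definition _ := GRing.isZmodMorphism.Build R[i] (sqz V) sqz_scal scalB.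
HB.instance Definition _ := GRing.isMonoidMorphism.Build R[i] (sqz V) sqz_scal
  (conj (erefl : sqz_scal 1 = 1) scalM).
Lemma sqz_vec_inj : injective sqz_vec. Proof. by move=> x y []. Qed.
Lemma sqz_vecD x y : sqz_vec (x + y) = sqz_vec x + sqz_vec y.
Proof. by congr pair; rewrite /= addr0. Qed.
Lemma sqz_vecN x : sqz_vec (- x) = - sqz_vec x.
Proof. by congr pair; rewrite /= oppr0. Qed.
Lemma sqz_vec0 : sqz_vec 0 = 0. Proof. by []. Qed.
Lemma sqz_vecZ k x : sqz_vec (k *: x) = sqz_scal k * sqz_vec x.
Proof. by congr pair; rewrite /= ?mulr0 // scale0r addr0. Qed.
End Sqz.

(** The linear identities are settled in the square-zero extension; [star_ring] first
expands products and adjoints down to monomials, which are then treated as vectors. *)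
Ltac lmod_ring := apply: sqz_vec_inj;
  rewrite ?(sqz_vecD, sqz_vecN, sqz_vecZ, sqz_vec0); ring.
Ltac star_expand := rewrite ?(smulDl, smulDr, smulNl, smulNr, smulZl, smulZr, smul0l, smul0r,
  starD, starN, starZ, starM, starK, star0, smulA).
Ltac star_ring := star_expand; lmod_ring.

Section Identity.
Variables (R : realType) (A : starAlgType R).
Implicit Types (u x : A).

Lemma identity_star u : is_identity u -> u^# = u.
Proof.
move=> uI; have h : u^# ** u = u^# by exact: (uI _).2.
by rewrite -[RHS]starK -[in RHS]h starM starK h.
Qed.

Lemma smul_suml (I : finType) (G : I -> A) x : (\sum_i G i) ** x = \sum_i G i ** x.
Proof. by elim/big_ind2: _ => [|a a' b b' <- <-|]; rewrite ?smul0l ?smulDl. Qed.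

Lemma smul_sumr (I : finType) (G : I -> A) x : x ** (\sum_i G i) = \sum_i x ** G i.
Proof. by elim/big_ind2: _ => [|a a' b b' <- <-|]; rewrite ?smul0r ?smulDr. Qed.
End Identity.

(** * Real-valued norms *)

Section RealNorm.
Context {R : realType} {V : normedModType R[i]}.
Implicit Types (x y : V) (k : R[i]).

(** Norms take their values in R[i]; this is the same norm in R, where orders are
total. On R[i] itself it is the modulus. *)
Definition nrm x : R := complex.Re `|x|.

Lemma nrmE x : `|x| = (nrm x)%:C%C.
Proof. by have /RRe_real <- : `|x| \is Num.real by apply: normr_real. Qed.

Lemma nrm_ge0 x : 0 <= nrm x.
Proof. by rewrite -ler0c -nrmE. Qed.

Lemma nrm0 : nrm 0 = 0.
Proof. by rewrite /nrm normr0. Qed.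

Lemma nrmN x : nrm (- x) = nrm x.
Proof. by rewrite /nrm normrN. Qed.

Lemma nrmD x y : nrm (x + y) <= nrm x + nrm y.
Proof. by rewrite -lecR rmorphD /= -!nrmE ler_normD. Qed.

Lemma nrmB x y : nrm (x - y) <= nrm x + nrm y.
Proof. by rewrite -(nrmN y) nrmD. Qed.

End RealNorm.

Section ComplexNorm.
Context {R : realType}.
Implicit Types (k z w : R[i]) (x : R).

Lemma nrm_sqr z : nrm z ^+ 2 = complex.Re z ^+ 2 + complex.Im z ^+ 2.
Proof.
by apply: complexI; rewrite add_Re2_Im2 nrmE rmorphXn.
Qed.

Lemma nrmMc z w : nrm (z * w) = nrm z * nrm w.
Proof. by apply: complexI; rewrite rmorphM /= -!nrmE normrM. Qed.

Lemma nrm_real x : nrm x%:C%C = `|x|.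
Proof. by rewrite /nrm normc_def /= expr0n addr0 sqrtr_sqr. Qed.

Lemma nrm_conj z : nrm (z^*)%C = nrm z.
Proof. by rewrite /nrm normcJ. Qed.

Lemma nrm1 : nrm (1 : R[i]) = 1.
Proof. by rewrite /nrm normr1. Qed.

Lemma nrm_i : nrm ('i%C : R[i]) = 1.
Proof. by rewrite /nrm normc_def /= expr0n add0r expr1n sqrtr1. Qed.

Lemma nrmV z : nrm z^-1 = (nrm z)^-1.
Proof. by apply: complexI; rewrite fmorphV /= -!nrmE normfV. Qed.

Lemma nrm_eq0 z : (nrm z == 0) = (z == 0).
Proof. by rewrite -(inj_eq (@complexI R)) -nrmE normr_eq0. Qed.

Lemma nrmXc z n : nrm (z ^+ n) = nrm z ^+ n.
Proof. by elim: n => [|n IH]; rewrite ?expr0 ?nrm1 // !exprS nrmMc IH. Qed.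

Lemma abs_Re_le z : `|complex.Re z| <= nrm z.
Proof. by rewrite -lecR -nrmE normc_ge_Re. Qed.

Lemma Re_le_nrm z : complex.Re z <= nrm z.
Proof. exact: le_trans (ler_norm _) (abs_Re_le z). Qed.

Lemma abs_Im_le z : `|complex.Im z| <= nrm z.
Proof.
rewrite -(@ler_pXn2r _ 2) ?nnegrE ?nrm_ge0 // nrm_sqr real_normK ?num_real //.
by rewrite lerDr sqr_ge0.
Qed.

Lemma nrm_le_ReIm z : nrm z <= `|complex.Re z| + `|complex.Im z|.
Proof.
rewrite {1}[z]complexE; apply: le_trans (nrmD _ _) _.
by rewrite nrmMc nrm_i mul1r !nrm_real.
Qed.

Lemma nrmZ {V : normedModType R[i]} k (v : V) : nrm (k *: v) = nrm k * nrm v.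
Proof. by apply: complexI; rewrite rmorphM /= -!nrmE normrZ. Qed.
End ComplexNorm.

Section CstarNorm.
Context {R : realType} {A : cstarAlgType R}.
Implicit Types (x y a : A).

Lemma nrmM x y : nrm (x ** y) <= nrm x * nrm y.
Proof. by rewrite -lecR rmorphM /= -!nrmE ler_normM. Qed.

Lemma nrm_starM x : nrm (x^# ** x) = nrm x ^+ 2.
Proof. by apply: complexI; rewrite rmorphXn /= -!nrmE normM_star. Qed.

Lemma nrm_star x : nrm x^# = nrm x.
Proof.
suff le_star b : nrm b <= nrm (b^# : A).
  by apply/eqP; rewrite eq_le -{2}[x]starK !le_star.
have [->|b0] := eqVneq (nrm b) 0; first exact: nrm_ge0.
have := nrmM b^# b; rewrite nrm_starM expr2 ler_pM2r // lt_def b0 nrm_ge0 //.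
Qed.
End CstarNorm.

(** * Truncated exponentials without a unit *)

(** This is (1 + i t a)^k - 1, the subtraction making sense without a unit. *)
Fixpoint dexp {R : realType} {A : starAlgType R} (t : R) (a : A) (k : nat) : A :=
  if k is k'.+1 then
    dexp t a k' + ('i * t%:C)%C *: (a + dexp t a k' ** a) else 0.

Section DexpAlgebra.
Context {R : realType} {A : starAlgType R}.
Implicit Types (a h p : A) (t : R).

Local Notation it t := ('i * t%:C)%C.

Lemma conj_it t : ((it t)^*)%C = - it t.
Proof. by apply/eqP; rewrite eq_complex /=; apply/andP; split; apply/eqP; ring. Qed.

Lemma it_sqr t : it t ^+ 2 = - (t ^+ 2)%:C%C.
Proof. by apply/eqP; rewrite eq_complex /=; apply/andP; split; apply/eqP; ring. Qed.

Lemma dexp_comm t a b k : a ** b = b ** a -> dexp t a k ** b = b ** dexp t a k.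
Proof.
move=> ab; elim: k => [|k IH] /=; first by rewrite smul0l smul0r.
by rewrite !(smulDl, smulDr, smulZl, smulZr) -smulA ab !smulA IH.
Qed.

(** With w = (1 + i t a)^k - 1, this is (1 + w)#(1 + w) - 1, which measures how far
1 + w is from being an isometry. *)
Definition defect t a k := let w := dexp t a k in w^# ** w + w + w^#.

(** Says that 1 + defect is multiplied by 1 + t^2 a^2 at each step: for a
self-adjoint, (1 - i t a)(1 + i t a) = 1 + t^2 a^2 and everything commutes. *)
Lemma defectS t a k : a^# = a ->
  defect t a k.+1 = defect t a k + (t ^+ 2)%:C%C *: (a ** a + a ** a ** defect t a k).
Proof.
move=> aE; rewrite /defect /=; set w := dexp t a k.
have aw : w ** a = a ** w by exact: dexp_comm.
have wa : w^# ** a = a ** w^# by rewrite -{1}aE -starM -aw starM aE.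
have aw' x : x ** w ** a = x ** a ** w by rewrite -!smulA aw.
have wa' x : x ** w^# ** a = x ** a ** w^# by rewrite -!smulA wa.
have -> : (t ^+ 2)%:C%C = - it t ^+ 2 by rewrite it_sqr opprK.
star_expand; rewrite conj_it aE.
rewrite !(aw, wa, aw', wa').
lmod_ring.
Qed.

(** Recursion for h (z^k - (1 + i t a)^k) with z = 1 + i t, in which the
increment involves a only through the product (h + h w)(1 - a). *)
Lemma dexp_errS t a h k (g := (1 + it t) ^+ k - 1) :
  ((1 + it t) ^+ k.+1 - 1) *: h - h ** dexp t a k.+1 =
  (1 + it t) *: (g *: h - h ** dexp t a k)
  + it t *: ((h + h ** dexp t a k) - (h + h ** dexp t a k) ** a).
Proof. by rewrite /g exprS /=; star_ring. Qed.

Lemma dexp_proj t p k : p ** p = p ->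
  dexp t p k = ((1 + it t) ^+ k - 1) *: p.
Proof.
move=> pp; elim: k => [|k IH] /=; first by rewrite expr0 subrr scale0r.
by rewrite IH exprS smulZl pp; lmod_ring.
Qed.
End DexpAlgebra.

Lemma dexp_quot_pi {R : realType} {A : starAlgType R} (I : starIdeal A) t a k :
  quot_pi I (dexp t a k) = dexp t (quot_pi I a) k.
Proof.
elim: k => [|k IH] /=; first by rewrite -(scale0r (0 : A)) quot_piZ scale0r.
by rewrite quot_piD quot_piZ quot_piD quot_piM IH.
Qed.

Section DexpNorm.
Context {R : realType} {A : cstarAlgType R}.
Implicit Types (a h : A) (t K rho : R).
Local Notation it t := ('i * t%:C)%C.

Lemma nrm_it t : nrm (it t) = `|t|.
Proof. by rewrite nrmMc nrm_i mul1r nrm_real. Qed.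

Lemma nrm_defect t a k K : a^# = a -> nrm a <= K ->
  (t * K) ^+ 2 *+ (2 * k) <= 1 -> nrm (defect t a k) <= (t * K) ^+ 2 *+ (2 * k).
Proof.
move=> aE aK; elim: k => [_|k IH tk1].
  by rewrite /defect /= star0 !addr0 smul0r nrm0.
rewrite defectS // in tk1 *.
have q0 : 0 <= (t * K) ^+ 2 by apply: sqr_ge0.
set q := (t * K) ^+ 2 in q0 tk1 IH *.
have tk : q *+ (2 * k) <= 1.
  by apply: le_trans tk1; rewrite ler_wpMn2l // leq_mul2l leqnSn.
have {}IH := IH tk.
have K0 : 0 <= K := le_trans (nrm_ge0 _) aK.
have aa : nrm (a ** a) <= K ^+ 2.
  by apply: le_trans (nrmM _ _) _; rewrite expr2 ler_pM ?nrm_ge0.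
apply: le_trans (nrmD _ _) _; rewrite nrmZ nrm_real ger0_norm ?sqr_ge0 //.
have : nrm (a ** a + a ** a ** defect t a k) <= K ^+ 2 * 2.
  apply: le_trans (nrmD _ _) _; rewrite mulr_natr mulr2n lerD //.
  apply: le_trans (nrmM _ _) _; rewrite -[leRHS]mulr1 ler_pM ?nrm_ge0 //.
  exact: le_trans tk.
move/(ler_wpM2l (sqr_ge0 t)) => h.
rewrite [(2 * _.+1)%N]mulnS [leRHS]mulrnDr addrC lerD //; apply: le_trans h _.
by rewrite mulrA -exprMn mulr_natr.
Qed.

(** The C*-identity turns w# w = defect - w - w# into |w|^2 <= rho + 2 |w|; the
bound does not depend on the bound K of |a|. *)
Lemma nrm_dexp t a k K rho : a^# = a -> nrm a <= K -> rho <= 1 ->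
  (t * K) ^+ 2 *+ (2 * k) <= rho -> nrm (dexp t a k) <= 2 + rho.
Proof.
move=> aE aK rho1 tk; have := nrm_defect aE aK (le_trans tk rho1).
move/le_trans => /(_ _ tk); rewrite /defect; set w := dexp t a k => h.
have : nrm w ^+ 2 <= rho + nrm w * 2.
  rewrite -nrm_starM.
  have -> : w^# ** w = (w^# ** w + w + w^#) - (w + w^#) by lmod_ring.
  apply: le_trans (nrmB _ _) _; rewrite lerD // mulr_natr.
  by apply: le_trans (nrmD _ _) _; rewrite nrm_star.
have := nrm_ge0 w; have rho0 := le_trans (nrm_ge0 _) h.
move: (nrm w) rho0 => x rho0 x0 hx; clear -rho0 x0 hx; rewrite leNgt; apply/negP => xlt; nra.
Qed.

(** Stated for an arbitrary seminorm because it is used for the norm and for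
tracial 2-norms. *)
Lemma dexp_err (N : A -> R) (B : R) t a h k :
  (forall x y, N (x + y) <= N x + N y) -> (forall c x, N (c *: x) <= nrm c * N x) ->
  0 <= B ->
  (forall j, (j < k)%N ->
    N ((h + h ** dexp t a j) - (h + h ** dexp t a j) ** a) <= B) ->
  N (((1 + it t) ^+ k - 1) *: h - h ** dexp t a k) <=
    (`|t| * B) *+ k * nrm (1 + it t) ^+ k.
Proof.
move=> ND NZ B0; set z := nrm _.
have N0 : N 0 <= 0 by have := NZ 0 0; rewrite scaler0 nrm0 mul0r.
have NP x : 0 <= N x.
  have := ND 0 0; rewrite (addr0 (0 : A)).
  have := ND x (- x); rewrite addrN.
  by have := NZ (-1) x; rewrite scaleN1r nrmN nrm1; lra.
have z1 : 1 <= z.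
  by apply: le_trans (Re_le_nrm _) => /=; lra.
elim: k => [_|k IH hB].
  by rewrite expr0 subrr scale0r sub0r /= smul0r oppr0 mulr0n mul0r -(scale0r h);
    apply: le_trans (NZ _ _) _; rewrite nrm0 mul0r.
rewrite dexp_errS; apply: le_trans (ND _ _) _.
rewrite mulrSr mulrDl exprS; apply: lerD.
  apply: le_trans (NZ _ _) _; rewrite -/z mulrCA ler_wpM2l ?nrm_ge0 //.
  by apply: IH => j jk; apply: hB; rewrite ltnS ltnW.
apply: le_trans (NZ _ _) _; rewrite nrm_it -[leLHS]mulr1 ler_pM ?mulr_ge0 //.
- by rewrite ler_wpM2l // hB.
- by rewrite -exprS exprn_ege1.
Qed.
End DexpNorm.

Section Trig.
Variable R : realType.
Implicit Types (x : R).

Lemma sin_le_id x : 0 <= x -> sin x <= x.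
Proof.
move=> x0; have [|c _] := @MVT_segment _ sin cos 0 x x0 (fun y _ => is_derive_sin y).
  by apply: continuous_subspaceT; exact: continuous_sin.
rewrite sin0 !subr0 => ->.
by rewrite ler_piMl // cos_le1.
Qed.

Lemma pi_le4 : (pi : R) <= 4.
Proof. have := @pihalf_lt2 R; lra. Qed.

(** Since 1 + i tan x = exp(i x) / cos x. *)
Lemma deMoivre x n : cos x != 0 ->
  (1 + 'i * (tan x)%:C)%C ^+ n = (cos (x *+ n) +i* sin (x *+ n))%C * (cos x ^- n)%:C%C.
Proof.
move=> cx; elim: n => [|n IH].
  by rewrite !expr0 mulr0n cos0 sin0 invr1 mulr1.
rewrite exprS IH mulrS cosD sinD.
apply/eqP; rewrite eq_complex /= !(mulr0, mul0r, mul1r, subr0, addr0, add0r, mulr1).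
have cn : cos x ^+ n != 0 by rewrite expf_neq0.
rewrite exprS invfM /tan.
by apply/andP; split; apply/eqP; field; rewrite cx cn.
Qed.

(** The choice t = tan(pi / N) makes (1 + i t)^N real and negative, hence the modulus
of (1 + i t)^N - 1 is the largest possible. As t <= 8 / N, the quantity t^2 N goes
to 0. *)
Lemma dexp_param (K rho : R) : 0 < rho -> exists t N,
  [/\ 0 <= t, t *+ N <= 8, (t * K) ^+ 2 *+ (2 * N) <= rho &
   nrm ((1 + 'i * t%:C)%C ^+ N - 1) = 1 + nrm ((1 + 'i * t%:C)%C ^+ N)].
Proof.
move=> rho0.
pose m := Num.bound (128 * K ^+ 2 / rho).
pose N := maxn m.+1 8.
have N8 : (8 <= N)%N by exact: leq_maxr.
have N0 : (0 : R) < N%:R by rewrite ltr0n (leq_trans _ N8).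
have N8R : (8 : R) <= N%:R by rewrite (ler_nat _ 8).
pose a : R := pi / N%:R.
have a0 : 0 <= a by rewrite divr_ge0 ?pi_ge0.
have aN : a *+ N = pi by rewrite -mulr_natr divfK // gt_eqF.
have a4 : a * N%:R <= 4 by rewrite mulr_natr aN pi_le4.
have a12 : a <= 1 / 2 by rewrite -(ler_pM2r N0); apply: le_trans a4 _; lra.
have s0 : 0 <= sin a by apply: sin_ge0_pi; rewrite a0 /=; have := @pihalf_ge1 R; lra.
have sa : sin a <= a := sin_le_id a0.
have c1 : cos a <= 1 := cos_le1 a.
have c0 : 0 < cos a.
  by apply: cos_gt0_pihalf; have := @pihalf_ge1 R; lra.
have cs := cos2Dsin2 a.
have c34 : 3 / 4 <= cos a by nra.
have cu : cos a != 0 by rewrite gt_eqF.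
pose t := tan a.
have t0 : 0 <= t by rewrite /t /tan divr_ge0 // ltW.
have ta : t <= 2 * a by rewrite /t /tan ler_pdivrMr //; nra.
have tN : t * N%:R <= 8 by nra.
exists t, N; split => //.
- by move: tN; rewrite mulr_natr.
- have : (128 * K ^+ 2 / rho) < N%:R.
    apply: lt_le_trans (archi_boundP _) _.
      by apply: divr_ge0; [apply: mulr_ge0 => //; exact: sqr_ge0|exact: ltW].
    by rewrite ler_nat (leq_trans (leqnSn _)) // leq_maxl.
  rewrite ltr_pdivrMr // -[leLHS]mulr_natr natrM => h.
  have tt : t ^+ 2 * N%:R ^+ 2 <= 64.
    rewrite -exprMn; move: tN (mulr_ge0 t0 (ltW N0)).
    by move: (t * N%:R) => y y8 y0; nra.
  rewrite -(ler_pM2r N0) [rho * _]mulrC; apply: le_trans (ltW h).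
    have -> : (t * K) ^+ 2 * (2%:R * N%:R) * N%:R = 2 * K ^+ 2 * (t ^+ 2 * N%:R ^+ 2) by ring.
  have : 2 * K ^+ 2 * (t ^+ 2 * N%:R ^+ 2) <= 2 * K ^+ 2 * 64.
    by apply: ler_wpM2l => //; apply: mulr_ge0 => //; exact: sqr_ge0.
  by move/le_trans; apply; lra.
- rewrite deMoivre // aN cospi sinpi.
  have p0 : 0 < cos a ^- N by rewrite invr_gt0 exprn_gt0.
  move: (cos a ^- N) p0 => c c_gt0.
  have -> : (-1 +i* 0)%C * c%:C%C - 1 = (- (1 + c))%:C%C.
    by apply/eqP; rewrite eq_complex /=; apply/andP; split; apply/eqP; ring.
  have -> : (-1 +i* 0)%C * c%:C%C = (- c)%:C%C.
    by apply/eqP; rewrite eq_complex /=; apply/andP; split; apply/eqP; ring.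
  by rewrite !nrm_real !normrN !gtr0_norm // addr_gt0.
Qed.
End Trig.

(** * Almost contractive functions equal to 1 at 1 *)

Section Contraction.
Context {R : realType}.
Implicit Types (t K rho : R).

(** The polynomial f(e) = ((1 + i t e)^N - 1) / ((1 + i t)^N - 1), for which f(0) = 0
and f(1) = 1. *)
Definition nexp {A : starAlgType R} t N (e : A) :=
  ((1 + 'i * t%:C)%C ^+ N - 1)^-1 *: dexp t e N.

Definition nexp_ok K t N :=
  [/\ 0 <= t, t *+ N <= 8, (t * K) ^+ 2 *+ (2 * N) <= 1 &
   nrm ((1 + 'i * t%:C)%C ^+ N - 1) = 1 + nrm ((1 + 'i * t%:C)%C ^+ N)].

Section NormalizedExponential.
Variables (K t : R) (N : nat).
Hypothesis ok : nexp_ok K t N.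
Let g := (1 + 'i * t%:C)%C ^+ N - 1.

Lemma gamma_ge2 : 2 <= nrm g.
Proof.
case: ok => _ _ _; rewrite /g => ->.
have : 1 <= nrm (1 + 'i * t%:C)%C ^+ N.
  by apply: exprn_ege1; apply: le_trans (Re_le_nrm _) => /=; lra.
by rewrite nrmXc; lra.
Qed.

Lemma gamma_neq0 : g != 0.
Proof. by rewrite -nrm_eq0 gt_eqF // (lt_le_trans _ gamma_ge2). Qed.

Lemma nexp_proj (A : starAlgType R) (p : A) : p ** p = p -> nexp t N p = p.
Proof.
by move=> pp; rewrite /nexp dexp_proj // scalerA mulVf ?scale1r // gamma_neq0.
Qed.

Variable A : cstarAlgType R.
Implicit Types (e h : A).

(** The numerator has norm at most 2 + rho by [nrm_dexp], and the denominator has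
modulus at least 2. *)
Lemma nrm_nexp e rho : e^# = e -> nrm e <= K -> rho <= 1 ->
  (t * K) ^+ 2 *+ (2 * N) <= rho -> nrm (nexp t N e) <= 1 + rho.
Proof.
move=> eE eK rho1 tr; rewrite nrmZ nrmV mulrC ler_pdivrMr.
  have := nrm_dexp eE eK rho1 tr; have := gamma_ge2; have := nrm_ge0 g.
  have : 0 <= rho by apply: le_trans tr; rewrite mulrn_wge0 // sqr_ge0.
  move: (nrm _) (nrm _) => w z r0 z0 z2 wr; nra.
by rewrite (lt_le_trans _ gamma_ge2).
Qed.

Lemma nrm_dexp3 e j : e^# = e -> nrm e <= K -> (j <= N)%N ->
  nrm (dexp t e j) <= 3.
Proof.
move=> eE eK jN; have [_ _ h _] := ok.
have -> : (3 : R) = 2 + 1 by ring.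
apply: (nrm_dexp eE eK) => //.
by apply: le_trans h; rewrite ler_wpMn2l ?sqr_ge0 // leq_mul2l.
Qed.

Lemma nexp_err (S : A -> R) (B : R) e h :
  (forall x y, S (x + y) <= S x + S y) -> (forall c x, S (c *: x) <= nrm c * S x) ->
  0 <= B ->
  (forall j, (j < N)%N ->
    S ((h + h ** dexp t e j) - (h + h ** dexp t e j) ** e) <= B) ->
  S (h - h ** nexp t N e) <= 8 * B.
Proof.
move=> SD SZ B0 hB; have := dexp_err SD SZ B0 hB; rewrite -/g.
have -> : h - h ** nexp t N e = g^-1 *: (g *: h - h ** dexp t e N).
  by rewrite scalerBr scalerA mulVf ?gamma_neq0 // scale1r /nexp smulZr.
move=> H; apply: le_trans (SZ _ _) _.
rewrite nrmV mulrC ler_pdivrMr; last by rewrite (lt_le_trans _ gamma_ge2).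
apply: le_trans H _; have [t0 tN _ gE] := ok.
rewrite (ger0_norm t0) -nrmXc -mulrnAl -mulrA [_ * nrm _]mulrC mulrA.
rewrite -mulrA [nrm _ * B]mulrC mulrA ler_pM ?mulr_ge0 ?mulrn_wge0 ?nrm_ge0 //.
  by rewrite ler_wpM2r.
by rewrite /g gE lerDr.
Qed.

(** If e acts almost as a unit on h, so does f(e): f(e) - 1 is a multiple of e - 1 by
a polynomial whose norm does not depend on the norm of e. *)
Lemma nexp_err_nrm e h : e^# = e -> nrm e <= K ->
  nrm (h - h ** nexp t N e) <= 32 * nrm (h - h ** e).
Proof.
move=> eE eK; have -> : (32 : R) = 8 * 4 by ring.
rewrite -mulrA; apply: nexp_err.
- exact: nrmD.
- by move=> c x; rewrite nrmZ.
- by rewrite mulr_ge0 ?nrm_ge0.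
- move=> j jN.
  have we : dexp t e j ** e = e ** dexp t e j by apply: dexp_comm.
  have -> : h + h ** dexp t e j - (h + h ** dexp t e j) ** e =
     (h - h ** e) + (h - h ** e) ** dexp t e j.
    by star_expand; rewrite -[h ** dexp t e j ** e]smulA we smulA; lmod_ring.
  apply: le_trans (nrmD _ _) _.
  have := nrmM (h - h ** e) (dexp t e j).
  have := nrm_dexp3 eE eK (ltnW jN); have := nrm_ge0 (h - h ** e).
  move: (nrm _) (nrm _) (nrm _) => a b c *; nra.
Qed.

Lemma nexp_err_seminorm (S : A -> R) (B : R) e h :
  (forall x y, S (x + y) <= S x + S y) -> (forall c x, S (c *: x) <= nrm c * S x) ->
  0 <= B -> e^# = e -> nrm e <= K -> (forall y, S (y - y ** e) <= nrm y * B) ->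
  S (h - h ** nexp t N e) <= 32 * (nrm h * B).
Proof.
move=> SD SZ B0 eE eK SB; have -> : (32 : R) = 8 * 4 by ring.
rewrite -mulrA; apply: nexp_err => //; first by rewrite !mulr_ge0 ?nrm_ge0.
move=> j jN; apply: le_trans (SB _) _; rewrite mulrA ler_wpM2r //.
apply: le_trans (nrmD _ _) _.
have := nrmM h (dexp t e j).
have := nrm_dexp3 eE eK (ltnW jN); have := nrm_ge0 h.
move: (nrm _) (nrm _) (nrm _) => a b c *; nra.
Qed.
End NormalizedExponential.

Lemma nexp_ok_ex K rho : 0 < rho -> rho <= 1 -> exists t N, nexp_ok K t N /\
  (t * K) ^+ 2 *+ (2 * N) <= rho.
Proof.
move=> r0 r1; have [t [N [h1 h2 h3 h4]]] := dexp_param K r0.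
by exists t, N; split=> //; split=> //; exact: le_trans r1.
Qed.
End Contraction.

(** * Approximate units *)

Lemma eps_le (R : realType) (X Y C : R) : 0 <= C ->
  (forall e : R, 0 < e -> e <= 1 -> X <= Y + C * e) -> X <= Y.
Proof.
move=> C0 H; apply/ler_addgt0Pr => e e0.
have C1 : 0 < C + 1 by lra.
pose d := Num.min 1 (e / (C + 1)).
have d0 : 0 < d by rewrite lt_min ltr01 divr_gt0.
have d1 : d <= 1 by rewrite ge_min lexx.
have de : d <= e / (C + 1) by rewrite ge_min lexx orbT.
apply: le_trans (H d d0 d1) _; rewrite lerD2l.
move: de; rewrite ler_pdivlMr //; nra.
Qed.

Section ApproxUnit.
Context {R : realType} {A : cstarAlgType R}.
Implicit Types (x y h f : A).

Lemma nrm_sum (n : nat) (F : 'I_n -> A) (C : R) :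
  (forall i, nrm (F i) <= C) -> nrm (\sum_(i < n) F i) <= C *+ n.
Proof.
elim: n F => [|n IH] F H; first by rewrite big_ord0 nrm0.
rewrite big_ord_recr mulrSr; apply: le_trans (nrmD _ _) _.
by apply: lerD => //; exact: IH.
Qed.

(** Summation of the geometric series of ratio 1 + i t h. *)
Lemma dexp_sum t h k :
  dexp t h k =
    ('i * t%:C)%C *: (k%:R *: h + (\sum_(j < k) dexp t h j) ** h).
Proof.
elim: k => [|k IH]; first by rewrite big_ord0 smul0l scale0r addr0 scaler0.
by rewrite big_ord_recr mulrSr /= {1}IH; star_ring.
Qed.

(** The average of (1 + i t h)^j over j < m tends to 0 when multiplied by h, by
summation of the geometric series. So f1 = 1 - average is an approximate unit for h,
of norm at most 3; its self-adjoint part e is one as well. Then f(e) has norm at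
most 1 + eps. The constant matters: it is what makes the trace of the virtual unit
equal to 1. *)
Lemma approx_unit h eps : h^# = h -> 0 < eps -> exists f,
  nrm f <= 1 + eps /\ nrm (h - h ** f) <= eps.
Proof.
move=> hE eps0.
pose rho := Num.min eps 1.
have rho0 : 0 < rho by rewrite lt_min eps0 ltr01.
have rho1 : rho <= 1 by rewrite ge_min lexx orbT.
have rhoe : rho <= eps by rewrite ge_min lexx.
have [s [M [sok sM]]] := nexp_ok_ex 3 rho0 rho1.
pose K := nrm h + 1.
have K0 : 0 < K by rewrite /K; have := nrm_ge0 h; lra.
(* The average has m = L^2 terms and t = 1 / (2 K L), so that m t^2 K^2 stays bounded
   while the error 3 / (m t) = 6 K / L is as small as needed. *)
pose L := (Num.bound (32 * 6 * K / eps)).+1.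
have L0 : (0 : R) < L%:R by rewrite ltr0n.
pose t := (2 * K * L%:R)^-1.
have t0 : 0 < t by rewrite invr_gt0 !mulr_gt0.
pose m := (L ^ 2)%N.
have tm : (t * K) ^+ 2 *+ (2 * m) <= 1.
  rewrite -[leLHS]mulr_natr /m natrM natrX /t.
  have -> : ((2 * K * L%:R)^-1 * K) ^+ 2 * (2 * L%:R ^+ 2) = 1 / 2 :> R.
    by field; rewrite !gt_eqF.
  lra.
have hK : nrm h <= K by rewrite /K; lra.
have w3 j : (j <= m)%N -> nrm (dexp t h j) <= 3.
  move=> jm; have -> : (3 : R) = 2 + 1 by ring.
  apply: (nrm_dexp hE hK) => //.
  by apply: le_trans tm; rewrite ler_wpMn2l ?sqr_ge0 // leq_mul2l.
pose S := \sum_(j < m) dexp t h j.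
have Sh : S ** h = h ** S.
  rewrite /S; elim: m {tm w3 S} => [|j IH]; first by rewrite !big_ord0 smul0l smul0r.
  by rewrite !big_ord_recr /= smulDl smulDr IH dexp_comm.
have m0 : (0 : R) < m%:R by rewrite ltr0n expn_gt0.
pose im : R[i] := ((m%:R)^-1 : R)%:C%C.
pose f1 := (- im) *: S.
have f1h : f1 ** h = h ** f1 by rewrite /f1 smulZl smulZr Sh.
have Sm : nrm S <= 3 *+ m by apply: nrm_sum => i; apply: w3; rewrite ltnW.
have f13 : nrm f1 <= 3.
  rewrite nrmZ nrmN nrm_real gtr0_norm ?invr_gt0 // mulrC ler_pdivrMr //.
  by rewrite mulr_natr.
have err1 : nrm (h - h ** f1) <= 6 * K / L%:R.
  have := dexp_sum t h m; rewrite -/S => wE.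
  have : ('i * (t * m%:R)%:C)%C *: (h - h ** f1) = dexp t h m.
    rewrite wE -f1h /f1.
    have -> : ('i * (t * m%:R)%:C)%C = ('i * t%:C)%C * m%:R :> R[i].
      by rewrite rmorphM /= rmorph_nat mulrA.
    have mim : m%:R * im = 1.
      by rewrite -(rmorph_nat (real_complex R)) -rmorphM /= mulfV // gt_eqF.
    rewrite -scalerA smulZl scaleNr opprK scalerDr scalerA mim scale1r.
    by [].
  move/(congr1 nrm); rewrite nrmZ nrmMc nrm_i mul1r nrm_real.
  have tm0 : 0 < t * m%:R by rewrite mulr_gt0.
  rewrite gtr0_norm // => E.
  rewrite -(ler_pM2l tm0) E; apply: le_trans (w3 _ (leqnn _)) _.
  rewrite /t /m natrX le_eqVlt; apply/orP; left; apply/eqP; field.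
  by rewrite !gt_eqF.
clearbody f1.
pose e := (1 / 2 : R)%:C%C *: (f1 + f1^#).
have conj2 : (((1 / 2 : R)%:C)^* = (1 / 2 : R)%:C)%C by rewrite conjc_real.
have eE : e^# = e by rewrite /e starZ conj2 starD starK addrC.
have e3 : nrm e <= 3.
  rewrite nrmZ nrm_real ger0_norm; last lra.
  have := nrmD f1 f1^#; rewrite nrm_star; lra.
have err2 : nrm (h - h ** e) <= 6 * K / L%:R.
  have -> : h - h ** e = (1 / 2 : R)%:C%C *: ((h - h ** f1) + (h - h ** f1)^#).
    rewrite -{1}[h]scale1r.
    have -> : (1 : R[i]) = (1 / 2 : R)%:C%C + (1 / 2 : R)%:C%C.
      by rewrite -rmorphD /= -splitr.
    have f1sh : f1^# ** h = h ** f1^# by rewrite -{1}hE -starM -f1h starM hE.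
    by rewrite /e; star_expand; rewrite hE f1sh; lmod_ring.
  rewrite nrmZ nrm_real ger0_norm; last lra.
  have := nrmD (h - h ** f1) (h - h ** f1)^#; rewrite nrm_star; lra.
exists (nexp s M e); split.
  by apply: le_trans (nrm_nexp sok eE e3 rho1 sM) _; rewrite lerD2l.
apply: le_trans (nexp_err_nrm sok h eE e3) _.
apply: le_trans (_ : _ <= 32 * (6 * K / L%:R)) _; first by rewrite ler_wpM2l.
rewrite !mulrA ler_pdivrMr // -ler_pdivrMl // mulrC; apply: ltW.
apply: lt_trans (archi_boundP _) _; last by rewrite ltr_nat.
by apply: divr_ge0; [apply: mulr_ge0 => //; exact: ltW|exact: ltW].
Qed.
End ApproxUnit.

(** * Traces and the virtual unit *)

Section Trace.
Context {R : realType} {A : cstarAlgType R}.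
Variable tau : A -> R[i].
Hypothesis tauP : is_tracial_state tau.
Implicit Types (x y z h f : A).

Lemma tr_lin k x y : tau (k *: x + y) = k * tau x + tau y.
Proof. by case: tauP => H _ _ _; rewrite H. Qed.
Lemma tr0 : tau 0 = 0.
Proof. by have := tr_lin (-1) 0 0; rewrite scaler0 addr0 mulN1r addNr. Qed.
Lemma trD x y : tau (x + y) = tau x + tau y.
Proof. by have := tr_lin 1 x y; rewrite scale1r mul1r. Qed.
Lemma trZ k x : tau (k *: x) = k * tau x.
Proof. by have := tr_lin k x 0; rewrite !addr0 tr0 addr0. Qed.
Lemma trN x : tau (- x) = - tau x.
Proof. by rewrite -scaleN1r trZ mulN1r. Qed.
Lemma trB x y : tau (x - y) = tau x - tau y.
Proof. by rewrite trD trN. Qed.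
Lemma trC x y : tau (x ** y) = tau (y ** x).
Proof. by case: tauP. Qed.
Lemma tr_ge0 x : 0 <= tau (x^# ** x).
Proof. by case: tauP. Qed.
Lemma tr_le_nrm x : nrm (tau x) <= nrm x.
Proof. by rewrite -lecR -!nrmE trace_le_norm. Qed.

Let trE := (trD, trN, trZ, tr0).

Definition tr_sq x := complex.Re (tau (x^# ** x)).

Lemma tr_sqE x : tau (x^# ** x) = (tr_sq x)%:C%C.
Proof. by rewrite /tr_sq RRe_real // ger0_real // tr_ge0. Qed.
Lemma tr_sq_ge0 x : 0 <= tr_sq x.
Proof. by rewrite -ler0c -tr_sqE tr_ge0. Qed.
Lemma tr_sq_tnorm x : tr_sq x = tnorm tau x ^+ 2.
Proof. by rewrite tnorm_sqr. Qed.
Lemma tr_CS x y : nrm (tau (y^# ** x)) <= tnorm tau x * tnorm tau y.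
Proof.
rewrite -(@ler_pXn2r _ 2) ?nnegrE ?mulr_ge0 ?nrm_ge0 ?tnorm_ge0 // exprMn.
by rewrite !(tnorm_sqr tauP) nrm_sqr trace_CauchySchwarz.
Qed.

Lemma tnorm_le_nrm x : tnorm tau x <= nrm x.
Proof. exact: tnorm_le_norm. Qed.

Lemma tr_herm x y : tau (y^# ** x) = ((tau (x^# ** y))^*)%C.
Proof.
have h1 := tr_ge0 (x + y).
have h2 := tr_ge0 (x + 'i%C *: y).
move: h1 h2; star_expand; rewrite !trE !tr_sqE.
case: (tau (y^# ** x)) => u v; case: (tau (x^# ** y)) => u' v'.
rewrite !lecE /= => /andP[/eqP h1 _] /andP[/eqP h2 _].
by apply/eqP; rewrite eq_complex /=; apply/andP; split; apply/eqP; lra.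
Qed.

Lemma nrm_small0 (z : R[i]) C : 0 <= C ->
  (forall e : R, 0 < e -> e <= 1 -> nrm z <= C * e) -> z = 0.
Proof.
move=> C0 H; apply/eqP; rewrite -nrm_eq0 eq_le nrm_ge0 andbT.
by apply: (eps_le C0) => e e0 e1; rewrite add0r H.
Qed.

(** As tau(f# h) is the conjugate of tau(h f), both being close to tau(h). *)
Lemma tr_star_sa h : h^# = h -> (tau h)^*%C = tau h.
Proof.
move=> hE; apply/eqP; rewrite eq_sym -subr_eq0; apply/eqP.
apply: (@nrm_small0 _ 2) => // e e0 e1.
have [f [_ hf]] := approx_unit hE e0.
have E : tau (f^# ** h) = ((tau (h ** f))^*)%C by rewrite tr_herm hE.
have -> : tau h - (tau h)^*%C = tau (h - f^# ** h) - ((tau (h - h ** f))^*)%C.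
  by rewrite !trB E rmorphB /=; ring.
apply: le_trans (nrmB _ _) _; rewrite nrm_conj.
have h1 := le_trans (tr_le_nrm (h - h ** f)) hf.
have : nrm (h - f^# ** h) <= e by rewrite -{1 2}hE -starM -starB nrm_star.
move/(le_trans (tr_le_nrm _)); lra.
Qed.

Lemma half2 : (1 : R[i]) = (1 / 2 : R)%:C%C + (1 / 2 : R)%:C%C.
Proof. by rewrite -rmorphD /= -splitr. Qed.

Lemma conj_half : (((1 / 2 : R)%:C)^* = (1 / 2 : R)%:C)%C.
Proof. by rewrite conjc_real. Qed.

Lemma tr_star x : tau x^# = (tau x)^*%C.
Proof.
have h1 : (x + x^#)^# = x + x^# by rewrite starD starK addrC.
have h2 : ('i%C *: (x - x^#))^# = 'i%C *: (x - x^#).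
  rewrite starZ starB starK -[x^# - x]opprB scalerN -scaleNr; congr (_ *: _).
  by apply/eqP; rewrite eq_complex /= oppr0 opprK !eqxx.
move: (tr_star_sa h1) (tr_star_sa h2); rewrite !trE.
case: (tau x) => a b; case: (tau x^#) => c d.
move=> /eqP; rewrite eq_complex /= => /andP[_ /eqP e1].
move=> /eqP; rewrite eq_complex /= => /andP[_ /eqP e2].
by apply/eqP; rewrite eq_complex /=; apply/andP; split; apply/eqP; lra.
Qed.

(** Cauchy-Schwarz against an approximate unit, whose 2-norm is at most 1 + eps. *)
Lemma tr_Re_le x : complex.Re (tau x) <= tnorm tau x.
Proof.
pose h := (1 / 2 : R)%:C%C *: (x + x^#).
have hE : h^# = h by rewrite /h starZ conj_half starD starK addrC.
have tE : complex.Re (tau h) = complex.Re (tau x).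
  by rewrite /h !trE tr_star; case: (tau x) => u v /=; lra.
have th : tnorm tau h <= tnorm tau x.
  rewrite /h tnormZ //; have := tnormD tauP x x^#; rewrite tnorm_star //.
  rewrite -/(nrm _) nrm_real ger0_norm; lra.
rewrite -tE; apply: le_trans th.
apply: (@eps_le _ _ _ (tnorm tau h + 1)); first by rewrite addr_ge0 ?tnorm_ge0.
move=> e e0 e1; have [f [f1 hf]] := approx_unit hE e0.
have -> : tau h = tau (h - h ** f) + tau (h^# ** f) by rewrite hE trB subrK.
rewrite raddfD /=.
have h1 := le_trans (Re_le_nrm _) (le_trans (tr_le_nrm _) hf).
have h2 := le_trans (Re_le_nrm _) (tr_CS f h).
have h3 : tnorm tau f <= 1 + e := le_trans (tnorm_le_nrm f) f1.
have h4 := tnorm_ge0 tau h.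
have h5 := ler_wpM2r h4 h3.
apply: le_trans (lerD h1 (le_trans h2 h5)) _.
by rewrite le_eqVlt; apply/orP; left; apply/eqP; ring.
Qed.

(** Cauchy-Schwarz against the unit that A may not have. *)
Lemma tr_le_tnorm x : nrm (tau x) <= tnorm tau x.
Proof.
have [->|t0] := eqVneq (nrm (tau x)) 0; first exact: tnorm_ge0.
have tp : 0 < nrm (tau x) by rewrite lt_def t0 nrm_ge0.
have := tr_Re_le ((tau x)^*%C *: x); rewrite tnormZ // -/(nrm _) nrm_conj trZ.
have -> : complex.Re ((tau x)^*%C * tau x) = nrm (tau x) ^+ 2.
  by rewrite nrm_sqr; case: (tau x) => u v /=; ring.
by rewrite expr2 ler_pM2l.
Qed.

(** The square of the 2-norm of 1 - x, if A had a unit of trace 1. *)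
Definition dist1 x := 1 - 2 * complex.Re (tau x) + tr_sq x.

Lemma dist1_ge0 x : 0 <= dist1 x.
Proof.
have h : complex.Re (tau x) ^+ 2 <= tr_sq x.
  rewrite tr_sq_tnorm; apply: le_trans (_ : nrm (tau x) ^+ 2 <= _).
    by rewrite nrm_sqr lerDl sqr_ge0.
  by rewrite ler_pXn2r ?nnegrE ?nrm_ge0 ?tnorm_ge0 // tr_le_tnorm.
have := sqr_ge0 (1 - complex.Re (tau x)).
rewrite sqrrB expr1n mul1r /dist1; lra.
Qed.

Lemma tr_sq_star x : tr_sq x^# = tr_sq x.
Proof. by rewrite /tr_sq starK trC. Qed.

Lemma dist1_star x : dist1 x^# = dist1 x.
Proof. by rewrite /dist1 tr_sq_star tr_star; case: (tau x). Qed.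

Lemma tr_sqM_le x y : nrm x <= 1 -> tr_sq (x ** y) <= tr_sq y.
Proof.
move=> x1; rewrite !tr_sq_tnorm ler_pXn2r ?nnegrE ?tnorm_ge0 //.
apply: le_trans (tnormM tauP _ _) _; rewrite -/(nrm _) ler_piMl // tnorm_ge0 //.
Qed.

(** With b = a (1 - x), the squared 2-norm of (1 - a# a)(1 - x) is that of 1 - x, minus
twice that of b, plus that of a# b, and a# is a contraction. *)
Lemma dist1_contract a x (g := a^# ** a) : nrm a <= 1 ->
  dist1 (g + x - g ** x) <= dist1 x.
Proof.
move=> a1; pose b := a - a ** x.
have -> : dist1 (g + x - g ** x) = dist1 x - 2 * tr_sq b + tr_sq (a^# ** b).
  rewrite (_ : g + x - g ** x = x + a^# ** b); last first.
    by rewrite /g /b; star_ring.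
  have axE : a ** x = a - b by rewrite /b; lmod_ring.
  clearbody b.
  have E : tau (x^# ** (a^# ** b)) = tau (a^# ** b) - tau (b^# ** b) - ((tau (a^# ** b))^*)%C
     + ((tau (a^# ** b))^*)%C.
    rewrite smulA -starM axE starB smulBl trB; ring.
  have E' : tau ((a^# ** b)^# ** x) = (tau (a^# ** b))^*%C - tau (b^# ** b).
    rewrite starM starK -smulA axE smulBr trB; congr (_ - _).
    by rewrite -tr_star starM starK.
  rewrite /dist1 /tr_sq !(starD, smulDl, smulDr) !trD E E'.
  case: (tau (a^# ** b)) => u v; rewrite !raddfD /=; ring.
have := tr_sqM_le b (_ : nrm a^# <= 1); rewrite nrm_star => /(_ a1).
have := tr_sq_ge0 b; lra.
Qed.
End Trace.

Lemma near_nrm (R : realType) (T : Type) (F : set_system T) {FF : Filter F}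
  (f : T -> R[i]) (z : R[i]) :
  f @ F --> z <-> forall e : R, 0 < e -> \forall t \near F, nrm (z - f t) < e.
Proof.
split=> [/cvgr_dist_lt H e e0|H].
  have := H e%:C%C; rewrite ltcR => /(_ e0); apply: filterS => t.
  by rewrite nrmE ltcR.
apply/cvgrPdist_lt => e; case: e => e e'; rewrite ltcE /= => /andP[/eqP -> e0].
by apply: filterS (H _ e0) => t; rewrite nrmE ltcR.
Qed.

Section VirtualUnit.
Context {R : realType} {A : cstarAlgType R}.
Implicit Types (x y z h f : A) (tau : A -> R[i]) (eps : R).

(** An approximate unit for h = y1# y1 + y2# y2 works for y1 and y2 in tracial
2-norms, because both terms of h have positive trace after compression. *)
Lemma approx_unit2 y1 y2 eps : 0 < eps -> exists f, nrm f <= 1 + eps /\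
  forall tau, is_tracial_state tau ->
   tnorm tau (y1 - y1 ** f) <= eps /\ tnorm tau (y2 - y2 ** f) <= eps.
Proof.
move=> e0; pose h := y1^# ** y1 + y2^# ** y2.
have hE : h^# = h by rewrite /h starD !starM !starK.
pose d := Num.min (Num.min 1 eps) (eps ^+ 2 / 3).
have d0 : 0 < d by rewrite !lt_min ltr01 e0 divr_gt0 // exprn_gt0.
have d1 : d <= 1 by rewrite !ge_min lexx.
have de : d <= eps by rewrite !ge_min lexx orbT.
have d3 : d * 3 <= eps ^+ 2 by rewrite -ler_pdivlMr // !ge_min lexx !orbT.
have [f [f1 hf]] := approx_unit hE d0.
exists f; split; first by apply: le_trans f1 _; rewrite lerD2l.
move=> tau tauP.
have E : tr_sq tau (y1 - y1 ** f) + tr_sq tau (y2 - y2 ** f) =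
    complex.Re (tau ((h - h ** f) - f^# ** (h - h ** f))).
  by rewrite /tr_sq -raddfD -trD //; congr (complex.Re (tau _)); rewrite /h; star_ring.
have : tr_sq tau (y1 - y1 ** f) + tr_sq tau (y2 - y2 ** f) <= eps ^+ 2.
  rewrite E; apply: le_trans d3; apply: le_trans (Re_le_nrm _) _.
  apply: le_trans (tr_le_nrm tauP _) _; apply: le_trans (nrmB _ _) _.
  have h1 := nrmM f^# (h - h ** f); rewrite nrm_star in h1.
  have h2 := nrm_ge0 (h - h ** f); have h3 := nrm_ge0 f.
  have h4 : nrm f * nrm (h - h ** f) <= 2 * d by apply: ler_pM => //; lra.
  lra.
have := tr_sq_ge0 tauP (y1 - y1 ** f); have := tr_sq_ge0 tauP (y2 - y2 ** f).
rewrite !(tr_sq_tnorm tauP) => h1 h2 h3.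
split; rewrite -(@ler_pXn2r _ 2) ?nnegrE ?tnorm_ge0 //; try lra; exact: ltW.
Qed.

(** Replaces y - y x by y (f - x) with f an approximate unit for y and x#; the squared
2-norm of f - x is then close to [dist1]. *)
Lemma tnorm_dist1 tau x y : is_tracial_state tau ->
  tnorm tau (y - y ** x) <= nrm y * Num.sqrt (dist1 tau x).
Proof.
move=> tauP.
have Y0 := nrm_ge0 y; have D0 := dist1_ge0 tauP x.
set s := Num.sqrt _; have s0 : 0 <= s by apply: sqrtr_ge0.
have ss : s ^+ 2 = dist1 tau x by apply: sqr_sqrtr.
apply: (@eps_le _ _ _ (1 + 3 * nrm y)); first lra.
move=> e e0 e1.
have ee0 : 0 < e ^+ 2 by rewrite exprn_gt0.
have ee : e ^+ 2 <= e by rewrite expr2 ler_piMr // ltW.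
have [f [f1 H]] := approx_unit2 y x^# ee0.
have [h1 h2] := H _ tauP.
have fx : tnorm tau (f - x) <= s + 3 * e.
  have se0 : 0 <= s + 3 * e by rewrite addr_ge0 // mulr_ge0 // ltW.
  rewrite -(@ler_pXn2r _ 2) ?nnegrE ?tnorm_ge0 // -(tr_sq_tnorm tauP).
  have -> : tr_sq tau (f - x) = dist1 tau x + (tr_sq tau f - 1)
      + 2 * complex.Re (tau (x - f^# ** x)).
    rewrite /dist1 /tr_sq starB !(smulBl, smulBr) !trB //.
    rewrite (tr_herm tauP x f) !raddfB /=.
    by case: (tau (x^# ** f)) => u v /=; ring.
  have hf : tr_sq tau f <= (1 + e ^+ 2) ^+ 2.
    rewrite (tr_sq_tnorm tauP) ler_pXn2r ?nnegrE ?tnorm_ge0 //;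
      last by rewrite addr_ge0 // ltW.
    exact: le_trans (tnorm_le_nrm tauP _) f1.
  have hx : complex.Re (tau (x - f^# ** x)) <= e ^+ 2.
    apply: le_trans (Re_le_nrm _) _; apply: le_trans (tr_le_tnorm tauP _) _.
    by apply: le_trans h2; rewrite -(tnorm_star tauP) starB starM starK.
  rewrite -ss; nra.
have -> : y - y ** x = (y - y ** f) + y ** (f - x) by star_ring.
apply: le_trans (tnormD tauP _ _) _.
have h3 := tnormM tauP y (f - x).
have h4 : nrm y * tnorm tau (f - x) <= nrm y * (s + 3 * e) by apply: ler_wpM2l.
rewrite -/(nrm _) in h3.
apply: le_trans (lerD h1 (le_trans h3 h4)) _.
have -> : nrm y * s + (1 + 3 * nrm y) * e = e + nrm y * (s + 3 * e) by ring.
by rewrite lerD2r.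
Qed.

Lemma trace_near1 tau eps : is_tracial_state tau -> 0 < eps -> exists x,
  nrm x <= 1 /\ 1 - eps < complex.Re (tau x).
Proof.
move=> tauP e0; have [_ _ t1 _] := tauP.
have : ((1 - eps)%:E < opnorm tau)%E by rewrite t1 lte_fin; lra.
rewrite /opnorm => /ereal_sup_gt [_ [a /= a1 <-]]; rewrite lte_fin => h.
change (is_true (1 - eps < nrm (tau a))) in h.
have a1' : nrm a <= 1 by rewrite -lecR -nrmE.
have [t0|t0] := eqVneq (tau a) 0.
  exists a; split => //; move: h; rewrite t0 nrm0 => h /=; lra.
exists (((tau a)^*%C / `|tau a|) *: a); split.
  rewrite nrmZ nrmMc nrmV nrm_conj.
  have -> : nrm `|tau a| = nrm (tau a) by rewrite /nrm normr_id.
  by rewrite mulfV ?mul1r // nrm_eq0.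
by rewrite trZ // mulrAC [_ * tau a]mulrC -sqr_normc expr2 mulfK ?normr_eq0 //.
Qed.

(** * The unit of the tracial ultrapower *)

(** Near each trace some contraction is still almost of trace 1; compactness of T(A)
leaves finitely many of them. The covering argument runs along the filter of
finite lists ordered by inclusion. *)
Lemma trace_cover eps : traces_compact A -> 0 < eps -> exists s : seq A,
  (forall x, x \in s -> nrm x <= 1) /\
  forall tau, is_tracial_state tau -> exists2 x, x \in s & 1 - eps < complex.Re (tau x).
Proof.
rewrite /traces_compact => /compact_near_coveringP cT e0.
pose F : set_system (seq A) := [set B | exists s0 : seq A,
  forall s : seq A, {subset s0 <= s} -> B s].
have FF : Filter F.
  split; first by exists nil.
    move=> B C [s1 H1] [s2 H2]; exists (s1 ++ s2) => s ss; split.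
      by apply: H1 => x xs; apply: ss; rewrite mem_cat xs.
    by apply: H2 => x xs; apply: ss; rewrite mem_cat xs orbT.
  by move=> B C BC [s0 H]; exists s0 => s /H/BC.
pose P (s : seq A) (tau : {ptws A -> R[i]}) := exists x, [/\ x \in s, nrm x <= 1 &
  1 - eps < complex.Re (tau x)].
have [|s0 /(_ s0 (fun x xs => xs)) H] := cT (seq A) F P FF.
  move=> tau tauT; have [x [x1 h]] := trace_near1 tauT e0.
  have : (fun sigma : {ptws A -> R[i]} => sigma x) @ nbhs tau --> tau x.
    exact: (@proj_continuous A (fun=> R[i]) x tau).
  move/near_nrm => /(_ (complex.Re (tau x) - (1 - eps))) near1.
  exists ([set sigma : {ptws A -> R[i]} |
      nrm (tau x - sigma x) < complex.Re (tau x) - (1 - eps)], [set s : seq A | x \in s]).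
    split => /=; first by apply: near1; rewrite subr_gt0.
    by exists [:: x] => s; apply; rewrite inE.
  move=> [sigma s] /= [h1 xs]; exists x; split => //.
  have := le_lt_trans (Re_le_nrm _) h1; rewrite raddfB /=; lra.
exists [seq x <- s0 | nrm x <= 1]; split.
  by move=> x; rewrite mem_filter => /andP[].
move=> tau /H[x [xs x1 h]]; exists x => //.
by rewrite mem_filter x1.
Qed.

(** The circle product: 1 - circ x y = (1 - x)(1 - y). *)
Definition circ x y : A := x + y - x ** y.

Lemma circ_star x y : (circ x y)^# = circ y^# x^#.
Proof. by rewrite /circ; star_ring. Qed.

Lemma circA x y z : circ x (circ y z) = circ (circ x y) z.
Proof. by rewrite /circ; star_ring. Qed.

(** For g_i = a_i# a_i, the element 1 - e is the palindromic product
(1 - g_1) ... (1 - g_k)(1 - g_k) ... (1 - g_1), hence e is self-adjoint. Each factor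
contracts 2-norms on both sides, so 1 - e is at most as large as the factor that is
small for the given trace. *)
Lemma almost_unit_sa eps : traces_compact A -> 0 < eps -> exists e : A,
  e^# = e /\ forall tau, is_tracial_state tau -> dist1 tau e <= eps.
Proof.
move=> cT e0; pose d := Num.min 1 (eps / 2).
have d0 : 0 < d by rewrite lt_min ltr01 divr_gt0.
have d1 : d <= 1 by rewrite ge_min lexx.
have de : d * 2 <= eps by rewrite -ler_pdivlMr // ge_min lexx orbT.
have [s [s1 scov]] := trace_cover cT d0.
suff [e [eE _ e1]] : exists e : A, [/\ e^# = e,
    forall tau, is_tracial_state tau -> forall x, dist1 tau (circ e x) <= dist1 tau x &
    forall tau x, is_tracial_state tau -> x \in s -> 1 - d < complex.Re (tau x) ->
      dist1 tau e <= eps].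
  exists e; split => // tau tauP; have [x xs tx] := scov tau tauP.
  exact: e1 xs tx.
elim: s s1 {scov} => [|a s IH] s1.
  exists 0; split=> // [|tau tauP x]; first exact: star0.
    by rewrite /circ smul0l subr0 add0r.
have [|e [eE eC e1]] := IH; first by move=> x xs; apply: s1; rewrite inE xs orbT.
have a1 : nrm a <= 1 by apply: s1; rewrite inE eqxx.
pose g := a^# ** a.
have gE : g^# = g by rewrite /g starM starK.
have gC tau (tauP : is_tracial_state tau) x : dist1 tau (circ g x) <= dist1 tau x.
  exact: dist1_contract.
exists (circ g (circ e g)); split => //.
- by rewrite !circ_star eE gE circA.
- move=> tau tauP x; rewrite -!circA.
  by apply: le_trans (gC _ tauP _) _; apply: le_trans (eC _ tauP _) _; exact: gC.
- move=> tau x tauP; rewrite inE => /predU1P[->|xs] tx.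
    apply: le_trans (gC _ tauP _) _; apply: le_trans (eC _ tauP _) _.
    have h1 : tr_sq tau g <= tr_sq tau a by rewrite /g tr_sqM_le // nrm_star.
    have h2 : complex.Re (tau a) ^+ 2 <= tr_sq tau a.
      rewrite (tr_sq_tnorm tauP); apply: le_trans (_ : nrm (tau a) ^+ 2 <= _).
        by rewrite nrm_sqr lerDl sqr_ge0.
      by rewrite ler_pXn2r ?nnegrE ?nrm_ge0 ?tnorm_ge0 // tr_le_tnorm.
    have -> : dist1 tau g = 1 - 2 * tr_sq tau a + tr_sq tau g by [].
    nra.
  apply: le_trans (gC _ tauP _) _.
  rewrite -(dist1_star tauP) circ_star eE gE; apply: le_trans (gC _ tauP _) _.
  exact: e1 xs tx.
Qed.

Lemma norm2_sup_le (M : R) x : 0 <= M ->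
  (forall tau, is_tracial_state tau -> tnorm tau x <= M) -> norm2 (traces A) x <= M.
Proof.
move=> M0 H; have [T0|/set0P[tau tauP]] := eqVneq (traces A) set0.
  by rewrite /norm2 T0 image_set0 sup0.
by apply: ge_sup; [eexists; exists tau|move=> _ [tau' tau'P <-]; exact: H].
Qed.

Lemma tnorm_le_norm2 tau x : is_tracial_state tau -> tnorm tau x <= norm2 (traces A) x.
Proof.
move=> tauP; apply: sup_upper_bound; last by exists tau.
by apply: norm2_has_sup; exists tau.
Qed.

(** The norm of the self-adjoint almost unit e depends on eps; that of f(e) does not. *)
Lemma almost_unit eps : traces_compact A -> 0 < eps -> exists f : A,
  nrm f <= 2 /\ forall y, norm2 (traces A) (y - y ** f) <= eps * nrm y.
Proof.
move=> cT e0; pose d := eps / 32.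
have d0 : 0 < d by rewrite divr_gt0.
have dd : 0 < d ^+ 2 by rewrite exprn_gt0.
have [e [eE eD]] := almost_unit_sa cT dd.
have [t [N [ok tN]]] := nexp_ok_ex (nrm e) (ltr01 : 0 < (1 : R)) (lexx _).
exists (nexp t N e); split.
  by have := nrm_nexp ok eE (lexx _) (lexx _) tN; have -> : (1 + 1 : R) = 2 by ring.
move=> y; apply: norm2_sup_le; first by rewrite mulr_ge0 ?nrm_ge0 // ltW.
move=> tau tauP.
have -> : eps * nrm y = 32 * (nrm y * d) by rewrite /d; field.
apply: (nexp_err_seminorm ok) => //.
- exact: tnormD.
- by move=> c x; rewrite tnormZ.
- exact: ltW.
- move=> z; apply: le_trans (tnorm_dist1 _ _ tauP) _.
  rewrite ler_wpM2l ?nrm_ge0 //.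
  have -> : d = Num.sqrt (d ^+ 2) by rewrite sqrtr_sqr gtr0_norm.
  by rewrite ler_wsqrtr // eD.
Qed.
End VirtualUnit.

(** * Limits along a free ultrafilter *)

Section UltraLim.
Variable omega : freeUltrafilter.
Local Notation om := (ultra_set omega).

Lemma free_ge k : \forall n \near om, (k <= n)%N.
Proof.
elim: k => [|k IH]; first exact: nearW.
suff H : \forall n \near om, n != k.
  by apply: filterS (filterI IH H) => n [/= kn nk]; rewrite ltn_neqAle eq_sym nk.
have [U omU nU] : exists2 U, om U & ~ U k.
  apply: contrapT => H; suff : (\bigcap_(U in om) U) k by rewrite ultra_free.
  by move=> U omU; apply: contrapT => nU; apply: H; exists U.
by apply: filterS omU => n Un; apply/eqP => nk; apply: nU; rewrite -nk.
Qed.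

Lemma ultra_not (P : set nat) : ~ (\forall n \near om, P n) -> \forall n \near om, ~ P n.
Proof. by have [//|//] := in_ultra_setVsetC P (ultra_ultra omega). Qed.

Lemma ultra_fmap (T : Type) (u : nat -> T) : UltraFilter (u @ om).
Proof.
split=> [|G GF sub]; first exact: fmap_proper_filter.
apply/seteqP; split=> // B GB; apply: contrapT => nB.
have GnB : G (~` B) by apply: sub; exact: (ultra_not nB).
by have [t [Bt nBt]] := @filter_ex _ G _ _ (filterI GB GnB).
Qed.

Context {R : realType}.

Lemma ultra_lim_real (u : nat -> R) (M : R) : (forall n, `|u n| <= M) ->
  exists l : R, u @ om --> l.
Proof.
move=> uM; have := @segment_compact R (- M) M; rewrite compact_ultra.
move=> /(_ (u @ om) (ultra_fmap u)) [].
  by apply: nearW => n /=; rewrite in_itv /= -ler_norml.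
by move=> l [_ ul]; exists l.
Qed.

Lemma near_nrmC (F : set_system nat) {FF : Filter F} (f : nat -> R[i]) (z : R[i]) :
  (fun n => complex.Re (f n)) @ F --> complex.Re z ->
  (fun n => complex.Im (f n)) @ F --> complex.Im z -> f @ F --> z.
Proof.
move=> /cvgr_dist_lt fR /cvgr_dist_lt fI; apply/near_nrm => e e0.
have e2 : 0 < e / 2 by rewrite divr_gt0.
apply: filterS (filterI (fR _ e2) (fI _ e2)) => n [/= h1 h2].
apply: le_lt_trans (nrm_le_ReIm _) _; rewrite !raddfB /=; lra.
Qed.

Lemma ultra_lim_C (u : nat -> R[i]) (M : R) : (forall n, nrm (u n) <= M) ->
  exists l : R[i], u @ om --> l.
Proof.
move=> uM.
have [a ha] := ultra_lim_real (fun n => le_trans (abs_Re_le (u n)) (uM n)).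
have [b hb] := ultra_lim_real (fun n => le_trans (abs_Im_le (u n)) (uM n)).
by exists (a +i* b)%C; apply: near_nrmC.
Qed.

Lemma cvg_Re (F : set_system nat) {FF : Filter F} (f : nat -> R[i]) (z : R[i]) :
  f @ F --> z -> (fun n => complex.Re (f n)) @ F --> complex.Re z.
Proof.
move=> /near_nrm H; apply/cvgrPdist_lt => e e0.
apply: filterS (H e e0) => n; apply: le_lt_trans.
by rewrite -raddfB; exact: abs_Re_le.
Qed.

Lemma cvgC_unique (F : set_system nat) {FF : ProperFilter F} (f : nat -> R[i]) (z w : R[i]) :
  f @ F --> z -> f @ F --> w -> z = w.
Proof.
move=> /near_nrm hz /near_nrm hw; apply/eqP; rewrite -subr_eq0 -nrm_eq0 eq_le nrm_ge0 andbT.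
apply/ler_addgt0Pr => e e0; have e2 : 0 < e / 2 by rewrite divr_gt0.
have [n [/= h1 h2]] := filter_ex (filterI (hz _ e2) (hw _ e2)).
have -> : z - w = (z - f n) - (w - f n) by ring.
apply: le_trans (nrmB _ _) _; lra.
Qed.

Lemma cvgC_squeeze (F : set_system nat) {FF : Filter F}
  (f g : nat -> R[i]) (d : nat -> R) (z : R[i]) :
  f @ F --> z -> (\forall n \near F, nrm (f n - g n) <= d n) ->
  d @ F --> (0 : R) -> g @ F --> z.
Proof.
move=> /near_nrm fz fg /cvgr_dist_lt d0; apply/near_nrm => e e0.
have e2 : 0 < e / 2 by rewrite divr_gt0.
near=> n; have -> : z - g n = (z - f n) + (f n - g n) by ring.
have h1 : nrm (z - f n) < e / 2 by near: n; exact: fz.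
have h2 : nrm (f n - g n) <= d n by near: n.
have h3 : `|0 - d n| < e / 2 by near: n; exact: d0.
have h4 := ler_norm (d n); rewrite sub0r normrN in h3.
apply: le_lt_trans (nrmD _ _) _; lra.
Unshelve. all: by end_near.
Qed.
End UltraLim.

(** * Limit traces and the 2-norm of the ultrapower *)

Section Ultrapower.
Context {R : realType} (omega : freeUltrafilter) {A : cstarAlgType R}.
Local Notation om := (ultra_set omega).
Local Notation U := (ultrapower omega A).
Local Notation pi := (@ultra_pi R omega A).
Local Notation T := (traces A).
Local Notation val := (@subalg_val R _ _).
Local Notation n2A := (norm2 (traces A)).
Implicit Types (a b : linfty A) (x y z : U).

Lemma piD a b : pi (a + b) = pi a + pi b. Proof. exact: quot_piD. Qed.
Lemma piM a b : pi (a ** b) = pi a ** pi b. Proof. exact: quot_piM. Qed.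
Lemma piZ k a : pi (k *: a) = k *: pi a. Proof. exact: quot_piZ. Qed.
Lemma pi_star a : pi a^# = (pi a)^#. Proof. exact: quot_pi_star. Qed.
Lemma piN a : pi (- a) = - pi a. Proof. by rewrite -scaleN1r piZ scaleN1r. Qed.
Lemma piB a b : pi (a - b) = pi a - pi b. Proof. by rewrite piD piN. Qed.
Lemma pi_surj x : exists a, pi a = x.
Proof. by exists (repr x); exact: quot_piK. Qed.

Lemma ultra_piP a b : pi a = pi b <-> n2A (val a n - val b n) @[n --> om] --> (0 : R).
Proof. by split => [/quot_piP|H]; [|apply/quot_piP]. Qed.

Lemma seq_lift (a : nat -> A) C : (forall n, nrm (a n) <= C) ->
  exists b, val b = a.
Proof.
move=> aC; have aB : bounded_seqs a by exists C%:C%C => n; rewrite nrmE lecR.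
by exists (mk_linfty aB).
Qed.

Lemma linfty_bound a : exists2 C, 0 <= C & forall n, nrm (val a n) <= C.
Proof.
have /set_mem[M aM] := subalg_valP a.
exists (complex.Re M) => [|n].
  by have := le_trans (normr_ge0 _) (aM 0%N); rewrite lecE => /andP[].
by have := aM n; rewrite lecE => /andP[].
Qed.

(** A limit trace is well defined on classes because traces are dominated by the
2-norm. *)
Lemma limit_trace_ex (ts : nat -> A -> R[i]) : (forall n, T (ts n)) ->
  exists2 tau : U -> R[i], limit_traces tau &
    forall a, ts n (val a n) @[n --> om] --> tau (pi a).
Proof.
move=> tsT.
have ex x : exists l : R[i], ts n (val (repr x) n) @[n --> om] --> l.
  have [C _ H] := linfty_bound (repr x).
  apply: (@ultra_lim_C omega R _ C) => n.
  have h := tr_le_nrm (tsT n) (val (repr x) n).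
  exact: le_trans h (H n).
pose tau x := projT1 (cid (ex x)).
have tauE a : ts n (val a n) @[n --> om] --> tau (pi a).
  have := projT2 (cid (ex (pi a))); rewrite -/(tau (pi a)) => H.
  have E : pi (repr (pi a)) = pi a by exact: quot_piK.
  move/ultra_piP: E; apply: cvgC_squeeze H _.
  apply: nearW => n; rewrite -(trB (tsT n)); apply: le_trans (tr_le_tnorm (tsT n) _) _.
  exact: (tnorm_le_norm2 _ (tsT n)).
by exists tau => //; exists ts.
Qed.
End Ultrapower.

(** Compares f with a contraction y whose trace is almost 1, as f - f y is small in
2-norm and y - y f as well. *)
Lemma almost_unit_trace (R : realType) (A : cstarAlgType R) (eps : R) (f : A) tau :
  nrm f <= 2 -> (forall y, norm2 (traces A) (y - y ** f) <= eps * nrm y) ->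
  is_tracial_state tau -> 0 <= eps -> nrm (1 - tau f) <= eps.
Proof.
move=> f2 fU tauP eps0; apply: (@eps_le _ _ _ 3) => // e e0 e1.
pose d := e ^+ 2 / 2.
have d0 : 0 < d by rewrite divr_gt0 ?exprn_gt0.
have [y [y1 ty]] := trace_near1 tauP d0.
have t1 := le_trans (tr_le_nrm tauP y) y1.
have e2d : 2 * d = e ^+ 2 by rewrite /d; field.
have ty1 : nrm (1 - tau y) <= e.
  rewrite -(@ler_pXn2r _ 2) ?nnegrE ?nrm_ge0 //; last exact: ltW.
  have : nrm (tau y) ^+ 2 <= 1 by rewrite exprn_ile1 ?nrm_ge0.
  rewrite !nrm_sqr raddfB raddfB /=; nra.
have D : dist1 tau y <= e ^+ 2.
  have : tr_sq tau y <= 1.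
    by rewrite (tr_sq_tnorm tauP) exprn_ile1 ?tnorm_ge0 // (le_trans (tnorm_le_nrm tauP y)).
  rewrite /dist1; lra.
have fy : nrm (tau f - tau (f ** y)) <= 2 * e.
  rewrite -(trB tauP); apply: le_trans (tr_le_tnorm tauP _) _.
  apply: le_trans (tnorm_dist1 _ _ tauP) _; apply: ler_pM; rewrite ?nrm_ge0 ?sqrtr_ge0 //.
  have -> : e = Num.sqrt (e ^+ 2) by rewrite sqrtr_sqr gtr0_norm.
  by rewrite ler_wsqrtr.
have yf : nrm (tau y - tau (y ** f)) <= eps.
  rewrite -(trB tauP); apply: le_trans (tr_le_tnorm tauP _) _.
  apply: le_trans (tnorm_le_norm2 _ tauP) _; apply: le_trans (fU _) _.
  by rewrite ler_piMr.
rewrite (trC tauP y f) in yf.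
have -> : 1 - tau f = (1 - tau y) + ((tau y - tau (f ** y)) - (tau f - tau (f ** y))) by ring.
apply: le_trans (nrmD _ _) _; apply: le_trans (lerD (lexx _) (nrmB _ _)) _; lra.
Qed.

Section LimitTraces.
Context {R : realType} (omega : freeUltrafilter) {A : cstarAlgType R}.
Local Notation om := (ultra_set omega).
Local Notation U := (ultrapower omega A).
Local Notation pi := (@ultra_pi R omega A).
Local Notation T := (traces A).
Local Notation val := (@subalg_val R _ _).
Local Notation n2A := (norm2 (traces A)).
Implicit Types (a b : linfty A) (x y z : U) (tau : U -> R[i]).

Lemma cvg_om (X : topologicalType) (u : nat -> X) (l : X) : u @ \oo --> l -> u @ om --> l.
Proof.
move=> H B /H [N _ NB]; apply: filterS (free_ge omega N) => n; exact: NB.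
Qed.

Lemma cvgC_lin (f g : nat -> R[i]) (k z w : R[i]) :
  f @ om --> z -> g @ om --> w -> (fun n => k * f n + g n) @ om --> k * z + w.
Proof.
move=> /near_nrm fz /near_nrm gw; apply/near_nrm => e e0.
have k1 : 0 < nrm k + 1 by have := nrm_ge0 k; lra.
have d0 : 0 < e / (nrm k + 1) / 2 by rewrite !divr_gt0.
have e2 : 0 < e / 2 by rewrite divr_gt0.
apply: filterS (filterI (fz _ d0) (gw _ e2)) => n [/= h1 h2].
have -> : k * z + w - (k * f n + g n) = k * (z - f n) + (w - g n) by ring.
apply: le_lt_trans (nrmD _ _) _; rewrite nrmMc.
have : (nrm k + 1) * nrm (z - f n) < e / 2.
  by rewrite mulrC -ltr_pdivlMr // mulrAC.
have := nrm_ge0 (z - f n); lra.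
Qed.

Lemma cvgR_ge (f : nat -> R) (l M : R) : f @ om --> l -> (forall n, M <= f n) -> M <= l.
Proof.
move=> fl fM; by apply: (ler_cvg_to (cvg_cst M) fl); exact: nearW.
Qed.

Section OneTrace.
Variable tau : U -> R[i].
Hypothesis tauP : limit_traces tau.

Lemma limtr_lin k x y : tau (k *: x + y) = k * tau x + tau y.
Proof.
have [ts [tsT H]] := tauP; have [a <-] := pi_surj x; have [b <-] := pi_surj y.
rewrite -piZ -piD; apply: cvgC_unique (H _) _.
have := cvgC_lin (k := k) (H a) (H b).
by under eq_fun do rewrite -(tr_lin (tsT _)).
Qed.
Lemma limtr0 : tau 0 = 0.
Proof. by have := limtr_lin (-1) 0 0; rewrite scaler0 addr0 mulN1r addNr. Qed.
Lemma limtrD x y : tau (x + y) = tau x + tau y.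
Proof. by have := limtr_lin 1 x y; rewrite scale1r mul1r. Qed.
Lemma limtrZ k x : tau (k *: x) = k * tau x.
Proof. by have := limtr_lin k x 0; rewrite !addr0 limtr0 addr0. Qed.
Lemma limtrN x : tau (- x) = - tau x.
Proof. by rewrite -scaleN1r limtrZ mulN1r. Qed.
Lemma limtrB x y : tau (x - y) = tau x - tau y.
Proof. by rewrite limtrD limtrN. Qed.

Lemma limtr_sq_cvg a :
  tr_sq (projT1 (cid tauP) n) (val a n) @[n --> om] --> complex.Re (tau ((pi a)^# ** pi a)).
Proof.
have [tsT H] := projT2 (cid tauP).
by rewrite -pi_star -piM; apply: cvg_Re; exact: H.
Qed.

End OneTrace.

Hypothesis T0 : T !=set0.

(** The norm of the ultrapower used below; A^omega is complete on bounded parts for it,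
and it separates points. *)
Definition n2 (x : U) : R := norm2 (limit_traces (omega := omega) (A := A)) x.

Lemma limit_traces_nonempty : limit_traces (omega := omega) (A := A) !=set0.
Proof.
have [t tT] := T0; have [tau tauP _] := @limit_trace_ex R omega A (fun=> t) (fun=> tT).
by exists tau.
Qed.

Lemma n2A_le a : exists2 C, 0 <= C & forall n, n2A (val a n) <= C.
Proof.
have [C C0 H] := linfty_bound a; exists C => // n.
apply: norm2_sup_le => // tau tauP; exact: le_trans (tnorm_le_nrm tauP _) (H n).
Qed.

(** For the lower bound, choose for each n a trace that almost attains the 2-norm of
the n-th entry. *)
Lemma n2_cvg a : n2A (val a n) @[n --> om] --> n2 (pi a).
Proof.
have [C C0 HC] := n2A_le a.
have [L HL] : exists L : R, n2A (val a n) @[n --> om] --> L.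
  by apply: (@ultra_lim_real omega R _ C) => n; rewrite ger0_norm ?norm2_ge0.
suff -> : n2 (pi a) = L by [].
have L0 : 0 <= L by apply: (cvgR_ge HL) => n; exact: norm2_ge0.
have supP := limit_traces_has_sup (pi a) limit_traces_nonempty.
apply/eqP; rewrite eq_le; apply/andP; split.
  apply: ge_sup; first by case: supP.
  move=> _ [tau tauP <-]; have [tsT _] := projT2 (cid tauP).
  apply: (ler_cvg_to _ HL).
    by apply: continuous_cvg (@limtr_sq_cvg tau tauP a); exact: sqrt_continuous.
  by apply: nearW => n; exact: (tnorm_le_norm2 _ (tsT n)).
have ex n : exists t, T t /\ n2A (val a n) - harmonic n <= tnorm t (val a n).
  have [_ [t tT <-] h] := sup_adherent (harmonic_gt0 n : 0 < (harmonic n : R))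
    (norm2_has_sup (val a n) T0).
  by exists t; split => //; exact: ltW.
have [ts tsP] := choice ex.
have [tau tauP tauE] := limit_trace_ex omega (fun n => (tsP n).1).
apply: le_trans (_ : Num.sqrt (complex.Re (tau ((pi a)^# ** pi a))) <= _); last first.
  by apply: sup_upper_bound => //; exists tau.
have H1 : n2A (val a n) - harmonic n @[n --> om] --> L - 0.
  by apply: cvgB => //; apply: cvg_om; exact: cvg_harmonic.
rewrite subr0 in H1; apply: (ler_cvg_to H1).
  apply: continuous_cvg; first exact: sqrt_continuous.
  by rewrite -pi_star -piM; apply: cvg_Re; exact: (tauE (a^# ** a)).
by apply: nearW => n; exact: (tsP n).2.
Qed.

Arguments n2_cvg a : clear implicits.

Lemma n2_ge0 x : 0 <= n2 x.
Proof.
have [a <-] := pi_surj x; apply: (cvgR_ge (n2_cvg a)) => n; exact: norm2_ge0.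
Qed.

Lemma n2D x y : n2 (x + y) <= n2 x + n2 y.
Proof.
have [a <-] := pi_surj x; have [b <-] := pi_surj y; rewrite -piD.
apply: (ler_cvg_to (n2_cvg _) (cvgD (n2_cvg a) (n2_cvg b))).
by apply: nearW => n; exact: (norm2D (val a n) (val b n)).
Qed.

Lemma n2Z k x : n2 (k *: x) <= nrm k * n2 x.
Proof.
have [a <-] := pi_surj x; rewrite -piZ.
apply: (ler_cvg_to (n2_cvg _) (cvgM (cvg_cst (nrm k)) (n2_cvg a))).
by apply: nearW => n; exact: (norm2Z k (val a n)).
Qed.

Lemma n2N x : n2 (- x) = n2 x.
Proof.
suff H y : n2 (- y) <= n2 y by apply/eqP; rewrite eq_le H /=; have := H (- x); rewrite opprK.
by have := n2Z (-1) y; rewrite scaleN1r nrmN nrm1 mul1r.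
Qed.

Lemma n2B x y : n2 (x - y) <= n2 x + n2 y.
Proof. by rewrite -(n2N y) n2D. Qed.

Lemma n2_star x : n2 x^# = n2 x.
Proof.
have [a <-] := pi_surj x; rewrite -pi_star.
have H := n2_cvg a^#; have E : (fun n => n2A (val a^# n)) = (fun n => n2A (val a n)).
  by apply/funext => n; exact: norm2_star.
by rewrite E in H; apply: (cvg_unique _ H (n2_cvg a)).
Qed.

Lemma n2_0 : n2 0 = 0.
Proof.
apply/eqP; rewrite eq_le n2_ge0 andbT.
by have := n2Z 0 0; rewrite scaler0 nrm0 mul0r.
Qed.

Lemma n2_eq0 x : n2 x <= 0 -> x = 0.
Proof.
move=> h; have n0 : n2 x = 0 by apply/eqP; rewrite eq_le h n2_ge0.
have [a aE] := pi_surj x; rewrite -aE; have -> : 0 = pi 0 by rewrite -(scale0r a) piZ scale0r.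
apply: (ultra_piP omega a 0).2; have H := n2_cvg a; rewrite aE n0 in H.
by move: H; under eq_fun do rewrite -[X in n2A X]subr0.
Qed.

Lemma n2_eps0 x C : 0 <= C -> (forall e : R, 0 < e -> e <= 1 -> n2 x <= C * e) -> x = 0.
Proof.
move=> C0 H; apply: n2_eq0; apply: (eps_le C0) => e e0 e1.
by rewrite add0r H.
Qed.

Lemma n2_lt a e : n2 (pi a) < e -> \forall n \near om, n2A (val a n) < e.
Proof. move=> h; have /cvgrPdist_lt/(_ (e - n2 (pi a))) := n2_cvg a.
rewrite subr_gt0 => /(_ h); apply: filterS => n.
have := ler_norm (n2A (val a n) - n2 (pi a)); rewrite distrC; lra. Qed.

Lemma n2_le_near a e : (\forall n \near om, n2A (val a n) <= e) -> n2 (pi a) <= e.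
Proof. by move=> h; apply: (ler_cvg_to (n2_cvg a) (cvg_cst e) h). Qed.

Lemma limtr_le_n2 tau x : limit_traces tau -> nrm (tau x) <= n2 x.
Proof.
move=> [ts [tsT H]]; have [a <-] := pi_surj x.
apply: (@le_trans _ _ (n2 (pi a))) => //.
have h : nrm (ts n (val a n)) @[n --> om] --> nrm (tau (pi a)).
  apply/cvgrPdist_lt => e e0; have /near_nrm/(_ e e0) := H a.
  apply: filterS => n; apply: le_lt_trans.
  set u := tau _; set v := ts _ _.
  rewrite ler_norml; apply/andP; split.
    have := nrmD (v - u) u; rewrite subrK -opprB nrmN; lra.
  have := nrmD (u - v) v; rewrite subrK; lra.
apply: (ler_cvg_to h (n2_cvg a)); apply: nearW => n.
exact: le_trans (tr_le_tnorm (tsT n) _) (tnorm_le_norm2 _ (tsT n)).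
Qed.

Lemma n2_le x M : 0 <= M ->
  (forall tau, limit_traces tau -> complex.Re (tau (x^# ** x)) <= M ^+ 2) -> n2 x <= M.
Proof.
move=> M0 H; apply: ge_sup; first by case: (limit_traces_has_sup x limit_traces_nonempty).
move=> _ [tau tauP <-].
by rewrite -(ger0_norm M0) -sqrtr_sqr ler_wsqrtr // H.
Qed.
End LimitTraces.

Arguments n2_cvg {R omega A} T0 a.

(** * Uniformly bounded lifts *)

Section Lifts.
Context {R : realType} (omega : freeUltrafilter) {A : cstarAlgType R}.
Local Notation om := (ultra_set omega).
Local Notation U := (ultrapower omega A).
Local Notation pi := (@ultra_pi R omega A).
Local Notation T := (traces A).
Local Notation val := (@subalg_val R _ _).
Local Notation n2A := (norm2 (traces A)).
Local Notation n2 := (@n2 R omega A).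
Implicit Types (a b : linfty A) (x y z p : U) (tau : U -> R[i]) (C D : R).

(** Plays the role of an operator norm on the ultrapower; it is only used through
upper bounds. *)
Definition liftable C x := exists2 a, pi a = x & forall n, nrm (val a n) <= C.

Lemma liftable_ex x : exists2 C, 0 <= C & liftable C x.
Proof.
by have [a aE] := pi_surj x; have [C C0 H] := linfty_bound a; exists C => //; exists a.
Qed.

Lemma liftable_ge0 C x : liftable C x -> 0 <= C.
Proof. by move=> [a _ H]; exact: le_trans (nrm_ge0 _) (H 0%N). Qed.

Lemma liftable_star C x : liftable C x -> liftable C x^#.
Proof.
by move=> [a <- H]; exists a^#; [rewrite pi_star|move=> n; rewrite nrm_star].
Qed.

Lemma liftable_lin C D (k : R[i]) x y : liftable C x -> liftable D y ->
  liftable (nrm k * C + D) (k *: x + y).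
Proof.
move=> [a <- H] [b <- H']; exists (k *: a + b); first by rewrite piD piZ.
move=> n; apply: le_trans (_ : nrm (k *: val a n + val b n) <= _) _ => //.
apply: le_trans (nrmD _ _) _; apply: lerD => //.
by rewrite nrmZ ler_wpM2l ?nrm_ge0.
Qed.

Lemma liftable_le C D x : C <= D -> liftable C x -> liftable D x.
Proof. by move=> CD [a <- H]; exists a => // n; exact: le_trans CD. Qed.

Lemma liftable0 : liftable 0 0.
Proof.
by exists 0; [rewrite -(scale0r 0) piZ scale0r|move=> n; rewrite nrm0].
Qed.

Lemma liftableD C D x y : liftable C x -> liftable D y -> liftable (C + D) (x + y).
Proof. by move=> hx hy; have := liftable_lin 1 hx hy; rewrite nrm1 mul1r scale1r. Qed.

Lemma liftableZ C (k : R[i]) x : liftable C x -> liftable (nrm k * C) (k *: x).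
Proof. by move=> hx; have := liftable_lin k hx liftable0; rewrite !addr0. Qed.

Lemma liftableM C D x y : liftable C x -> liftable D y -> liftable (C * D) (x ** y).
Proof.
move=> [a <- H] [b <- H']; exists (a ** b); first by rewrite piM.
by move=> n; apply: le_trans (nrmM (val a n) (val b n)) _; rewrite ler_pM ?nrm_ge0.
Qed.

Lemma liftable_convex C (s : R) x y : 0 <= s -> s <= 1 -> liftable C x -> liftable C y ->
  liftable C (s%:C%C *: x + (1 - s)%:C%C *: y).
Proof.
move=> s0 s1 hx hy; have := liftableD (liftableZ s%:C%C hx) (liftableZ (1 - s)%:C%C hy).
by rewrite !nrm_real !ger0_norm ?subr_ge0 // -mulrDl addrC subrK mul1r.
Qed.

Lemma valD a b (n : nat) : val (a + b) n = val a n + val b n. Proof. by []. Qed.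
Lemma valZ (k : R[i]) a (n : nat) : val (k *: a) n = k *: val a n. Proof. by []. Qed.
Lemma valM a b (n : nat) : val (a ** b) n = val a n ** val b n. Proof. by []. Qed.
Lemma val_dexp t a (k n : nat) : val (dexp t a k) n = dexp t (val a n) k.
Proof. by elim: k => [|k IH] //; rewrite [dexp _ _ _]/= valD valZ valD valM IH. Qed.

Lemma pi_nexp t N a : pi (nexp t N a) = nexp t N (pi a).
Proof. by rewrite {1}/nexp piZ; congr (_ *: _); exact: dexp_quot_pi. Qed.

(** Apply f to a self-adjoint lift, entry by entry. The class is unchanged as f fixes
projections, and the entries get norm at most 2 whatever the lift. *)
Lemma liftable_proj p : is_projection p -> liftable 2 p.
Proof.
move=> [pE pp]; have [b bE] := pi_surj p.
pose a := (1 / 2 : R)%:C%C *: (b + b^#).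
have aE : pi a = p.
  by rewrite piZ piD pi_star bE pE -[p in LHS]scale1r -scalerDl scalerA -[RHS]scale1r
    mulrDr !mulr1 -half2.
have asa n : (val a n)^# = val a n.
  by rewrite [LHS]starZ conj_half [X in _ *: X]starD starK addrC.
have [K _ aK] := linfty_bound a.
have [t [N [ok tN]]] := nexp_ok_ex K (ltr01 : 0 < (1 : R)) (lexx _).
exists (nexp t N a) => [|n].
  by rewrite pi_nexp aE (nexp_proj ok).
have -> : val (nexp t N a) n = nexp t N (val a n).
  by rewrite /nexp -val_dexp.
apply: le_trans (nrm_nexp ok (asa n) (aK n) (lexx _) tN) _; lra.
Qed.

Hypothesis T0 : T !=set0.

Lemma n2Ml C x y : liftable C x -> n2 (x ** y) <= C * n2 y.
Proof.
move=> hx; have C0 := liftable_ge0 hx; have [a <- H] := hx.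
have [b <-] := pi_surj y; rewrite -piM.
apply: (ler_cvg_to (n2_cvg T0 _) (cvgM (cvg_cst C) (n2_cvg T0 b))).
apply: nearW => n; apply: le_trans (norm2M (val a n) (val b n)) _.
by apply: ler_wpM2r; [exact: norm2_ge0|exact: H].
Qed.

Lemma n2Mr C x y : liftable C x -> n2 (y ** x) <= C * n2 y.
Proof.
move=> hx; rewrite -(n2_star T0) starM -(n2_star T0 y).
exact: n2Ml (liftable_star hx).
Qed.

(** Diagonal argument: at the entry n follow the m(n)-th term of the sequence, where
m(n) <= n is the largest index up to which the Cauchy estimates hold at n. *)
Lemma n2_complete (x : nat -> U) C : (forall k : nat, liftable C (x k)) ->
  (forall k : nat, n2 (x k.+1 - x k) < 2^-1 ^+ k) ->
  exists2 y, liftable C y & forall k : nat, n2 (y - x k) <= 2 * 2^-1 ^+ k.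
Proof.
move=> xC xcau.
have ex (k : nat) : exists a, pi a = x k /\ forall n, nrm (val a n) <= C.
  by have [a aE aC] := xC k; exists a.
have [a aP] := choice ex.
pose good (k n : nat) := forall j : nat, (j < k)%N ->
  n2A (val (a j.+1) n - val (a j) n) < 2^-1 ^+ j.
have good_near (k : nat) : \forall n \near om, good k n.
  elim: k => [|k IH]; first exact: nearW.
  have := xcau k; rewrite -(aP k.+1).1 -(aP k).1 -piB => /(n2_lt T0) h.
  apply: filterS (filterI IH h) => n [/= g1 g2] j; rewrite ltnS leq_eqVlt => /predU1P[->|] //.
  exact: g1.
have kn n : exists k : nat, [/\ (k <= n)%N, good k n &
    forall j, (j <= n)%N -> good j n -> (j <= k)%N].
  pose P := [pred k | (k <= n)%N && `[< good k n >]].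
  have P0 : exists k, P k by exists 0%N; apply/andP; split => //; apply/asboolP.
  have Pn k : P k -> (k <= n)%N by case/andP.
  have [k /andP[k1 /asboolP k2] k3] := ex_maxnP P0 Pn.
  by exists k; split => // j jn gj; apply: k3; apply/andP; split => //; apply/asboolP.
have [m mP] := choice kn.
have [b bE] := @seq_lift R A (fun n => val (a (m n)) n) C (fun n => (aP (m n)).2 n).
exists (pi b); first by exists b => // n; rewrite bE; exact: (aP (m n)).2.
move=> k; rewrite -(aP k).1 -piB; apply: (n2_le_near T0).
apply: filterS (filterI (free_ge omega k) (good_near k)) => n [/= nk gk].
have [mn gm mmax] := mP n; have km := mmax k nk gk.
change (is_true (n2A (val b n - val (a k) n) <= 2 * 2^-1 ^+ k)); rewrite bE.
have [d dE] : exists d, m n = (d + k)%N by exists (m n - k)%N; rewrite subnK.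
move: gm; rewrite dE => gM; clear dE.
suff : n2A (val (a (d + k)%N) n - val (a k) n) <= 2 * (2^-1 ^+ k - 2^-1 ^+ (d + k)).
  move=> h; apply: le_trans h _; rewrite mulrBr gerBl mulr_ge0 // exprn_ge0 // invr_ge0 //.
elim: d gM => [|d IH] gM; first by rewrite !add0n !subrr mulr0 norm2_0.
have := IH (fun j jd => gM j (ltn_trans jd (ltnSn _))).
have := gM (d + k)%N (ltnSn _).
rewrite addSn => h1 h2.
have -> : val (a (d + k).+1) n - val (a k) n =
  (val (a (d + k).+1) n - val (a (d + k)%N) n) + (val (a (d + k)%N) n - val (a k) n).
  by rewrite addrA subrK.
apply: le_trans (norm2D _ _) _; rewrite exprS.
move: (2^-1 ^+ (d + k)) h1 h2 => q h1 h2.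
apply: le_trans (lerD (ltW h1) h2) _; lra.
Qed.

Hypothesis Tc : traces_compact A.

(** Almost units for eps = 1 / (n + 1) at the n-th entry. *)
Lemma ultrapower_unit : exists u : U, [/\ is_identity u, liftable 2 u &
  forall tau, limit_traces tau -> tau u = 1].
Proof.
have ex n := almost_unit Tc (harmonic_gt0 n : 0 < (harmonic n : R)).
have [f fP] := choice ex.
have [b bE] := seq_lift (fun n => (fP n).1).
have h0 : (harmonic : nat -> R) n @[n --> om] --> (0 : R).
  by apply: cvg_om; exact: cvg_harmonic.
pose u := pi b.
have xu x : x ** u = x.
  have [a <-] := pi_surj x; have [C C0 H] := linfty_bound a.
  apply/esym; rewrite /u -piM; apply: (ultra_piP omega a (a ** b)).2.
  apply: (@squeeze_cvgr _ _ _ _ (cst 0) (fun n => harmonic n * C)).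
  - apply: nearW => n; rewrite norm2_ge0 /=.
    apply: le_trans (_ : _ <= harmonic n * nrm (val a n)) _.
      rewrite -[X in norm2 _ X]/(val a n - val a n ** val b n) bE; exact: (fP n).2.
    by rewrite ler_wpM2l ?harmonic_ge0.
  - exact: cvg_cst.
  - by rewrite -(mul0r C); apply: cvgM => //; exact: cvg_cst.
have uE : u^# = u by rewrite -[LHS]xu -[u^# ** u]starK starM starK xu starK.
exists u; split.
- by move=> x; split => //; rewrite -[x]starK -{1}uE -starM xu.
- by exists b => // n; rewrite bE; exact: (fP n).1.
- move=> tau [ts [tsT H]]; apply: cvgC_unique (H b) _.
  apply: (@cvgC_squeeze R om _ (cst 1) _ harmonic) => //; first exact: cvg_cst.
  apply: nearW => n; rewrite bE.
  by apply: (almost_unit_trace (fP n).1 (fP n).2 (tsT n)); rewrite harmonic_ge0.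
Qed.
End Lifts.

(** * Reindexing a factorising projection *)

Section Reindexing.
Context {R : realType} (omega : freeUltrafilter) {A : cstarAlgType R}.
Local Notation om := (ultra_set omega).
Local Notation U := (ultrapower omega A).
Local Notation pi := (@ultra_pi R omega A).
Local Notation T := (traces A).
Local Notation val := (@subalg_val R _ _).
Local Notation n2A := (norm2 (traces A)).
Local Notation n2 := (@n2 R omega A).
Implicit Types (a b : linfty A) (x y z p : U) (tau : U -> R[i]).

Lemma const_lift (y : A) : exists2 c, pi c = const_embed omega y & val c = fun=> y.
Proof. by eexists; [reflexivity|]. Qed.

Lemma near_all (P : nat -> nat -> Prop) n : (forall k, \forall m \near om, P k m) ->
  \forall m \near om, forall k, (k < n)%N -> P k m.
Proof.
move=> H; elim: n => [|n IH]; first exact: nearW.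
apply: filterS (filterI IH (H n)) => m [/= h1 h2] k.
by rewrite ltnS leq_eqVlt => /predU1P[->|/h1].
Qed.

Lemma pi_eq_harmonic a b :
  (\forall n \near om, n2A (val a n - val b n) <= harmonic n) -> pi a = pi b.
Proof.
move=> h; apply/ultra_piP.
apply: (@squeeze_cvgr _ _ _ _ (cst 0) harmonic).
- by apply: filterS h => n h; rewrite norm2_ge0.
- exact: cvg_cst.
- by apply: cvg_om; exact: cvg_harmonic.
Qed.

Hypothesis T0 : T !=set0.

Variables (lam : R) (p : U).
Hypotheses (pP : is_projection p)
  (pC : forall y : A, p ** const_embed omega y = const_embed omega y ** p)
  (pT : forall (y : A) tau, limit_traces tau ->
    tau (const_embed omega y ** p) = lam%:C%C * tau (const_embed omega y)).

(** Otherwise some traces violate the estimate along the ultrafilter, and their limit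
trace does not factor at p. *)
Lemma near_trace_factor b (y : A) (e : R) : pi b = p -> 0 < e ->
  \forall n \near om, forall t, T t -> nrm (t (y ** val b n) - lam%:C%C * t y) <= e.
Proof.
move=> bE e0; apply: contrapT => /ultra_not H.
have ex n : exists t, T t /\ (~ (forall t, T t ->
  nrm (t (y ** val b n) - lam%:C%C * t y) <= e) ->
    e < nrm (t (y ** val b n) - lam%:C%C * t y)).
  have [h|/existsNP[t /not_implyP[tT /negP h]]] :=
    EM (forall t, T t -> nrm (t (y ** val b n) - lam%:C%C * t y) <= e).
    by have [t tT] := T0; exists t.
  by exists t; split => // _; rewrite ltNge.
have [ts tsP] := choice ex.
have [tau tauP tauE] := limit_trace_ex omega (fun n => (tsP n).1).
have [c cE cV] := const_lift y.
have h1 := tauE (c ** b); rewrite piM cE bE pT // -cE in h1.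
have h2 := cvgC_lin (k := - lam%:C%C) (tauE c) h1.
rewrite mulNr addNr in h2; have /near_nrm/(_ e e0) := h2.
move=> h3; have [n [/= + h4]] := filter_ex (filterI h3 H).
rewrite sub0r nrmN => h5.
have {}h5 : nrm (- lam%:C%C * ts n (val c n) + ts n (val c n ** val b n)) < e by [].
rewrite cV mulNr addrC in h5.
by have := (tsP n).2 h4; move: h5 => /lt_trans/[apply]; rewrite ltxx.
Qed.

(** The class of (c_n), where c_n is an entry of a lift of p which has, up to
1 / (n + 1), all the properties of p with respect to the n-th entries of the first n
elements d_k. *)
Lemma reindexed_projection (d : nat -> U) : exists q : U, [/\ is_projection q,
  forall k, q ** d k = d k ** q &
  forall k tau, limit_traces tau -> tau (d k ** q) = lam%:C%C * tau (d k)].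
Proof.
have [b bE bC] := liftable_proj pP.
have ex0 k : exists a, pi a = d k by exact: pi_surj.
have [dl dlE] := choice ex0.
have [pE pp] := pP.
have near0 a e : pi a = 0 -> 0 < e -> \forall n \near om, n2A (val a n) < e.
  by move=> a0 e0; apply: (n2_lt T0); rewrite a0 n2_0.
pose good n (c : A) := [/\ nrm c <= 2, n2A (c^# - c) <= harmonic n,
  n2A (c ** c - c) <= harmonic n &
  forall k, (k < n)%N -> n2A (c ** val (dl k) n - val (dl k) n ** c) <= harmonic n /\
   forall t, T t -> nrm (t (val (dl k) n ** c) - lam%:C%C * t (val (dl k) n)) <= harmonic n].
have ex n : exists c, good n c.
  have e0 : 0 < (harmonic n : R) by exact: harmonic_gt0.
  have h1 := near0 (b^# - b) _ (_ : pi (b^# - b) = 0) e0.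
  rewrite piB pi_star bE pE subrr in h1; have {}h1 := h1 erefl.
  have h2 := near0 (b ** b - b) _ (_ : pi (b ** b - b) = 0) e0.
  rewrite piB piM bE pp subrr in h2; have {}h2 := h2 erefl.
  have h3 : \forall m \near om, forall k, (k < n)%N ->
    n2A (val b m ** val (dl k) n - val (dl k) n ** val b m) < harmonic n.
    apply: near_all => k; have [c cE cV] := const_lift (val (dl k) n).
    have := near0 (b ** c - c ** b) _ (_ : pi (b ** c - c ** b) = 0) e0.
    rewrite piB !piM bE cE pC subrr => /(_ erefl); apply: filterS => m.
    by rewrite -[val (b ** c - c ** b) m]/(val b m ** val c m - val c m ** val b m) cV.
  have h4 : \forall m \near om, forall k, (k < n)%N -> forall t, T t ->
     nrm (t (val (dl k) n ** val b m) - lam%:C%C * t (val (dl k) n)) <= harmonic n.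
    by apply: near_all => k; exact: near_trace_factor.
  have [m [/= [/= [/= g1 g2] g3] g4]] := filter_ex (filterI (filterI (filterI h1 h2) h3) h4).
  exists (val b m); split => //; [exact: ltW|exact: ltW|].
  by move=> k kn; split; [apply: ltW; exact: g3|exact: g4].
have [c cP] := choice ex.
have [q qE] := @seq_lift R A c 2 (fun n => let: And4 h _ _ _ := cP n in h).
have cP' n : good n (val q n) by rewrite qE.
exists (pi q); split; first split.
- rewrite -pi_star; apply: pi_eq_harmonic; apply: nearW => n.
  by have [_ h _ _] := cP' n.
- rewrite -piM; apply: pi_eq_harmonic; apply: nearW => n.
  by have [_ _ h _] := cP' n.
- move=> k; rewrite -dlE -!piM; apply: pi_eq_harmonic.
  apply: filterS (free_ge omega k.+1) => n kn.
  by have [_ _ _ /(_ k kn)[]] := cP' n.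
- move=> k tau [ts [tsT H]]; rewrite -dlE -piM; apply: cvgC_unique (H _) _.
  have h1 : (fun n => lam%:C%C * ts n (val (dl k) n)) @ om --> lam%:C%C * tau (pi (dl k)).
    have h0 : (fun=> 0 : R[i]) @ om --> (0 : R[i]) by exact: cvg_cst.
    have := cvgC_lin (k := lam%:C%C) (H (dl k)) h0.
    by rewrite addr0; under eq_fun do rewrite addr0.
  apply: cvgC_squeeze h1 _ _.
    apply: filterS (free_ge omega k.+1) => n kn.
    have [_ _ _ /(_ k kn)[_ /(_ _ (tsT n)) h]] := cP' n.
    by rewrite -nrmN opprB; exact: h.
  by apply: cvg_om; exact: cvg_harmonic.
Qed.
End Reindexing.

(** * The chain of projections *)

Lemma expr_small (R : realType) (s : R) e : 0 <= s -> s < 1 -> 0 < e ->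
  exists N, forall m, (N <= m)%N -> s ^+ m < e.
Proof.
move=> s0 s1 e0.
have s1' : `|s| < 1 by rewrite ger0_norm.
have /cvgrPdist_lt/(_ _ e0)[N _ H] := cvg_expr s1'; exists N => m Nm.
have := H m Nm; rewrite sub0r normrN ger0_norm // exprn_ge0 //.
Qed.

Section Cauchy.
Context {R : realType} (omega : freeUltrafilter) {A : cstarAlgType R}.
Local Notation U := (ultrapower omega A).
Local Notation n2 := (@n2 R omega A).
Hypothesis T0 : traces A !=set0.

(** The rate r allows the conclusion to keep the modulus of convergence. *)
Lemma n2_cauchy (x : nat -> U) (C : R) (r : nat -> R) :
  (forall k, liftable C (x k)) ->
  (forall e : R, 0 < e -> exists N, forall m, (N <= m)%N -> r m < e) ->
  (forall m n, (m <= n)%N -> n2 (x n - x m) <= r m) ->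
  exists2 y, liftable C y & forall m, n2 (y - x m) <= r m.
Proof.
move=> xC r0 xr.
have p0 k : 0 < (2^-1 : R) ^+ k by rewrite exprn_gt0 // invr_gt0.
have ex k : exists N, forall m, (N <= m)%N -> r m < 2^-1 ^+ k by exact: r0.
have [N NP] := choice ex.
pose M k := (k + \sum_(j < k.+1) N j)%N.
have NM k : (N k <= M k)%N by rewrite /M big_ord_recr /= addnA leq_addl.
have MM k : (M k <= M k.+1)%N.
  by rewrite /M [\sum_(j < k.+2) _]big_ord_recr /= leq_add // leq_addr.
have [y yC yP] := n2_complete T0 (x := fun k => x (M k)) (C := C)
  (fun k => xC (M k)) (fun k => le_lt_trans (xr _ _ (MM k)) (NP k _ (NM k))).
exists y => // m; apply/ler_addgt0Pr => e e0.
have [K KP] := @expr_small R 2^-1 (e / 2) (ltac:(by rewrite invr_ge0))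
  (ltac:(by rewrite invf_lt1 // ltr1n)) (divr_gt0 e0 (ltr0n _ 2)).
pose k := maxn K m.
have mM : (m <= M k)%N by rewrite (leq_trans (leq_maxr K m)) // leq_addr.
have -> : y - x m = (y - x (M k)) + (x (M k) - x m) by rewrite addrA subrK.
apply: le_trans (n2D T0 _ _) _; rewrite addrC; apply: lerD; first exact: xr.
apply: le_trans (yP k) _; have := KP k (leq_maxl _ _); move: (_ ^+ k) => q; lra.
Qed.
End Cauchy.

Section Chain.
Context {R : realType} (omega : freeUltrafilter) {A : cstarAlgType R}.
Local Notation U := (ultrapower omega A).
Local Notation n2 := (@n2 R omega A).
Local Notation lt_trace := (limit_traces (omega := omega) (A := A)).
Implicit Types (x y z : U) (tau : U -> R[i]) (s t : R) (j k : nat).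
Hypothesis T0 : traces A !=set0.
Variable u : U.
Hypotheses (uI : is_identity u) (u1 : forall tau, lt_trace tau -> tau u = 1).
Variable lam : R.
Hypotheses (lam0 : 0 < lam) (lam1 : lam < 1).
Hypothesis ext : forall d : nat -> U, exists q, [/\ is_projection q,
  forall k, q ** d k = d k ** q &
  forall k tau, lt_trace tau -> tau (d k ** q) = lam%:C%C * tau (d k)].
Variable d : nat -> U.

(** A projection independent of the sequence e; [D j] enumerates a set containing u and
the d_k, and stable under multiplication by the projections chosen before step j. *)
Let E (e : nat -> U) : U := projT1 (cid (ext e)).
Let interleave (e : nat -> U) (q : U) k := if odd k then e k./2 ** q else e k./2.
Let D := fix D j := if j is j'.+1 then interleave (D j') (E (D j'))
  else fun k => if k is k'.+1 then d k' else u.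
Let p j := E (D j).
Let In j x := exists k, D j k = x.

Let u_star : u^# = u. Proof. exact: identity_star. Qed.
Let ul x : u ** x = x. Proof. exact: (uI x).1. Qed.
Let ur x : x ** u = x. Proof. exact: (uI x).2. Qed.

Let p_proj j : is_projection (p j).
Proof. by rewrite /p /E; case: (cid _) => q [/= ? _ _]. Qed.
Let p_star j : (p j)^# = p j. Proof. by case: (p_proj j). Qed.
Let pp j : p j ** p j = p j. Proof. by case: (p_proj j). Qed.
Let p_comm j x : In j x -> p j ** x = x ** p j.
Proof. by rewrite /p /E; case: (cid _) => q [/= _ H _] [k <-]; exact: H. Qed.
Let p_trace j x tau : In j x -> lt_trace tau -> tau (x ** p j) = lam%:C%C * tau x.
Proof. by rewrite /p /E; case: (cid _) => q [/= _ _ H] [k <-]; exact: H. Qed.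
Let In_S j x : In j x -> In j.+1 x.
Proof. by move=> [k <-]; exists k.*2; rewrite /= /interleave odd_double doubleK. Qed.
Let In_p j x : In j x -> In j.+1 (x ** p j).
Proof.
by move=> [k <-]; exists k.*2.+1; rewrite /= /interleave /= odd_double /= uphalf_double.
Qed.
Let In_u j : In j u.
Proof. by elim: j => [|j IH]; [exists 0%N|exact: In_S]. Qed.
Let In_d j k : In j (d k).
Proof. by elim: j => [|j IH]; [exists k.+1|exact: In_S]. Qed.
Let In_pp i j : (i < j)%N -> In j (p i).
Proof.
elim: j => // j IH; rewrite ltnS leq_eqVlt => /predU1P[->|/IH]; last exact: In_S.
by rewrite -[p j]ul; exact: In_p.
Qed.
Let pC i j : p i ** p j = p j ** p i.
Proof.
have [ij|ji|->] := ltngtP i j => //; last by apply: p_comm; exact: In_pp.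
by apply/esym/p_comm; exact: In_pp.
Qed.

(** Approximation of depth k of the projection attached to [0, t[, using p_j, p_(j+1),
...: if t is below lambda the interval lies in the left part, otherwise it contains
the left part and a portion of the right one. In both cases the remaining portion
is rescaled to [0, 1]. *)
Let F := fix F k j t : U := if k is k'.+1 then
    if t < lam then p j ** F k' j.+1 (t / lam)
    else p j + (F k' j.+1 ((t - lam) / (1 - lam)) - p j ** F k' j.+1 ((t - lam) / (1 - lam)))
  else if 1 <= t then u else 0.
(** The trace of [F k j t]. *)
Let G := fix G k t : R := if k is k'.+1 then
    if t < lam then lam * G k' (t / lam)
    else lam + (1 - lam) * G k' ((t - lam) / (1 - lam))
  else if 1 <= t then 1 else 0.

Let FS k j t : F k.+1 j t = if t < lam then p j ** F k j.+1 (t / lam)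
    else p j + (F k j.+1 ((t - lam) / (1 - lam)) - p j ** F k j.+1 ((t - lam) / (1 - lam))).
Proof. by []. Qed.
Let F0E j t : F 0 j t = if 1 <= t then u else 0. Proof. by []. Qed.

Let F_comm y k j t : (forall i, p i ** y = y ** p i) -> F k j t ** y = y ** F k j t.
Proof.
move=> py; elim: k j t => [|k IH] j t; rewrite (F0E, FS).
  by case: ifP => _; rewrite ?ul ?ur ?smul0l ?smul0r.
case: ifP => _; first by rewrite -smulA IH smulA py smulA.
rewrite !(smulDl, smulDr, smulNl, smulNr) -!(smulA (p j)) IH (smulA y) -py.
by rewrite -(smulA (p j)).
Qed.
Let F_p k j t i : F k j t ** p i = p i ** F k j t.
Proof. by apply: F_comm => i'; exact: pC. Qed.
Let F_d k j t i : F k j t ** d i = d i ** F k j t.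
Proof. by apply: F_comm => i'; apply: p_comm; exact: In_d. Qed.

Let F_star k j t : (F k j t)^# = F k j t.
Proof.
elim: k j t => [|k IH] j t; rewrite (F0E, FS);
  first by case: ifP => _; rewrite ?u_star ?star0.
by case: ifP => _; rewrite !(starD, starN, starM) !IH p_star F_p.
Qed.

Let F_mul k j s t : s <= t -> F k j s ** F k j t = F k j s.
Proof.
elim: k j s t => [|k IH] j s t st; rewrite !(F0E, FS).
  case: ifP => [s1|]; last by rewrite smul0l.
  by rewrite ul (le_trans s1 st).
have ppx x : x ** p j ** p j = x ** p j by rewrite -smulA pp.
have Fp v : F k j.+1 v ** p j = p j ** F k j.+1 v by exact: F_p.
have Fpx x v : x ** F k j.+1 v ** p j = x ** p j ** F k j.+1 v.
  by rewrite -smulA Fp smulA.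
have l10 : 0 < 1 - lam by rewrite subr_gt0.
case: (ltP t lam) => tl.
  rewrite (le_lt_trans st tl).
  have FF := IH j.+1 (s / lam) (t / lam) _; rewrite ler_pM2r ?invr_gt0 // in FF.
  have {}FF := FF st; set f := F k _ _ in FF *; set g := F k _ _ in FF *.
  by rewrite !smulA Fpx pp -smulA FF.
case: (ltP s lam) => sl.
  set f := F k _ _; set g := F k _ _.
  by star_expand; rewrite !(Fp, Fpx, pp, ppx); lmod_ring.
have FF := IH j.+1 ((s - lam) / (1 - lam)) ((t - lam) / (1 - lam)) _.
rewrite ler_pM2r ?invr_gt0 // lerD2r in FF; have {}FF := FF st.
set f := F k _ _ in FF *; set g := F k _ _ in FF *.
have FFx x : x ** f ** g = x ** f by rewrite -smulA FF.
by star_expand; rewrite !(Fp, Fpx, pp, ppx, FF, FFx); lmod_ring.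
Qed.

Let F_mono1 k j t : F k j t ** F k.+1 j t = F k j t.
Proof.
elim: k j t => [|k IH] j t.
  rewrite F0E FS.
  case: ifP => [t1|]; last by rewrite smul0l.
  rewrite ltNge (ltW (lt_le_trans lam1 t1)) /=.
  rewrite ler_pdivlMr ?subr_gt0 // mul1r lerD2r t1 ur ul; lmod_ring.
have ppx x : x ** p j ** p j = x ** p j by rewrite -smulA pp.
have Fp v : F k j.+1 v ** p j = p j ** F k j.+1 v by exact: F_p.
have Fpx x v : x ** F k j.+1 v ** p j = x ** p j ** F k j.+1 v.
  by rewrite -smulA Fp smulA.
rewrite !FS; case: ifP => _.
  by rewrite smulA Fpx pp -smulA IH.
have := IH j.+1 ((t - lam) / (1 - lam)).
set f := F k _ _; set g := F k.+1 _ _ => FF.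
have FFx x : x ** f ** g = x ** f by rewrite -smulA FF.
by star_expand; rewrite !(Fp, Fpx, pp, ppx, FF, FFx); lmod_ring.
Qed.

Let F_mono k n j t : (k <= n)%N -> F k j t ** F n j t = F k j t.
Proof.
move=> /subnK <-; elim: (n - k)%N => [|i IH]; first by rewrite add0n F_mul.
by rewrite addSn -{1}IH -smulA F_mono1 IH.
Qed.

(** The product with p_j stays in the set over which p_(j+1) is independent. *)
Let F_trace k j t b tau : In j b -> lt_trace tau ->
  tau (b ** F k j t) = (G k t)%:C%C * tau b.
Proof.
move=> + tauP; elim: k j t b => [|k IH] j t b jb; rewrite (F0E, FS) [G _ _]/=.
  by case: ifP => _; [rewrite ur mul1r|rewrite smul0r (limtr0 tauP) mul0r].
have bp := p_trace jb tauP.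
case: ifP => _.
  by rewrite smulA (IH _ _ _ (In_p jb)) bp rmorphM /= mulrCA mulrA.
rewrite !(smulDr, smulNr) smulA !(limtrD tauP) (limtrN tauP) (IH _ _ _ (In_p jb))
  (IH _ _ _ (In_S jb)) bp.
by rewrite rmorphD rmorphM rmorphB /=; ring.
Qed.

Let rho := Num.max lam (1 - lam).
Let sigma := Num.sqrt rho.
Let rho0 : 0 <= rho. Proof. by rewrite le_max ltW. Qed.
Let rho1 : rho < 1. Proof. by rewrite gt_max lam1 ltrBlDr ltrDl. Qed.
Let sigma0 : 0 <= sigma. Proof. exact: sqrtr_ge0. Qed.
Let sigma2 : sigma ^+ 2 = rho. Proof. exact: sqr_sqrtr. Qed.
Let sigma1 : sigma < 1.
Proof. by rewrite -(@ltr_pXn2r _ 2) ?nnegrE // sigma2 expr1n. Qed.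
Let r m := 2 * sigma ^+ m.
Let r_small (e : R) : 0 < e -> exists N, forall m, (N <= m)%N -> r m < e.
Proof.
move=> e0; have [N NP] := @expr_small R sigma (e / 2) sigma0 sigma1 (divr_gt0 e0 (ltr0n _ 2)).
by exists N => m /NP; rewrite /r; lra.
Qed.
Let r_ge0 m : 0 <= r m. Proof. by rewrite mulr_ge0 // exprn_ge0. Qed.

Let G_err k t : 0 <= t -> t <= 1 -> `|G k t - t| <= rho ^+ k.
Proof.
elim: k t => [|k IH] t t0 t1 /=.
  by rewrite expr0 ler_norml; case: ifP => h; apply/andP; split; lra.
have l10 : 0 < 1 - lam by rewrite subr_gt0.
have R0 := exprn_ge0 k rho0.
case: (ltP t lam) => tl.
  have h : `|G k (t / lam) - t / lam| <= rho ^+ k.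
    by apply: IH; [apply: divr_ge0 => //; exact: ltW|rewrite ler_pdivrMr // mul1r ltW].
  have -> : lam * G k (t / lam) - t = lam * (G k (t / lam) - t / lam).
    by rewrite mulrBr [lam * (t / lam)]mulrC divfK // gt_eqF.
  rewrite normrM (gtr0_norm lam0) exprS; apply: ler_pM => //; first exact: ltW.
  by rewrite le_max lexx.
set v := (t - lam) / (1 - lam).
have h : `|G k v - v| <= rho ^+ k.
  apply: IH; first by rewrite divr_ge0 ?subr_ge0 // ltW.
  by rewrite ler_pdivrMr // mul1r lerD2r.
have -> : lam + (1 - lam) * G k v - t = (1 - lam) * (G k v - v).
  by rewrite mulrBr [(1 - lam) * v]mulrC divfK ?gt_eqF //; ring.
rewrite normrM (gtr0_norm l10) exprS; apply: ler_pM => //; first exact: ltW.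
by rewrite le_max lexx orbT.
Qed.

Let F_tr k t tau : lt_trace tau -> tau (F k 0 t) = (G k t)%:C%C.
Proof. by move=> tauP; rewrite -[F k 0 t]ul (F_trace _ _ (In_u 0) tauP) u1 // mulr1. Qed.

(** F increases with its depth, so the squared 2-norm of a difference is a difference
of traces; these are within rho^m of t. *)
Let F_cauchy t m n : 0 <= t -> t <= 1 -> (m <= n)%N -> n2 (F n 0 t - F m 0 t) <= r m.
Proof.
move=> t0 t1 mn; apply: (n2_le T0) => // tau tauP.
have FF : F m 0 t ** F n 0 t = F m 0 t by exact: F_mono.
have FF' : F n 0 t ** F m 0 t = F m 0 t by rewrite -{1}(F_star m) -(F_star n) -starM FF.
rewrite starB !F_star smulBl !smulBr !F_mul // FF FF' subrr subr0.
rewrite (limtrB tauP) !F_tr // -rmorphB /=.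
have h1 := G_err m t0 t1; have h2 := G_err n t0 t1.
have h3 : rho ^+ n <= rho ^+ m by rewrite ler_wiXn2l // ltW.
have -> : r m ^+ 2 = 4 * rho ^+ m by rewrite /r exprMn -exprM mulnC exprM sigma2; ring.
move: h1 h2; rewrite !ler_norml => /andP[a1 a2] /andP[a3 a4].
have := exprn_ge0 m rho0; lra.
Qed.

Let Q_ex t : exists y, 0 <= t -> t <= 1 ->
  liftable 2 y /\ forall m, n2 (y - F m 0 t) <= r m.
Proof.
have [/andP[t0 t1]|/negP nt] := boolP ((0 <= t) && (t <= 1)); last first.
  by exists 0 => t0 t1; case: nt; rewrite t0 t1.
have [|m n mn|y yC yP] := @n2_cauchy R omega A T0 (fun m => F m 0 t) 2 r _ r_small.
- by move=> k; apply: liftable_proj; split; [exact: F_star|exact: F_mul].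
- exact: F_cauchy.
- by exists y.
Qed.

Let r_eq0 x C : 0 <= C -> (forall m, n2 x <= C * r m) -> x = 0.
Proof.
move=> C0 H; apply: (n2_eps0 T0 C0) => e e0 _.
have [N NP] := r_small e0; apply: le_trans (H N) _.
by rewrite ler_wpM2l // ltW // NP.
Qed.

(** Q_t is the 2-norm limit of the approximations, which exists by bounded
completeness. *)
Lemma projection_chain : exists Q : R -> U,
  [/\ forall t, 0 <= t -> t <= 1 -> is_projection (Q t) /\
        forall k, Q t ** d k = d k ** Q t,
      forall s t, 0 <= s -> s <= t -> t <= 1 -> Q s ** Q t = Q s,
      forall k t tau, 0 <= t -> t <= 1 -> lt_trace tau ->
        tau (d k ** Q t) = t%:C%C * tau (d k) &
      forall t tau, 0 <= t -> t <= 1 -> lt_trace tau -> tau (Q t) = t%:C%C].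
Proof.
have [Q QP] := choice Q_ex.
have F2 m t : liftable 2 (F m 0 t).
  by apply: liftable_proj; split; [exact: F_star|exact: F_mul].
have Qmul s t : 0 <= s -> s <= t -> t <= 1 -> Q s ** Q t = Q s.
  move=> s0 st t1; apply/eqP; rewrite -subr_eq0; apply/eqP.
  have [Qs2 Qs] := QP s s0 (le_trans st t1).
  have [Qt2 Qt] := QP t (le_trans s0 st) t1.
  apply: (@r_eq0 _ 5) => // m.
  have -> : Q s ** Q t - Q s =
      (Q s - F m 0 s) ** Q t + F m 0 s ** (Q t - F m 0 t) - (Q s - F m 0 s).
    by rewrite smulBl smulBr (F_mul _ _ st); lmod_ring.
  apply: le_trans (n2B T0 _ _) _.
  apply: le_trans (lerD (n2D T0 _ _) (lexx _)) _.
  have h1 := n2Mr T0 (Q s - F m 0 s) Qt2.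
  have h2 := n2Ml T0 (Q t - F m 0 t) (F2 m s).
  have := Qs m; have := Qt m; lra.
have Qstar t : 0 <= t -> t <= 1 -> (Q t)^# = Q t.
  move=> t0 t1; apply/eqP; rewrite -subr_eq0; apply/eqP.
  have [_ Qt] := QP t t0 t1; apply: (@r_eq0 _ 2) => // m.
  have -> : (Q t)^# - Q t = (Q t - F m 0 t)^# - (Q t - F m 0 t).
    by rewrite starB F_star; lmod_ring.
  apply: le_trans (n2B T0 _ _) _; rewrite n2_star //; have := Qt m; lra.
have Qtr x t tau C : 0 <= t -> t <= 1 -> lt_trace tau -> liftable C x ->
    (forall m, tau (x ** F m 0 t) = (G m t)%:C%C * tau x) -> tau (x ** Q t) = t%:C%C * tau x.
  move=> t0 t1 tauP xC H; apply/eqP; rewrite -subr_eq0; apply/eqP.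
  have [_ Qt] := QP t t0 t1; have C0 := liftable_ge0 xC.
  apply: (@nrm_small0 _ _ (C + nrm (tau x))); first by rewrite addr_ge0 ?nrm_ge0.
  move=> e e0 _; have [N NP] := r_small e0; have {}NP := NP N (leqnn N).
  have -> : tau (x ** Q t) - t%:C%C * tau x =
      tau (x ** (Q t - F N 0 t)) + (G N t - t)%:C%C * tau x.
    by rewrite smulBr (limtrB tauP) H rmorphB /=; ring.
  apply: le_trans (nrmD _ _) _; rewrite mulrDl; apply: lerD.
    apply: le_trans (limtr_le_n2 T0 _ tauP) _; apply: le_trans (n2Ml T0 _ xC) _.
    by rewrite ler_wpM2l // (le_trans (Qt N)) // ltW.
  rewrite nrmMc nrm_real mulrC ler_wpM2l ?nrm_ge0 //.
  apply: le_trans (G_err N t0 t1) _; apply: le_trans (ltW NP).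
  rewrite /r -sigma2 -exprM mulnC exprM expr2.
  have := exprn_ge0 N sigma0; have := exprn_ile1 N sigma0 (ltW sigma1).
  move: (sigma ^+ N) => q; nra.
exists Q; split => //.
- move=> t t0 t1; split; first by split; [exact: Qstar|exact: Qmul].
  move=> k; have [C C0 dC] := liftable_ex (d k).
  apply/eqP; rewrite -subr_eq0; apply/eqP; apply: (@r_eq0 _ (C + C)); first lra.
  move=> m; have [_ /(_ m) Qt] := QP t t0 t1.
  have -> : Q t ** d k - d k ** Q t = (Q t - F m 0 t) ** d k - d k ** (Q t - F m 0 t).
    by rewrite smulBl smulBr F_d; lmod_ring.
  apply: le_trans (n2B T0 _ _) _; rewrite mulrDl; apply: lerD.
    by apply: le_trans (n2Mr T0 _ dC) _; rewrite ler_wpM2l.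
  by apply: le_trans (n2Ml T0 _ dC) _; rewrite ler_wpM2l.
- move=> k t tau t0 t1 tauP; have [C C0 dC] := liftable_ex (d k).
  by apply: (Qtr _ _ _ _ t0 t1 tauP dC) => m; apply: F_trace => //; exact: In_d.
- move=> t tau t0 t1 tauP; have [C C0 uC] := liftable_ex u.
  rewrite -[Q t]ul (Qtr _ _ _ _ t0 t1 tauP uC); first by rewrite u1 // mulr1.
  by move=> m; exact: (F_trace _ _ (In_u 0) tauP).
Qed.
End Chain.

(** * Step functions as formal combinations of initial intervals *)

Section StepList.
Context {R : realType}.
(** A pair (c, t) stands for c times the indicator function of [0, t[. Keeping formal
lists avoids choosing a partition: the same list has a value in R^R and one in
A^omega, and both are compatible with products. *)
Definition step := seq (R * R).
Implicit Types (l m : step) (c t x k : R).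

Definition step_ok l := all (fun ct => 0 <= ct.2 <= 1) l.
Definition step_ev l x : R := \sum_(ct <- l) ct.1 * (x < ct.2)%R%:R.
Definition step_len l : R := \sum_(ct <- l) ct.1 * ct.2.
Definition step_scale k l : step := [seq (k * ct.1, ct.2) | ct <- l].
Definition step_mul l m : step :=
  [seq (ct.1 * ct'.1, Num.min ct.2 ct'.2) | ct <- l, ct' <- m].

Lemma step_ok_cat l m : step_ok (l ++ m) = step_ok l && step_ok m.
Proof. exact: all_cat. Qed.
Lemma step_ok_scale k l : step_ok (step_scale k l) = step_ok l.
Proof. by rewrite /step_ok all_map. Qed.
Lemma step_ok_mul l m : step_ok l -> step_ok m -> step_ok (step_mul l m).
Proof.
move=> /allP ol /allP om; apply/allP => _ /allpairsP[[a b] /= [al bm ->]] /=.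
have /andP[a0 a1] := ol a al; have /andP[b0 b1] := om b bm.
by rewrite le_min a0 b0 /= ge_min a1.
Qed.

Lemma step_ev_cat l m x : step_ev (l ++ m) x = step_ev l x + step_ev m x.
Proof. exact: big_cat. Qed.
Lemma step_ev_scale k l x : step_ev (step_scale k l) x = k * step_ev l x.
Proof.
by rewrite /step_ev big_map big_distrr /=; apply: eq_bigr => ct _; rewrite mulrA.
Qed.
Lemma step_ev_mul l m x : step_ev (step_mul l m) x = step_ev l x * step_ev m x.
Proof.
rewrite /step_ev big_allpairs_dep big_distrl /=; apply: eq_bigr => a _.
rewrite big_distrr /=; apply: eq_bigr => b _; rewrite lt_min.
by case: (x < a.2); case: (x < b.2); rewrite /= ?(mulr0, mulr1, mul0r).
Qed.
End StepList.

Section StepValues.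
Context {R : realType} (omega : freeUltrafilter) {A : cstarAlgType R}.
Local Notation U := (ultrapower omega A).
Local Notation n2 := (@n2 R omega A).
Local Notation lt_trace := (limit_traces (omega := omega) (A := A)).
Implicit Types (x y z : U) (tau : U -> R[i]) (s t c k : R) (l m : @step R).
Hypothesis T0 : traces A !=set0.
Variable u : U.
Hypotheses (uI : is_identity u) (u1 : forall tau, lt_trace tau -> tau u = 1).
Variable Q : R -> U.
Hypotheses (Qproj : forall t, 0 <= t -> t <= 1 -> is_projection (Q t))
  (Qmul : forall s t, 0 <= s -> s <= t -> t <= 1 -> Q s ** Q t = Q s)
  (Qtr : forall t tau, 0 <= t -> t <= 1 -> lt_trace tau -> tau (Q t) = t%:C%C).

Definition step_phi l : U := \sum_(ct <- l) ct.1%:C%C *: Q ct.2.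

Lemma step_phi_cat l m : step_phi (l ++ m) = step_phi l + step_phi m.
Proof. exact: big_cat. Qed.

Lemma step_phi_scale k l : step_phi (step_scale k l) = k%:C%C *: step_phi l.
Proof.
rewrite /step_phi big_map scaler_sumr; apply: eq_bigr => ct _.
by rewrite rmorphM /= scalerA.
Qed.

Lemma step_phi_cons ct l : step_phi (ct :: l) = ct.1%:C%C *: Q ct.2 + step_phi l.
Proof. exact: big_cons. Qed.

Lemma Q_min s t : 0 <= s <= 1 -> 0 <= t <= 1 -> Q s ** Q t = Q (Num.min s t).
Proof.
move=> /andP[s0 s1] /andP[t0 t1]; case: (leP s t) => st; first by rewrite Qmul.
have [sE _] := Qproj s0 s1; have [tE _] := Qproj t0 t1.
by rewrite -sE -tE -starM Qmul ?tE // ltW.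
Qed.

Lemma step_phi_mul l m : step_ok l -> step_ok m ->
  step_phi (step_mul l m) = step_phi l ** step_phi m.
Proof.
elim: l => [|a l IH]; first by rewrite /step_phi /= !big_nil smul0l.
rewrite /step_ok /= => /andP[a01 ol] om; rewrite step_phi_cat IH // step_phi_cons smulDl.
congr (_ + _); elim: m om {IH ol} => [|b m IH].
  by rewrite /step_phi !big_nil smul0r.
rewrite /= => /andP[b01 om]; rewrite !step_phi_cons IH //= smulDr.
by congr (_ + _); rewrite smulZl smulZr Q_min // scalerA rmorphM.
Qed.

Lemma step_phi_star l : step_ok l -> (step_phi l)^# = step_phi l.
Proof.
elim: l => [|a l IH]; first by rewrite /step_phi !big_nil star0.
rewrite /step_ok /= => /andP[/andP[a0 a1] ol];
  rewrite step_phi_cons starD IH // starZ conjc_real.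
by have [-> _] := Qproj a0 a1.
Qed.

Lemma step_phi_tr l tau : step_ok l -> lt_trace tau -> tau (step_phi l) = (step_len l)%:C%C.
Proof.
move=> + tauP; elim: l => [|a l IH]; first by rewrite /step_phi /step_len !big_nil limtr0.
rewrite /step_ok /= => /andP[/andP[a0 a1] ol].
by rewrite step_phi_cons (limtrD tauP) (limtrZ tauP) Qtr // IH // /step_len big_cons
  rmorphD rmorphM.
Qed.

Lemma step_phi_mul_tr l tau x : step_ok l -> lt_trace tau ->
  (forall t, 0 <= t -> t <= 1 -> tau (x ** Q t) = t%:C%C * tau x) ->
  tau (x ** step_phi l) = (step_len l)%:C%C * tau x.
Proof.
move=> + tauP H; elim: l => [|a l IH].
  by rewrite /step_phi /step_len !big_nil smul0r limtr0 // mul0r.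
rewrite /step_ok /= => /andP[/andP[a0 a1] ol].
rewrite step_phi_cons smulDr smulZr (limtrD tauP) (limtrZ tauP) H // IH //.
by rewrite /step_len big_cons rmorphD rmorphM /=; ring.
Qed.

Lemma step_phi_comm l x : step_ok l ->
  (forall t, 0 <= t -> t <= 1 -> Q t ** x = x ** Q t) -> step_phi l ** x = x ** step_phi l.
Proof.
move=> + H; elim: l => [|a l IH]; first by rewrite /step_phi !big_nil smul0l smul0r.
rewrite /step_ok /= => /andP[/andP[a0 a1] ol].
by rewrite step_phi_cons smulDl smulDr smulZl smulZr H // IH.
Qed.

(** The squared 2-norm of the value of l is the trace of the value of l l, which is the
length of l l. *)
Lemma step_phi_n2 l (M : R) : step_ok l -> 0 <= M ->
  step_len (step_mul l l) <= M ^+ 2 -> n2 (step_phi l) <= M.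
Proof.
move=> ol M0 h; apply: (n2_le T0) => // tau tauP.
by rewrite step_phi_star // -step_phi_mul // step_phi_tr // step_ok_mul.
Qed.

Lemma Q1 : Q 1 = u.
Proof.
apply/eqP; rewrite eq_sym -subr_eq0; apply/eqP; apply: (n2_eq0 T0).
have [QE QQ] := Qproj ler01 (lexx 1).
have uE := identity_star uI.
apply: (n2_le T0) => // tau tauP; rewrite starB QE uE smulBl !smulBr QQ.
rewrite (uI u).1 (uI (Q 1)).1 (uI (Q 1)).2 subrr subr0 (limtrB tauP) u1 // Qtr //.
by rewrite subrr expr0n.
Qed.

Section Cells.
Variable n : nat.
Hypothesis n0 : (0 < n)%N.
Let node (i : nat) : R := i%:R / n%:R.
Let nR : (0 : R) < n%:R. Proof. by rewrite ltr0n. Qed.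
Let node_ge0 i : 0 <= node i. Proof. by rewrite divr_ge0. Qed.
Let node_le1 i : (i <= n)%N -> node i <= 1.
Proof. by move=> ni; rewrite /node ler_pdivrMr // mul1r ler_nat. Qed.
Let node_le i j : (i <= j)%N -> node i <= node j.
Proof. by move=> ij; rewrite ler_pM2r ?invr_gt0 // ler_nat. Qed.
Let node01 i : (i <= n)%N -> 0 <= node i <= 1.
Proof. by move=> h; rewrite node_ge0 node_le1. Qed.

(** The projection attached to [i/n, (i+1)/n[. *)
Definition cell i : U := Q (i.+1%:R / n%:R) - Q (i%:R / n%:R).

Lemma Qnode i j : (i <= n)%N -> (j <= n)%N -> Q (node i) ** Q (node j) = Q (node (minn i j)).
Proof.
move=> ni nj; rewrite Q_min ?node01 //; congr Q.
case: (leqP i j) => ij; first by rewrite min_l // node_le.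
by rewrite min_r // node_le // ltnW.
Qed.

Lemma cell_mul i j : (i < n)%N -> (j < n)%N ->
  cell i ** cell j = if i == j then cell i else 0.
Proof.
move=> ni nj; have ni' := ltnW ni; have nj' := ltnW nj.
rewrite /cell -!/(node _) smulBl !smulBr !Qnode //.
have [ij|ji|<-] := ltngtP i j.
- have e1 : minn i.+1 j.+1 = i.+1 by apply/minn_idPl; rewrite ltnS ltnW.
  have e2 : minn i j.+1 = i by apply/minn_idPl; apply: ltnW; exact: ltnW.
  rewrite e1 e2 (minn_idPl ij); lmod_ring.
- have e1 : minn i.+1 j.+1 = j.+1 by apply/minn_idPr; rewrite ltnS ltnW.
  have e2 : minn i.+1 j = j by apply/minn_idPr; apply: ltnW; exact: ltnW.
  rewrite e1 e2 (minn_idPr ji); lmod_ring.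
- rewrite !minnn (minn_idPr (leqnSn _)) (minn_idPl (leqnSn _)); lmod_ring.
Qed.

Lemma cell_star i : (i < n)%N -> (cell i)^# = cell i.
Proof.
move=> ni; rewrite /cell starB.
have [-> _] := Qproj (node_ge0 i.+1) (node_le1 ni).
by have [-> _] := Qproj (node_ge0 i) (node_le1 (ltnW ni)).
Qed.

Lemma cell_sum : \sum_(i < n) cell i = u - Q 0.
Proof.
rewrite -(big_mkord xpredT cell) telescope_sumr // divff ?gt_eqF //.
by rewrite mul0r Q1.
Qed.

Lemma cells_proj (c : nat -> R) : (forall i, c i = 0 \/ c i = 1) ->
  is_projection (\sum_(i < n) (c i)%:C%C *: cell i).
Proof.
move=> c01; split.
  elim/big_ind: _ => [|x y xE yE|i _]; first exact: star0.
    by rewrite starD xE yE.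
  by rewrite starZ conjc_real cell_star.
rewrite smul_suml; apply: eq_bigr => i _; rewrite smul_sumr (bigD1 i) //= big1 ?addr0.
  rewrite smulZl smulZr cell_mul // eqxx scalerA.
  by case: (c01 i) => ->; rewrite ?mulr1 ?mulr0.
move=> j ji; rewrite smulZl smulZr cell_mul //.
by rewrite eq_sym (inj_eq val_inj) (negPf ji) !scaler0.
Qed.

(** Elements with lifts bounded by 2 form a convex set. It contains the vertices of the
cube of coefficients, which are projections, hence the whole cube. *)
Lemma cells_liftable (c : nat -> R) : (forall i, 0 <= c i <= 1) ->
  liftable 2 (\sum_(i < n) (c i)%:C%C *: cell i).
Proof.
move=> c01; pose c' i := if (i < n)%N then c i else 0.
have -> : \sum_(i < n) (c i)%:C%C *: cell i = \sum_(i < n) (c' i)%:C%C *: cell i.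
  by apply: eq_bigr => i _; rewrite /c' ltn_ord.
have {}c01 i : 0 <= c' i <= 1 by rewrite /c'; case: ifP => // _; rewrite lexx ler01.
have : forall i, (n <= i)%N -> c' i = 0 \/ c' i = 1.
  by move=> i ni; left; rewrite /c' ltnNge ni.
(* Induction on the number j of coordinates that may differ from 0 and 1. *)
suff H (j : nat) : forall b : nat -> R, (forall i, 0 <= b i <= 1) ->
    (forall i : nat, (j <= i)%N -> b i = 0 \/ b i = 1) ->
    liftable 2 (\sum_(i < n) (b i)%:C%C *: cell i) by exact: (H n).
elim: j {c c' c01} => [|j IH] c c01 cm.
  by apply: liftable_proj; apply: cells_proj => i; exact: cm.
pose c1 i := if i == j then 1 else c i; pose c0 i := if i == j then 0 else c i.
have cE i : c i = c j * c1 i + (1 - c j) * c0 i.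
  by rewrite /c1 /c0; case: eqP => [->|_]; ring.
have -> : \sum_(i < n) (c i)%:C%C *: cell i =
   (c j)%:C%C *: (\sum_(i < n) (c1 i)%:C%C *: cell i) +
   (1 - c j)%:C%C *: (\sum_(i < n) (c0 i)%:C%C *: cell i).
  rewrite !scaler_sumr -big_split; apply: eq_bigr => i _ /=.
  by rewrite !scalerA -scalerDl cE rmorphD !rmorphM.
have /andP[m0 m1] := c01 j; apply: liftable_convex => //; apply: IH.
- by move=> i; rewrite /c1; case: ifP; rewrite ?lexx ?ler01.
- move=> i mi; rewrite /c1; case: eqP => [_|/eqP im]; first by right.
  by apply: cm; rewrite ltn_neqAle eq_sym im.
- by move=> i; rewrite /c0; case: ifP; rewrite ?lexx ?ler01.
- move=> i mi; rewrite /c0; case: eqP => [_|/eqP im]; first by left.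
  by apply: cm; rewrite ltn_neqAle eq_sym im.
Qed.

(** The value c i on [i/n, (i+1)/n[ is encoded as c i on [0, (i+1)/n[ minus c i on
[0, i/n[. *)
Definition cell_step (c : nat -> R) : @step R :=
  flatten [seq [:: (c i, i.+1%:R / n%:R); (- c i, i%:R / n%:R)] | i <- iota 0 n].

Lemma cell_step_phi (c : nat -> R) :
  step_phi (cell_step c) = \sum_(i < n) (c i)%:C%C *: cell i.
Proof.
rewrite -(big_mkord xpredT (fun i => (c i)%:C%C *: cell i)) /index_iota subn0.
rewrite /step_phi big_flatten big_map; apply: eq_bigr => i _.
rewrite !big_cons big_nil /= /cell rmorphN; lmod_ring.
Qed.

Lemma cell_step_ok (c : nat -> R) : step_ok (cell_step c).
Proof.
apply/allP => ct /flattenP[_ /mapP[i + ->]]; rewrite mem_iota add0n /= => ni.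
by rewrite !inE => /predU1P[->|/eqP ->] /=; apply: node01 => //; exact: ltnW.
Qed.

Lemma cell_step_ev (c : nat -> R) (x : R) i : (i < n)%N -> i%:R / n%:R <= x ->
  x < i.+1%:R / n%:R ->
  step_ev (cell_step c) x = c i.
Proof.
move=> ni xi xi1; rewrite /step_ev big_flatten big_map.
have -> : iota 0 n = index_iota 0 n by rewrite /index_iota subn0.
rewrite big_mkord (bigD1 (Ordinal ni)) //= [X in _ + X]big1 ?addr0.
  by rewrite !big_cons big_nil /= xi1 ltNge xi /= mulr1 mulr0 !addr0.
move=> j; rewrite -(inj_eq val_inj) /= => ji.
rewrite !big_cons big_nil /= addr0 mulNr -mulrBr.
have [jlt|jgt|/eqP] := ltngtP j i; last by rewrite (negPf ji).
  have h1 : (x < j.+1%:R / n%:R) = false.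
    by apply/negbTE; rewrite -leNgt; apply: le_trans xi; exact: node_le.
  have h2 : (x < j%:R / n%:R) = false.
    by apply/negbTE; rewrite -leNgt; apply: le_trans xi; apply: node_le; exact: ltnW.
  by rewrite h1 h2 subrr mulr0.
have h1 : x < j%:R / n%:R by apply: lt_le_trans xi1 _; exact: node_le.
by rewrite h1 (lt_le_trans h1 (node_le (leqnSn _))) subrr mulr0.
Qed.

Lemma cell_step_ev_out (c : nat -> R) (x : R) : x < 0 \/ 1 <= x ->
  step_ev (cell_step c) x = 0.
Proof.
move=> xo; rewrite /step_ev big_flatten big_map big_seq big1 // => i.
rewrite mem_iota add0n /= => ni; rewrite !big_cons big_nil /= addr0 mulNr -mulrBr.
case: xo => x0.
  by rewrite (lt_le_trans x0 (node_ge0 i)) (lt_le_trans x0 (node_ge0 i.+1)) subrr mulr0.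
rewrite !ltNge (le_trans (node_le1 ni) x0) (le_trans (node_le1 (ltnW ni)) x0).
by rewrite subrr mulr0.
Qed.

Lemma cell_ex (x : R) : 0 <= x -> x < 1 -> exists2 i, (i < n)%N &
  (i%:R / n%:R <= x) && (x < i.+1%:R / n%:R).
Proof.
move=> x0 x1; pose i := Num.truncn (x * n%:R).
have xn0 : 0 <= x * n%:R by rewrite mulr_ge0.
have /andP[h1 h2] := truncn_itv xn0.
exists i; last by rewrite ler_pdivrMr // ltr_pdivlMr // h1 h2.
rewrite -(ltr_nat R); apply: le_lt_trans h1 _.
by rewrite -[ltRHS]mul1r ltr_pM2r.
Qed.
End Cells.
End StepValues.

(** * Bounded measurable functions on the unit interval *)

#[local] Instance ae_lebesgue_filter (R : realType) :
  Filter (nbhs (almost_everywhere (@lebesgue_measure R))).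
Proof. exact: ae_filter_ringOfSetsType. Qed.

Section UnitIntervalIntegral.
Context {R : realType}.
Local Notation mu := (@lebesgue_measure R).
Local Notation I01 := (`[0, 1]%classic : set R).
Implicit Types (f g h : R -> R) (k : R) (l : @step R).

Definition bmeas f := measurable_fun I01 f /\ exists M, forall t, I01 t -> `|f t| <= M.
Definition int01 f : R := \int[mu]_(t in I01) f t.

Lemma mu_I01 : mu I01 = 1%:E.
Proof. by rewrite lebesgue_measure_itv /= lte_fin ltr01 sube0. Qed.

Lemma mI01 : measurable I01. Proof. exact: measurable_itv. Qed.

Lemma bmeas_integrable f : bmeas f -> mu.-integrable I01 (EFin \o f).
Proof.
move=> [mf [M fM]]; apply: measurable_bounded_integrable => //.
  by rewrite [X in (X < _)%E]mu_I01 ltry.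
exists M; split; first exact: num_real.
by move=> x Mx t t01 /=; apply: le_trans (fM t t01) _; exact: ltW.
Qed.

Lemma bmeas_cst k : bmeas (fun=> k).
Proof. by split; [exact: measurable_cst|exists `|k|]. Qed.
Lemma bmeasD f g : bmeas f -> bmeas g -> bmeas (fun t => f t + g t).
Proof.
move=> [mf [M fM]] [mg [N gN]]; split; first exact: measurable_funD.
by exists (M + N) => t t01; apply: le_trans (ler_normD _ _) _; apply: lerD;
  [exact: fM|exact: gN].
Qed.
Lemma bmeasM f g : bmeas f -> bmeas g -> bmeas (fun t => f t * g t).
Proof.
move=> [mf [M fM]] [mg [N gN]]; split; first exact: measurable_funM.
by exists (M * N) => t t01; rewrite normrM ler_pM ?fM ?gN.
Qed.
Lemma bmeasZ k f : bmeas f -> bmeas (fun t => k * f t).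
Proof. by move=> hf; apply: bmeasM => //; exact: bmeas_cst. Qed.
Lemma bmeasB f g : bmeas f -> bmeas g -> bmeas (fun t => f t - g t).
Proof.
move=> hf hg; rewrite (_ : (fun t => _) = (fun t => f t + (-1) * g t)).
  by apply: bmeasD => //; exact: bmeasZ.
by apply/funext => t; rewrite mulN1r.
Qed.
Lemma bmeas_abs f : bmeas f -> bmeas (fun t => `|f t|).
Proof.
move=> [mf [M fM]]; split; first exact: measurableT_comp.
by exists M => t t01; rewrite normr_id fM.
Qed.

Lemma bmeas_ind (s : R) : bmeas (fun t => (t < s)%R%:R).
Proof.
split; last by exists 1 => t _; case: (t < s); rewrite ?normr1 ?normr0.
rewrite (_ : (fun t => _) = \1_(`]-oo, s[%classic : set R)).
  by apply: measurable_indic.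
by apply/funext => t; rewrite indicE mem_setE in_itv.
Qed.

Lemma bmeas_step l : bmeas (step_ev l).
Proof.
elim: l => [|a l IH].
  rewrite (_ : step_ev [::] = fun=> 0); first exact: bmeas_cst.
  by apply/funext => t; rewrite /step_ev big_nil.
rewrite (_ : step_ev (a :: l) = fun t => a.1 * (t < a.2)%R%:R + step_ev l t).
  by apply: bmeasD => //; apply: bmeasZ; exact: bmeas_ind.
by apply/funext => t; rewrite /step_ev big_cons.
Qed.

Lemma int01D f g : bmeas f -> bmeas g ->
  int01 (fun t => f t + g t) = int01 f + int01 g.
Proof. by move=> /bmeas_integrable hf /bmeas_integrable hg; apply: (RintegralD _ hf hg);
  exact: mI01. Qed.
Lemma int01B f g : bmeas f -> bmeas g ->
  int01 (fun t => f t - g t) = int01 f - int01 g.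
Proof. by move=> /bmeas_integrable hf /bmeas_integrable hg; apply: (RintegralB _ hf hg);
  exact: mI01. Qed.
Lemma int01Z k f : bmeas f -> int01 (fun t => k * f t) = k * int01 f.
Proof. by move=> /bmeas_integrable hf; apply: (RintegralZl _ _ hf); exact: mI01. Qed.
Lemma le_int01 f g : bmeas f -> bmeas g -> (forall t, 0 <= t <= 1 -> f t <= g t) ->
  int01 f <= int01 g.
Proof.
move=> /bmeas_integrable hf /bmeas_integrable hg fg; apply: (le_Rintegral _ hf hg);
  first exact: mI01.
by move=> t /=; rewrite in_itv /=; exact: fg.
Qed.
Lemma int01_cst k : int01 (fun=> k) = k.
Proof.
rewrite /int01 Rintegral_cst; last exact: mI01.
by rewrite [X in fine X]mu_I01 mulr1.
Qed.
Lemma abs_int01 f : bmeas f -> `|int01 f| <= int01 (fun t => `|f t|).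
Proof. by move=> /bmeas_integrable hf; apply: (le_normr_Rintegral _ hf); exact: mI01. Qed.

Lemma int01_ind (s : R) : 0 <= s <= 1 -> int01 (fun t => (t < s)%R%:R) = s.
Proof.
move=> /andP[s0 s1]; rewrite /int01 /Rintegral.
rewrite (_ : (fun t : R => _) = (fun t => (\1_(`]-oo, s[%classic : set R) t)%:E)); last first.
  by apply/funext => t; rewrite indicE mem_setE in_itv.
rewrite integral_indic //.
rewrite (_ : _ `&` _ = `[0, s[%classic); last first.
  apply/seteqP; split => t /=; rewrite !in_itv /=.
    by move=> [ts /andP[t0 _]]; rewrite t0 ts.
  by move=> /andP[t0 ts]; rewrite ts t0 (le_trans (ltW ts) s1).
have H : mu (`[0, s[%classic : set R) = s%:E.
  rewrite lebesgue_measure_itv /= lte_fin; case: ltP => s0'; first by rewrite sube0.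
  by congr EFin; apply/eqP; rewrite eq_le s0 s0'.
by rewrite [X in fine X]H.
Qed.

Lemma int01_step l : step_ok l -> int01 (step_ev l) = step_len l.
Proof.
elim: l => [|a l IH].
  move=> _; rewrite (_ : step_ev [::] = fun=> 0).
    by rewrite int01_cst /step_len big_nil.
  by apply/funext => t; rewrite /step_ev big_nil.
rewrite /step_ok /= => /andP[a01 ol].
rewrite (_ : step_ev (a :: l) = fun t => a.1 * (t < a.2)%R%:R + step_ev l t); last first.
  by apply/funext => t; rewrite /step_ev big_cons.
rewrite int01D; [|by apply: bmeasZ; exact: bmeas_ind|exact: bmeas_step].
by rewrite int01Z ?int01_ind // ?IH // ?/step_len ?big_cons //; exact: bmeas_ind.
Qed.

Definition L1 f := int01 (fun t => `|f t|).

Lemma L1_ge0 f : 0 <= L1 f.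
Proof. by apply: Rintegral_ge0 => t _. Qed.

Lemma L1_le f h : bmeas f -> bmeas h -> (forall t, 0 <= t <= 1 -> `|f t| <= h t) ->
  L1 f <= int01 h.
Proof. by move=> hf hh H; apply: le_int01 => //; exact: bmeas_abs. Qed.

Lemma L1D f g : bmeas f -> bmeas g -> L1 (fun t => f t + g t) <= L1 f + L1 g.
Proof.
move=> hf hg; rewrite /L1 -int01D; try exact: bmeas_abs.
by apply: L1_le => [||t _]; [exact: bmeasD|apply: bmeasD; exact: bmeas_abs|exact: ler_normD].
Qed.

Lemma L1Z k f : bmeas f -> L1 (fun t => k * f t) = `|k| * L1 f.
Proof.
move=> hf; rewrite /L1 -int01Z; last exact: bmeas_abs.
by congr int01; apply/funext => t; rewrite normrM.
Qed.

Definition ae01 f g := {ae mu, forall t, I01 t -> f t = g t}.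

Lemma int01_ae f g : measurable_fun I01 f -> measurable_fun I01 g -> ae01 f g ->
  int01 f = int01 g.
Proof.
move=> mf mg fg; rewrite /int01 /Rintegral; congr fine.
apply: ae_eq_integral.
- exact: mI01.
- exact/measurable_EFinP.
- exact/measurable_EFinP.
- by apply: filterS fg => t fg t01 /=; rewrite fg.
Qed.

Lemma L1_ae f g h : bmeas f -> bmeas g -> bmeas h -> ae01 f g ->
  L1 (fun t => f t - h t) = L1 (fun t => g t - h t).
Proof.
move=> hf hg hh fg.
have [mf _] : bmeas (fun t => `|f t - h t|) by apply: bmeas_abs; exact: bmeasB.
have [mg _] : bmeas (fun t => `|g t - h t|) by apply: bmeas_abs; exact: bmeasB.
apply: (int01_ae mf mg).
by apply: filterS fg => t fg t01 /=; rewrite fg.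
Qed.

(** Near each point one value of n suffices by continuity; compactness of [0, 1] makes
it uniform. *)
Lemma unif_cont01 f (e : R) : continuous f -> 0 < e ->
  exists n, (0 < n)%N /\ forall x y, 0 <= x <= 1 -> `|x - y| <= n%:R^-1 -> `|f x - f y| <= e.
Proof.
move=> fc e0; have := @segment_compact R 0 1.
move=> /compact_near_coveringP/(_ nat \oo
  (fun n x => forall y, `|x - y| <= n%:R^-1 -> `|f x - f y| <= e)) [].
  move=> x _; have e2 : 0 < e / 2 by rewrite divr_gt0.
  have /cvgrPdist_lt/(_ _ e2)[/= d d0 H] := fc x.
  have d2 : 0 < d / 2 by rewrite divr_gt0.
  pose N := Num.bound (d / 2)^-1.
  exists (ball x (d / 2), [set n | (N <= n)%N]).
    split => /=; first exact: nbhsx_ballx.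
    by exists N.
  move=> [z n] /= [xz Nn] y zy.
  have n0 : (d / 2)^-1 < n%:R.
    apply: lt_le_trans (archi_boundP _) _; first by rewrite invr_ge0 ltW.
    by rewrite ler_nat.
  have nd : n%:R^-1 < d / 2.
    rewrite -[X in _ < X]invrK ltf_pV2 ?posrE //; last by rewrite invr_gt0.
    by apply: lt_trans n0; rewrite invr_gt0.
  have hz : `|f x - f z| < e / 2.
    by apply: H => /=; apply: lt_trans xz _; lra.
  have hy : `|f x - f y| < e / 2.
    apply: H => /=; rewrite -[x - y](subrKA z).
    apply: le_lt_trans (ler_normD _ _) _.
    have := ltrD xz (le_lt_trans zy nd); lra.
  rewrite -[f z - f y](subrKA (f x)).
  apply: le_trans (ler_normD _ _) _; rewrite distrC; lra.
move=> N _ H; exists N.+1; split => // x y x01 xy.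
apply: (H N.+1) => //=; by rewrite in_itv.
Qed.
End UnitIntervalIntegral.

Section StepApprox.
Context {R : realType}.
Local Notation mu := (@lebesgue_measure R).
Local Notation I01 := (`[0, 1]%classic : set R).

Definition clamp01 (y : R) : R := Num.max 0 (Num.min 1 y).

Lemma clamp01_itv y : 0 <= clamp01 y <= 1.
Proof. by rewrite /clamp01 le_max lexx /= ge_max ler01 ge_min lexx. Qed.

Lemma clamp01_dist a y : 0 <= a <= 1 -> `|a - clamp01 y| <= `|a - y|.
Proof.
move=> /andP[a0 a1]; rewrite /clamp01.
have [y1|y1] := leP 1 y.
  rewrite max_r // ler_norml; have := ler_norm (- (a - y)); rewrite normrN => h.
  by apply/andP; split; lra.
have [y0|y0] := leP 0 y; first by [].
rewrite ler_norml; have := ler_norm (a - y) => h.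
by apply/andP; split; lra.
Qed.

(** Continuous functions are dense in L1, and they are uniformly continuous on [0, 1].
Clamping the values of the continuous function only improves the approximation of
f. The end point 1, where step functions vanish, accounts for the last term of h. *)
Lemma step_approx (f : R -> R) (e : R) : bmeas f ->
  (forall t, 0 <= t <= 1 -> 0 <= f t <= 1) ->
  0 < e -> exists n c, [/\ (0 < n)%N, forall i, 0 <= c i <= 1 &
    L1 (fun t => f t - step_ev (cell_step n c) t) <= e].
Proof.
move=> hf f01 e0; have e2 : 0 < e / 2 by rewrite divr_gt0.
have muI : (mu I01 < +oo)%E by rewrite [X in (X < _)%E]mu_I01 ltry.
have [g_ [gc gi gl]] := approximation_continuous_integrable mI01 muI (bmeas_integrable hf).
have [g [gcont fg]] : exists g : R -> R, continuous g /\ L1 (fun t => f t - g t) <= e / 2.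
  have /fine_cvgP[_ /cvgrPdist_lt/(_ _ e2)] := gl.
  move=> [N _ /(_ N (leqnn N)) /=]; rewrite sub0r normrN => h.
  by exists (g_ N); split => //; apply: ltW; apply: le_lt_trans h; exact: ler_norm.
have [n [n0 gn]] := unif_cont01 gcont e2.
have hg : bmeas g.
  split.
    by apply: measurable_funS (continuous_measurable_fun gcont) => //; exact: measurableT.
  have [|c _ gcP] := @EVT_max R (fun t => `|g t|) 0 1 ler01.
    apply: continuous_subspaceT => x; apply: continuous_comp; first exact: gcont.
    exact: norm_continuous.
  by exists `|g c| => t t01; exact: gcP.
pose c i := clamp01 (g (i%:R / n%:R)).
exists n, c; split => //; first by move=> i; exact: clamp01_itv.
pose h t := `|f t - g t| + (e / 2 + (1 - (t < 1)%R%:R)).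
have hfg : bmeas (fun t => `|f t - g t|) by apply: bmeas_abs; exact: bmeasB.
have hi : bmeas (fun t : R => 1 - (t < 1)%R%:R).
  by apply: bmeasB; [exact: bmeas_cst|exact: bmeas_ind].
have he : bmeas (fun t : R => e / 2 + (1 - (t < 1)%R%:R)).
  by apply: bmeasD => //; exact: bmeas_cst.
have hh : bmeas h by exact: bmeasD.
have -> : e = e / 2 + e / 2 by rewrite -splitr.
apply: le_trans (_ : int01 h <= _).
  apply: L1_le => //; first by apply: bmeasB => //; exact: bmeas_step.
  move=> t /andP[t0]; rewrite le_eqVlt => /predU1P[->|t1].
    rewrite cell_step_ev_out //; last by right.
    rewrite /h ltxx subr0 /=; have := f01 1; rewrite ler01 lexx => /(_ isT)/andP[a0 a1].
    by rewrite ger0_norm //; have := normr_ge0 (f 1 - g 1); lra.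
  have [i ni /andP[i1 i2]] := cell_ex n0 t0 t1.
  rewrite (cell_step_ev n0 _ ni i1 i2) /h t1 subrr addr0.
  apply: le_trans (clamp01_dist _ (f01 t _)) _; first by rewrite t0 ltW.
  rewrite -[f t - g (i%:R / n%:R)](subrKA (g t)); apply: le_trans (ler_normD _ _) _.
  rewrite lerD2l; apply: gn; first by rewrite t0 ltW.
  rewrite ger0_norm ?subr_ge0 //; move: i2; rewrite -natr1 mulrDl mul1r; lra.
rewrite int01D // int01D //; last exact: bmeas_cst.
rewrite int01B; [|exact: bmeas_cst|exact: bmeas_ind].
by rewrite !int01_cst int01_ind ?ler01 ?lexx // subrr addr0 lerD2r.
Qed.
End StepApprox.

(** * Integration of bounded functions against the chain *)

Section Representation.
Context {R : realType} (omega : freeUltrafilter) {A : cstarAlgType R}.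
Local Notation U := (ultrapower omega A).
Local Notation n2 := (@n2 R omega A).
Local Notation lt_trace := (limit_traces (omega := omega) (A := A)).
Implicit Types (x y z : U) (tau : U -> R[i]) (s t k : R) (l m : @step R) (f g : R -> R).
Hypothesis T0 : traces A !=set0.
Variable u : U.
Hypotheses (uI : is_identity u) (u1 : forall tau, lt_trace tau -> tau u = 1).
Variable Q : R -> U.
Hypotheses (Qproj : forall t, 0 <= t -> t <= 1 -> is_projection (Q t))
  (Qmul : forall s t, 0 <= s -> s <= t -> t <= 1 -> Q s ** Q t = Q s)
  (Qtr : forall t tau, 0 <= t -> t <= 1 -> lt_trace tau -> tau (Q t) = t%:C%C).
Local Notation phi := (step_phi Q).
Local Notation I01 := (`[0, 1]%classic : set R).

(** x is the limit of the values of step lists which converge to f in L1, with uniform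
bounds: the bound on step functions turns L1 convergence into L2 convergence, and
the bound on lifts makes products converge. *)
Definition represents f x := exists C, forall e : R, 0 < e -> exists l,
  [/\ step_ok l, forall t, 0 <= t <= 1 -> `|step_ev l t| <= C, liftable C (phi l),
      L1 (fun t => f t - step_ev l t) <= e & n2 (x - phi l) <= e].

Lemma bmeas_res f l : bmeas f -> bmeas (fun t => f t - step_ev l t).
Proof. by move=> hf; apply: bmeasB => //; exact: bmeas_step. Qed.

(** The 2-norm of the value of l is the L2-norm of the step function, and its square
is at most C |step_ev l|. *)
Lemma n2_phi l (C : R) : step_ok l -> 0 <= C ->
  (forall t, 0 <= t <= 1 -> `|step_ev l t| <= C) ->
  n2 (phi l) <= Num.sqrt (C * L1 (step_ev l)).
Proof.
move=> ol C0 lC; apply: (step_phi_n2 T0 Qproj Qmul Qtr ol (sqrtr_ge0 _)).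
rewrite sqr_sqrtr ?mulr_ge0 ?L1_ge0 // -int01_step ?step_ok_mul //.
have hl := bmeas_step l; have ha := bmeas_abs hl.
rewrite /L1 -int01Z //; apply: le_int01; [exact: bmeas_step|exact: bmeasZ|].
move=> t t01; rewrite step_ev_mul -expr2 -real_normK ?num_real // expr2.
by rewrite ler_wpM2r // lC.
Qed.

Lemma represents_n2 f l m (C D e : R) : bmeas f ->
  step_ok l -> step_ok m -> 0 <= C -> 0 <= D ->
  (forall t, 0 <= t <= 1 -> `|step_ev l t| <= C) ->
  (forall t, 0 <= t <= 1 -> `|step_ev m t| <= D) ->
  L1 (fun t => f t - step_ev l t) <= e -> L1 (fun t => f t - step_ev m t) <= e ->
  n2 (phi l - phi m) <= Num.sqrt ((C + D) * (e + e)).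
Proof.
move=> hf ol om C0 D0 lC mD le me.
pose q := l ++ step_scale (-1) m.
have oq : step_ok q by rewrite step_ok_cat ol step_ok_scale.
have qE t : step_ev q t = step_ev l t - step_ev m t.
  by rewrite step_ev_cat step_ev_scale mulN1r.
have -> : phi l - phi m = phi q.
  by rewrite step_phi_cat step_phi_scale rmorphN1 scaleN1r.
apply: le_trans (n2_phi (C := C + D) oq _ _) _; first by rewrite addr_ge0.
  by move=> t t01; rewrite qE; apply: le_trans (ler_normB _ _) _; apply: lerD;
    [exact: lC|exact: mD].
rewrite ler_wsqrtr // ler_wpM2l ?addr_ge0 //.
apply: le_trans (lerD le me); rewrite /L1 -int01D; try by apply: bmeas_abs; exact: bmeas_res.
apply: le_int01; first by apply: bmeas_abs; exact: bmeas_step.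
  by apply: bmeasD; apply: bmeas_abs; exact: bmeas_res.
move=> t _; rewrite qE.
have -> : step_ev l t - step_ev m t = (f t - step_ev m t) - (f t - step_ev l t) by ring.
by rewrite [leRHS]addrC; exact: ler_normB.
Qed.

Let h01 : 0 <= (0 : R) <= 1. Proof. by rewrite lexx ler01. Qed.

(** Two step functions close to f in L1 are close to each other in L2. *)
Lemma represents_uniq f x y : bmeas f -> represents f x -> represents f y -> x = y.
Proof.
move=> hf [C xC] [D yD]; apply/eqP; rewrite -subr_eq0; apply/eqP.
have C0 : 0 <= C.
  by have [l [_ /(_ 0) h _ _ _]] := xC 1 ltr01; exact: le_trans (normr_ge0 _) (h h01).
have D0 : 0 <= D.
  by have [l [_ /(_ 0) h _ _ _]] := yD 1 ltr01; exact: le_trans (normr_ge0 _) (h h01).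
pose K := Num.sqrt ((C + D) * 2).
apply: (@n2_eps0 _ _ _ T0 _ (2 + K)); first by rewrite addr_ge0 // sqrtr_ge0.
move=> e e0 e1; have ee : 0 < e ^+ 2 by rewrite exprn_gt0.
have [l [ol lC _ lf xl]] := xC _ ee; have [m [om mD _ mf ym]] := yD _ ee.
have h := represents_n2 hf ol om C0 D0 lC mD lf mf.
have hE : Num.sqrt ((C + D) * (e ^+ 2 + e ^+ 2)) = K * e.
  have -> : (C + D) * (e ^+ 2 + e ^+ 2) = (C + D) * 2 * e ^+ 2 by ring.
  by rewrite sqrtrM ?mulr_ge0 ?addr_ge0 // sqrtr_sqr gtr0_norm.
rewrite hE in h.
have -> : x - y = (x - phi l) + (phi l - phi m) - (y - phi m) by lmod_ring.
apply: le_trans (n2B T0 _ _) _; apply: le_trans (lerD (n2D T0 _ _) (lexx _)) _.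
have e2 : e ^+ 2 <= e by rewrite expr2 ler_piMr // ltW.
have -> : (2 + K) * e = e + K * e + e by ring.
by apply: lerD; [apply: lerD => //|]; apply: le_trans e2.
Qed.

Lemma represents_ae f g x : bmeas f -> bmeas g -> ae01 f g ->
  represents f x -> represents g x.
Proof.
move=> hf hg fg [C xC]; exists C => e e0; have [l [h1 h2 h3 h4 h5]] := xC e e0.
exists l; split => //; rewrite -(L1_ae hf hg) //; exact: bmeas_step.
Qed.

Lemma represents_lin k f g x y : bmeas f -> bmeas g ->
  represents f x -> represents g y ->
  represents (fun t => k * f t + g t) (k%:C%C *: x + y).
Proof.
move=> hf hg [C xC] [D yD]; exists (`|k| * C + D) => e e0.
have k1 : 0 < `|k| + 1 by rewrite ltr_wpDl.
have e1 : 0 < e / 2 / (`|k| + 1) by rewrite !divr_gt0.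
have e2 : 0 < e / 2 by rewrite divr_gt0.
have ke : `|k| * (e / 2 / (`|k| + 1)) + e / 2 <= e.
  have : `|k| * (e / 2 / (`|k| + 1)) <= e / 2.
    by rewrite mulrA ler_pdivrMr // [leLHS]mulrC ler_wpM2l ?ltW // ltrDl.
  lra.
have [l [ol lC lL lf xl]] := xC _ e1; have [m [om mD mL mf ym]] := yD _ e2.
exists (step_scale k l ++ m); split.
- by rewrite step_ok_cat step_ok_scale ol.
- move=> t t01; rewrite step_ev_cat step_ev_scale; apply: le_trans (ler_normD _ _) _.
  by rewrite normrM lerD ?mD // ler_wpM2l // lC.
- rewrite step_phi_cat step_phi_scale.
  by have := liftable_lin k%:C%C lL mL; rewrite nrm_real.
- apply: le_trans ke.
  have -> : (fun t => k * f t + g t - step_ev (step_scale k l ++ m) t) =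
     (fun t => k * (f t - step_ev l t) + (g t - step_ev m t)).
    by apply/funext => t; rewrite step_ev_cat step_ev_scale; ring.
  apply: le_trans (L1D (bmeasZ _ (bmeas_res _ hf)) (bmeas_res _ hg)) _.
  by rewrite L1Z; [apply: lerD => //; exact: ler_wpM2l|exact: bmeas_res].
- apply: le_trans ke; rewrite step_phi_cat step_phi_scale.
  have -> : k%:C%C *: x + y - (k%:C%C *: phi l + phi m) = k%:C%C *: (x - phi l) + (y - phi m).
    by lmod_ring.
  apply: le_trans (n2D T0 _ _) _; apply: lerD => //.
  by apply: le_trans (n2Z T0 _ _) _; rewrite nrm_real ler_wpM2l.
Qed.

Lemma represents_mul f g x y : bmeas f -> bmeas g ->
  represents f x -> represents g y -> represents (fun t => f t * g t) (x ** y).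
Proof.
move=> hf hg [C xC] [D yD]; exists (C * D) => e e0.
have [_ [M gM]] := hg; have [N N0 yN] := liftable_ex y.
have M0 : 0 <= M by apply: le_trans (gM 0 _) => //; rewrite /= in_itv /= lexx ler01.
have C0 : 0 <= C.
  by have [l [_ /(_ 0) h _ _ _]] := xC 1 ltr01; exact: le_trans (normr_ge0 _) (h h01).
have e2 : 0 < e / 2 by rewrite divr_gt0.
pose K := M + N + 1; have K0 : 0 < K by rewrite /K; lra.
have KC : 0 < C + 1 by lra.
have eK : 0 < e / 2 / K by rewrite !divr_gt0.
have eC : 0 < e / 2 / (C + 1) by rewrite !divr_gt0.
have bound (P E : R) : 0 <= P -> 0 < E -> P <= E -> P * (e / 2 / E) <= e / 2.
  move=> P0 E0 PE; rewrite mulrA ler_pdivrMr // [leLHS]mulrC ler_wpM2l // ltW //.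
have [l [ol lC lL lf xl]] := xC _ eK; have [m [om mD mL mf ym]] := yD _ eC.
exists (step_mul l m); split.
- exact: step_ok_mul.
- by move=> t t01; rewrite step_ev_mul normrM ler_pM ?lC ?mD.
- by rewrite step_phi_mul //; exact: liftableM.
- have hfl := bmeas_res l hf; have hgm := bmeas_res m hg.
  apply: le_trans (_ : M * L1 (fun t => f t - step_ev l t) +
    C * L1 (fun t => g t - step_ev m t) <= _).
    rewrite /L1 -!int01Z; try exact: bmeas_abs.
    rewrite -int01D; try by apply: bmeasZ; exact: bmeas_abs.
    apply: L1_le.
    - by apply: bmeasB; [exact: bmeasM|exact: bmeas_step].
    - by apply: bmeasD; apply: bmeasZ; exact: bmeas_abs.
    move=> t t01; rewrite step_ev_mul.
    have -> : f t * g t - step_ev l t * step_ev m t =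
      g t * (f t - step_ev l t) + step_ev l t * (g t - step_ev m t) by ring.
    apply: le_trans (ler_normD _ _) _; rewrite !normrM; apply: lerD; apply: ler_wpM2r => //.
      by apply: gM; rewrite /= in_itv.
    exact: lC.
  have h1 := ler_wpM2l M0 lf; have h2 := ler_wpM2l C0 mf.
  have h3 := bound M K M0 K0 _; have h4 := bound C (C + 1) C0 KC _.
  have {}h3 := h3 (ltac:(rewrite /K; lra)); have {}h4 := h4 (ltac:(lra)); lra.
- rewrite step_phi_mul //.
  have -> : x ** y - phi l ** phi m = (x - phi l) ** y + phi l ** (y - phi m) by star_ring.
  apply: le_trans (n2D T0 _ _) _.
  have h1 := n2Mr T0 (x - phi l) yN; have h2 := n2Ml T0 (y - phi m) lL.
  have h3 := ler_wpM2l N0 xl; have h4 := ler_wpM2l C0 ym.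
  have h5 := bound N K N0 K0 (ltac:(rewrite /K; lra)).
  have h6 := bound C (C + 1) C0 KC (ltac:(lra)); lra.
Qed.

Lemma represents_cst1 : represents (fun=> 1) u.
Proof.
have [C C0 uC] := liftable_ex u.
exists (1 + C) => e e0; exists [:: (1, 1)].
have evE t : step_ev [:: (1, 1)] t = (t < 1)%R%:R.
  by rewrite /step_ev big_cons big_nil addr0 mul1r.
have phiE : phi [:: (1, 1)] = u.
  by rewrite step_phi_cons /step_phi big_nil addr0 scale1r (Q1 T0 uI u1 Qproj Qtr).
split.
- by rewrite /step_ok /= ler01 lexx.
- by move=> t _; rewrite evE; case: (t < 1); rewrite ?normr1 ?normr0; lra.
- by rewrite phiE; apply: liftable_le uC; lra.
- have -> : L1 (fun t => 1 - step_ev [:: (1, 1)] t) = 0; last exact: ltW.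
  have -> : L1 (fun t => 1 - step_ev [:: (1, 1)] t) = int01 (fun t => 1 - (t < 1)%R%:R).
    rewrite /L1; congr int01; apply/funext => t; rewrite evE ger0_norm //.
    by case: (t < 1); rewrite ?subrr ?subr0.
  rewrite int01B; [|exact: bmeas_cst|exact: bmeas_ind].
  by rewrite int01_cst int01_ind ?subrr // ler01 lexx.
- by rewrite phiE subrr n2_0 // ltW.
Qed.

Lemma represents_tr f x (a : U) tau : bmeas f -> represents f x -> lt_trace tau ->
  (forall t, 0 <= t -> t <= 1 -> tau (a ** Q t) = t%:C%C * tau a) ->
  tau (a ** x) = tau a * (int01 f)%:C%C.
Proof.
move=> hf [C xC] tauP H; apply/eqP; rewrite -subr_eq0; apply/eqP.
have [K K0 aK] := liftable_ex a.
apply: (@nrm_small0 _ _ (K + nrm (tau a))); first by rewrite addr_ge0 ?nrm_ge0.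
move=> e e0 _; have [l [ol _ _ lf xl]] := xC e e0.
have -> : tau (a ** x) - tau a * (int01 f)%:C%C =
   tau (a ** (x - phi l)) - tau a * (int01 f - step_len l)%:C%C.
  by rewrite smulBr (limtrB tauP) (step_phi_mul_tr ol tauP H) rmorphB /=; ring.
apply: le_trans (nrmB _ _) _; rewrite mulrDl; apply: lerD.
  apply: le_trans (limtr_le_n2 T0 _ tauP) _; apply: le_trans (n2Ml T0 _ aK) _.
  by rewrite ler_wpM2l.
rewrite nrmMc nrm_real ler_wpM2l ?nrm_ge0 //.
rewrite -int01_step // -int01B //; last exact: bmeas_step.
by apply: le_trans (abs_int01 (bmeas_res l hf)) _.
Qed.

Lemma represents_comm f x (a : U) : represents f x ->
  (forall t, 0 <= t -> t <= 1 -> Q t ** a = a ** Q t) -> x ** a = a ** x.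
Proof.
move=> [C xC] H; apply/eqP; rewrite -subr_eq0; apply/eqP.
have [K K0 aK] := liftable_ex a.
apply: (@n2_eps0 _ _ _ T0 _ (K + K)); first by rewrite addr_ge0.
move=> e e0 _; have [l [ol _ _ _ xl]] := xC e e0.
have -> : x ** a - a ** x = (x - phi l) ** a - a ** (x - phi l).
  by rewrite smulBl smulBr (step_phi_comm ol H); lmod_ring.
apply: le_trans (n2B T0 _ _) _; rewrite mulrDl; apply: lerD.
  by apply: le_trans (n2Mr T0 _ aK) _; rewrite ler_wpM2l.
by apply: le_trans (n2Ml T0 _ aK) _; rewrite ler_wpM2l.
Qed.

Lemma represents_star f x : represents f x -> x^# = x.
Proof.
move=> [C xC]; apply/eqP; rewrite -subr_eq0; apply/eqP.
apply: (@n2_eps0 _ _ _ T0 _ 2) => // e e0 _; have [l [ol _ _ _ xl]] := xC e e0.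
have -> : x^# - x = (x - phi l)^# - (x - phi l).
  by rewrite starB (step_phi_star Qproj ol); lmod_ring.
apply: le_trans (n2B T0 _ _) _; rewrite n2_star //; lra.
Qed.

(** The step lists of [step_approx] have coefficients in [0, 1], hence values with lifts
bounded by 2, so that bounded completeness applies. *)
Lemma represents_ex01 f : bmeas f -> (forall t, 0 <= t <= 1 -> 0 <= f t <= 1) ->
  exists x, represents f x.
Proof.
move=> hf f01.
(* An L1-error of 4^-k / 16 gives a 2-norm increment below 2^-k. *)
have p4 (k : nat) : 0 < 4^-1 ^+ k / 16 :> R by rewrite divr_gt0 // exprn_gt0 // invr_gt0.
have ex (k : nat) : exists l, [/\ step_ok l, forall t, 0 <= t <= 1 -> `|step_ev l t| <= 1,
    liftable 2 (phi l) & L1 (fun t => f t - step_ev l t) <= 4^-1 ^+ k / 16].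
  have [n [c [n0 c01 h]]] := step_approx hf f01 (p4 k).
  exists (cell_step n c); split => //; first exact: cell_step_ok.
    move=> t /andP[t0]; rewrite le_eqVlt => /predU1P[->|t1].
      by rewrite cell_step_ev_out ?normr0 //; right.
    have [i ni /andP[i1 i2]] := cell_ex n0 t0 t1.
    rewrite (cell_step_ev n0 _ ni i1 i2); have /andP[a0 a1] := c01 i.
    by rewrite ger0_norm.
  rewrite cell_step_phi; exact: (cells_liftable Qproj Qmul n0 c01).
have [l lP] := choice ex.
have cau (k : nat) : n2 (phi (l k.+1) - phi (l k)) < 2^-1 ^+ k.
  have [k1 b1 _ h1] := lP k.+1; have [k2 b2 _ h2] := lP k.
  have h1' : L1 (fun t => f t - step_ev (l k.+1) t) <= 4^-1 ^+ k / 16.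
    apply: le_trans h1 _; rewrite ler_pM2r ?invr_gt0 // exprS ler_piMl
      ?exprn_ge0 ?invr_ge0 //.
    by rewrite invf_le1 // ler1n.
  apply: le_lt_trans (represents_n2 hf k1 k2 ler01 ler01 b1 b2 h1' h2) _.
  have -> : (2^-1 : R) ^+ k = Num.sqrt (4^-1 ^+ k).
    have -> : (4^-1 : R) ^+ k = (2^-1 ^+ k) ^+ 2.
      have -> : (4^-1 : R) = 2^-1 ^+ 2 by field.
      by rewrite -!exprM mulnC.
    by rewrite sqrtr_sqr ger0_norm // exprn_ge0 // invr_ge0.
  rewrite ltr_sqrt; last by rewrite exprn_gt0 // invr_gt0.
  have : 0 < (4^-1 : R) ^+ k by rewrite exprn_gt0 // invr_gt0.
  move: (_ ^+ k) => q; lra.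
have [y yC yP] := n2_complete T0 (x := fun k : nat => phi (l k)) (C := 2)
  (fun k : nat => let: And4 _ _ h _ := lP k in h) cau.
exists y, 2 => e e0.
have [N NP] := @expr_small R 2^-1 (e / 2) (ltac:(by rewrite invr_ge0))
  (ltac:(by rewrite invf_lt1 // ltr1n)) (divr_gt0 e0 (ltr0n _ 2)).
have {}NP := NP N (leqnn N).
have [k1 b h1 h2] := lP N; exists (l N); split => //.
- by move=> t t01; apply: le_trans (b t t01) _; lra.
- apply: le_trans h2 _.
  have : (4^-1 : R) ^+ N <= 2^-1 ^+ N.
    by apply: lerXn2r; rewrite ?nnegrE ?invr_ge0 // lef_pV2 ?posrE // ler_nat.
  have : 0 < (4^-1 : R) ^+ N by rewrite exprn_gt0 // invr_gt0.
  move: (4^-1 ^+ N) => p; move: (2^-1 ^+ N) NP => q; lra.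
- apply: le_trans (yP N) _; move: (2^-1 ^+ N) NP => q; lra.
Qed.

(** Reduction to values in [0, 1] by an affine change of values. *)
Lemma represents_ex f : bmeas f -> exists x, represents f x.
Proof.
move=> hf; have [mf [M fM]] := hf.
pose N := `|M| + 1; have N0 : 0 < N by rewrite /N ltr_wpDl.
have fN t : 0 <= t <= 1 -> `|f t| <= N.
  move=> t01; have /fM ft : I01 t by rewrite /= in_itv.
  by apply: le_trans ft _; rewrite (le_trans (ler_norm M)) // lerDl.
clearbody N.
pose r t := (2 * N)^-1 * f t + 2^-1.
have hr : bmeas r by apply: bmeasD; [exact: bmeasZ|exact: bmeas_cst].
have N2 : 0 < 2 * N by lra.
have [x xr] : exists x, represents r x.
  apply: represents_ex01 => // t t01; have := fN t t01; rewrite ler_norml => /andP[a b].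
  have -> : r t = (f t + N) / (2 * N) by rewrite /r; field; rewrite gt_eqF.
  apply/andP; split; first by apply: divr_ge0; lra.
  by rewrite ler_pdivrMr // mul1r; lra.
exists ((2 * N)%:C%C *: x + ((- N)%:C%C *: u + 0)).
have r0 : represents (fun=> 0) 0.
  have := represents_lin (- 1) (bmeas_cst 1) (bmeas_cst 1) represents_cst1 represents_cst1.
  by rewrite rmorphN1 scaleN1r addNr mulN1r addNr.
have h1 := represents_lin (- N) (bmeas_cst 1) (bmeas_cst 0) represents_cst1 r0.
have h2 := represents_lin (2 * N) hr (bmeas_cst _) xr h1.
rewrite (_ : f = fun t => 2 * N * r t + (- N * 1 + 0)) //.
apply/funext => t; rewrite /r; field; rewrite gt_eqF //.
Qed.
End Representation.

(** * Separable sets in the ultrapower *)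

Section Separability.
Context {R : realType} (omega : freeUltrafilter) {A : cstarAlgType R}.
Local Notation U := (ultrapower omega A).
Local Notation n2 := (@n2 R omega A).
Local Notation lt_trace := (limit_traces (omega := omega) (A := A)).
Local Notation iota := (@const_embed R omega A).
Hypothesis T0 : traces A !=set0.

Definition in_closure (d : nat -> U) (a : U) :=
  forall e : R, 0 < e -> exists k, n2 (a - d k) < e.

Lemma separable_seq (S : set U) : S 0 -> norm2_separable lt_trace S ->
  exists d : nat -> U, forall a, S a -> in_closure d a.
Proof.
move=> S0 [D [cD DS Dd]].
have /countable_injP[f finj] := cD.
have ex (k : nat) : exists x, (exists2 y, D y & f y = k) -> D x /\ f x = k.
  have [[y Dy fy]|n] := EM (exists2 y, D y & f y = k); first by exists y.
  by exists 0.
have [d dP] := choice ex.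
exists d => a Sa e e0; have [x Dx xe] := Dd a e Sa e0.
exists (f x); have [Dy fy] := dP (f x) (ex_intro2 _ _ x Dx erefl).
by rewrite (finj _ _ (mem_set Dy) (mem_set Dx) fy).
Qed.

Lemma closure_comm d a x : in_closure d a -> (forall k, x ** d k = d k ** x) ->
  x ** a = a ** x.
Proof.
move=> da H; apply/eqP; rewrite -subr_eq0; apply/eqP.
have [K K0 xK] := liftable_ex x.
apply: (@n2_eps0 _ _ _ T0 _ (K + K)); first by rewrite addr_ge0.
move=> e e0 _; have [k /ltW ak] := da e e0.
have -> : x ** a - a ** x = x ** (a - d k) - (a - d k) ** x.
  by rewrite smulBl smulBr H; lmod_ring.
apply: le_trans (n2B T0 _ _) _; rewrite mulrDl; apply: lerD.
  by apply: le_trans (n2Ml T0 _ xK) _; rewrite ler_wpM2l.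
by apply: le_trans (n2Mr T0 _ xK) _; rewrite ler_wpM2l.
Qed.

Lemma closure_trace d a x (c : R[i]) tau : in_closure d a -> lt_trace tau ->
  (forall k, tau (d k ** x) = c * tau (d k)) -> tau (a ** x) = c * tau a.
Proof.
move=> da tauP H; apply/eqP; rewrite -subr_eq0; apply/eqP.
have [K K0 xK] := liftable_ex x.
apply: (@nrm_small0 _ _ (K + nrm c)); first by rewrite addr_ge0 ?nrm_ge0.
move=> e e0 _; have [k /ltW ak] := da e e0.
have -> : tau (a ** x) - c * tau a = tau ((a - d k) ** x) - c * tau (a - d k).
  by rewrite smulBl !(limtrB tauP) H; ring.
apply: le_trans (nrmB _ _) _; rewrite mulrDl; apply: lerD.
  apply: le_trans (limtr_le_n2 T0 _ tauP) _; apply: le_trans (n2Mr T0 _ xK) _.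
  by rewrite ler_wpM2l.
rewrite nrmMc ler_wpM2l ?nrm_ge0 //.
exact: le_trans (limtr_le_n2 T0 _ tauP) ak.
Qed.

Lemma iota_lin k x y : iota (k *: x + y) = k *: iota x + iota y.
Proof. by rewrite -piZ -piD; congr ultra_pi; apply/val_inj. Qed.
Lemma iotaM x y : iota (x ** y) = iota x ** iota y.
Proof. by rewrite -piM; congr ultra_pi; apply/val_inj. Qed.
Lemma iota0 : iota 0 = 0.
Proof. by have := iota_lin (-1) 0 0; rewrite scaleN1r oppr0 addr0 scaleN1r addNr. Qed.
Lemma iotaB x y : iota (x - y) = iota x - iota y.
Proof. by rewrite addrC -scaleN1r iota_lin scaleN1r addrC. Qed.

Lemma n2_iota x : n2 (iota x) <= nrm x.
Proof.
have [c cE cV] := const_lift omega x; rewrite -cE; apply: (n2_le_near T0).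
apply: nearW => n; rewrite cV; apply: norm2_sup_le; first exact: nrm_ge0.
by move=> tau tauP; exact: tnorm_le_nrm.
Qed.

Lemma range_iota_subalgebra : is_subalgebra (range iota).
Proof.
split; first by exists 0 => //; exact: iota0.
  by move=> k _ _ [x _ <-] [y _ <-]; exists (k *: x + y) => //; exact: iota_lin.
by move=> _ _ [x _ <-] [y _ <-]; exists (x ** y) => //; exact: iotaM.
Qed.

Lemma range_iota_separable : separable_space A -> norm2_separable lt_trace (range iota).
Proof.
move=> [D [cD dD]]; exists (iota @` D); split.
- exact: (sub_countable (card_image_le _ _) cD).
- by move=> _ [x _ <-]; exists x.
move=> _ e [x _ <-] e0.
have eC : 0 < e%:C%C by rewrite (ltcR 0 e).
have [|y [/= xy Dy]] := dD (ball x e%:C%C) _ (ball_open _ _).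
  by exists x; exact: ballxx.
exists (iota y); first by exists y.
rewrite -iotaB; apply: le_lt_trans (n2_iota _) _.
by move: xy; rewrite -ball_normE /= nrmE ltcR.
Qed.
End Separability.

(** * The homomorphism on essentially bounded functions *)

Section LinftyCalculus.
Context {R : realType}.
Local Notation mu := (@lebesgue_measure R).
Local Notation I01 := (`[0, 1]%classic : set R).
Local Notation val := (@subalg_val R _ _).

Definition ess_meas (f : R -> R) := measurable_fun I01 f /\
  exists M, {ae mu, forall t, I01 t -> `|f t| <= M}.

(** Truncation at the essential bound. *)
Lemma ess_meas_bmeas f : ess_meas f -> exists2 g, bmeas g & ae01 f g.
Proof.
move=> [mf [M fM]]; pose g t := Num.max (- `|M|) (Num.min `|M| (f t)).
exists g.
  split.
    apply: measurable_maxr; first exact: measurable_cst.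
    by apply: measurable_minr => //; exact: measurable_cst.
  exists `|M| => t _; rewrite /g ler_norml le_max lexx /= ge_max.
  by rewrite ge_min lexx /= andbT; have := normr_ge0 M; lra.
apply: filterS fM => t fM t01; have := le_trans (fM t01) (ler_norm M).
by rewrite ler_norml => /andP[h1 h2]; rewrite /g min_r // max_r.
Qed.

Lemma ess_bounded_Re (f : ess_bounded R) : ess_meas (fun t => complex.Re (val f t)).
Proof.
have /set_mem[mr _ [M fM]] := subalg_valP f; split => //.
exists (complex.Re M); apply: filterS fM => t fM t01.
have := fM t01; rewrite nrmE lecE => /andP[_ h].
exact: le_trans (abs_Re_le _) h.
Qed.
Lemma ess_bounded_Im (f : ess_bounded R) : ess_meas (fun t => complex.Im (val f t)).
Proof.
have /set_mem[_ mi [M fM]] := subalg_valP f; split => //.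
exists (complex.Re M); apply: filterS fM => t fM t01.
have := fM t01; rewrite nrmE lecE => /andP[_ h].
exact: le_trans (abs_Im_le _) h.
Qed.

Lemma ess_bounded_lin k (F G : ess_bounded R) t : val (k *: F + G) t = k * val F t + val G t.
Proof. by []. Qed.
Lemma ess_bounded_mul (F G : ess_bounded R) t : val (F ** G) t = val F t * val G t.
Proof. by []. Qed.
Lemma ess_bounded_star (F : ess_bounded R) t : val F^# t = ((val F t)^*)%C.
Proof. by []. Qed.

Section Calculus.
Context (omega : freeUltrafilter) {A : cstarAlgType R}.
Local Notation U := (ultrapower omega A).
Local Notation n2 := (@n2 R omega A).
Local Notation lt_trace := (limit_traces (omega := omega) (A := A)).
Implicit Types (x y z : U) (tau : U -> R[i]) (f g : R -> R) (F G : ess_bounded R).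
Hypothesis T0 : traces A !=set0.
Variable u : U.
Hypotheses (uI : is_identity u) (u1 : forall tau, lt_trace tau -> tau u = 1).
Variable Q : R -> U.
Hypotheses (Qproj : forall t, 0 <= t -> t <= 1 -> is_projection (Q t))
  (Qmul : forall s t, 0 <= s -> s <= t -> t <= 1 -> Q s ** Q t = Q s)
  (Qtr : forall t tau, 0 <= t -> t <= 1 -> lt_trace tau -> tau (Q t) = t%:C%C).

(** The functions of L^oo are bounded almost everywhere only. *)
Definition ess_rep f x := exists g, [/\ bmeas g, ae01 f g & represents Q g x].

Lemma ess_rep_ex f : ess_meas f -> exists x, ess_rep f x.
Proof.
move=> /ess_meas_bmeas[g hg fg].
by have [x gx] := represents_ex T0 uI u1 Qproj Qmul Qtr hg; exists x, g.
Qed.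

Lemma ess_rep_uniq f g x y : ess_rep f x -> ess_rep g y -> ae01 f g -> x = y.
Proof.
move=> [f' [hf ff' fx]] [g' [hg gg' gy]] fg.
apply: (represents_uniq T0 Qproj Qmul Qtr hg _ gy).
apply: represents_ae hf hg _ fx.
apply: filterS (filterI (filterI ff' gg') fg) => t [[h1 h2] h3] t01.
by rewrite -h1 // h3 // h2.
Qed.

Lemma ess_rep_lin k f g x y : ess_rep f x -> ess_rep g y ->
  ess_rep (fun t => k * f t + g t) (k%:C%C *: x + y).
Proof.
move=> [f' [hf ff' fx]] [g' [hg gg' gy]].
exists (fun t => k * f' t + g' t); split.
- by apply: bmeasD => //; exact: bmeasZ.
- by apply: filterS (filterI ff' gg') => t [h1 h2] t01; rewrite h1 // h2.
- exact: represents_lin.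
Qed.

Lemma ess_rep_mul f g x y : ess_rep f x -> ess_rep g y ->
  ess_rep (fun t => f t * g t) (x ** y).
Proof.
move=> [f' [hf ff' fx]] [g' [hg gg' gy]].
exists (fun t => f' t * g' t); split.
- exact: bmeasM.
- by apply: filterS (filterI ff' gg') => t [h1 h2] t01; rewrite h1 // h2.
- exact: represents_mul.
Qed.

Lemma ess_rep1 : ess_rep (fun=> 1) u.
Proof.
exists (fun=> 1); split; first exact: bmeas_cst.
  by apply: nearW => t _.
exact: (represents_cst1 T0 uI u1 Qproj Qtr).
Qed.

Lemma ess_rep0 : ess_rep (fun=> 0) 0.
Proof.
have := ess_rep_lin (-1) ess_rep1 ess_rep1; rewrite rmorphN1 scaleN1r addNr.
by rewrite mulN1r addNr.
Qed.

Lemma ess_rep_star f x : ess_rep f x -> x^# = x.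
Proof. by move=> [g [_ _ gx]]; exact: (represents_star T0 Qproj gx). Qed.

Lemma ess_rep_comm f x a : ess_rep f x ->
  (forall t, 0 <= t -> t <= 1 -> Q t ** a = a ** Q t) ->
  x ** a = a ** x.
Proof. by move=> [g [_ _ gx]] H; exact: (represents_comm T0 gx H). Qed.

Lemma ess_rep_tr f x a tau : measurable_fun I01 f -> ess_rep f x -> lt_trace tau ->
  (forall t, 0 <= t -> t <= 1 -> tau (a ** Q t) = t%:C%C * tau a) ->
  tau (a ** x) = tau a * (int01 f)%:C%C.
Proof.
move=> mf [g [hg fg gx]] tauP H; rewrite (represents_tr T0 hg gx tauP H).
by rewrite (int01_ae mf _ fg) //; case: hg.
Qed.

(** Real and imaginary parts are treated separately, since [represents] deals with
self-adjoint elements. *)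
Definition cplx_rep F x := exists a b, [/\ ess_rep (fun t => complex.Re (val F t)) a,
  ess_rep (fun t => complex.Im (val F t)) b & x = a + 'i%C *: b].

Lemma cplx_rep_ex F : exists x, cplx_rep F x.
Proof.
have [a ra] := ess_rep_ex (ess_bounded_Re F); have [b rb] := ess_rep_ex (ess_bounded_Im F).
by exists (a + 'i%C *: b), a, b.
Qed.

Lemma cplx_rep_uniq F G x y : cplx_rep F x -> cplx_rep G y -> Linfty_pi F = Linfty_pi G ->
  x = y.
Proof.
move=> [a [b [ra rb ->]]] [c [d [rc rd ->]]] /quot_piP FG.
have FGt : {ae mu, forall t, I01 t -> val F t = val G t}.
  by apply: filterS FG => t h t01; apply/eqP; rewrite -subr_eq0; apply/eqP; exact: h.
rewrite (ess_rep_uniq ra rc); last by apply: filterS FGt => t h t01; rewrite h.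
by rewrite (ess_rep_uniq rb rd) //; apply: filterS FGt => t h t01; rewrite h.
Qed.

Let ii : 'i%C * 'i%C = -1 :> R[i].
Proof. by rewrite -expr2 sqr_i. Qed.

Lemma cplx_rep_lin k F G x y : cplx_rep F x -> cplx_rep G y ->
  cplx_rep (k *: F + G) (k *: x + y).
Proof.
move=> [a [b [ra rb ->]]] [c [d [rc rd ->]]].
pose kr := complex.Re k; pose ki := complex.Im k.
exists (kr%:C%C *: a + ((- ki)%:C%C *: b + c)), (kr%:C%C *: b + (ki%:C%C *: a + d)); split.
- have := ess_rep_lin kr ra (ess_rep_lin (- ki) rb rc).
  rewrite (_ : (fun t => kr * _ + _) = fun t => complex.Re (val (k *: F + G) t)) //.
  apply/funext => t; rewrite ess_bounded_lin raddfD /=.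
  by rewrite /kr /ki; case: (k) => p q; case: (val F t) => v w /=; ring.
- have := ess_rep_lin kr rb (ess_rep_lin ki ra rd).
  rewrite (_ : (fun t => kr * _ + _) = fun t => complex.Im (val (k *: F + G) t)) //.
  apply/funext => t; rewrite ess_bounded_lin raddfD /=.
  by rewrite /kr /ki; case: (k) => p q; case: (val F t) => v w /=; ring.
have kE : k = kr%:C%C + 'i%C * ki%:C%C by rewrite -complexE.
have kiE : k * 'i%C = 'i%C * kr%:C%C - ki%:C%C.
  by rewrite kE mulrDl mulrAC ii mulN1r mulrC.
rewrite scalerDr scalerA kiE {1}kE rmorphN /=; lmod_ring.
Qed.

Lemma cplx_rep_mul F G x y : cplx_rep F x -> cplx_rep G y -> cplx_rep (F ** G) (x ** y).
Proof.
move=> [a [b [ra rb ->]]] [c [d [rc rd ->]]].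
exists ((-1)%:C%C *: (b ** d) + a ** c), (1%:C%C *: (a ** d) + b ** c); split.
- have := ess_rep_lin (-1) (ess_rep_mul rb rd) (ess_rep_mul ra rc).
  rewrite (_ : (fun t => -1 * _ + _) = fun t => complex.Re (val (F ** G) t)) //.
  apply/funext => t; rewrite ess_bounded_mul.
  by case: (val F t) => p q; case: (val G t) => v w /=; ring.
- have := ess_rep_lin 1 (ess_rep_mul ra rd) (ess_rep_mul rb rc).
  rewrite (_ : (fun t => 1 * _ + _) = fun t => complex.Im (val (F ** G) t)) //.
  apply/funext => t; rewrite ess_bounded_mul.
  by case: (val F t) => p q; case: (val G t) => v w /=; ring.
rewrite rmorphN1 rmorph1; star_expand; rewrite scalerA ii; lmod_ring.
Qed.

Lemma cplx_rep_star F x : cplx_rep F x -> cplx_rep F^# x^#.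
Proof.
move=> [a [b [ra rb ->]]]; exists a, ((-1)%:C%C *: b + 0); split.
- rewrite (_ : (fun t => complex.Re (val F^# t)) = fun t => complex.Re (val F t)) //.
  by apply/funext => t; rewrite ess_bounded_star; case: (val F t).
- have := ess_rep_lin (-1) rb ess_rep0.
  rewrite (_ : (fun t => -1 * _ + _) = fun t => complex.Im (val F^# t)) //.
  apply/funext => t; rewrite ess_bounded_star.
  by case: (val F t) => p q /=; ring.
rewrite starD starZ (ess_rep_star ra) (ess_rep_star rb) addr0 rmorphN1 scalerA.
by congr (_ + _ *: _); apply/eqP; rewrite eq_complex /=; apply/andP; split; apply/eqP; ring.
Qed.

Lemma Linfty_hom : exists phi : Linfty R -> U, is_star_morphism phi /\
  forall F, cplx_rep F (phi (Linfty_pi F)).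
Proof.
have [f0 f0P] := choice cplx_rep_ex.
pose phi (X : Linfty R) := f0 (repr X).
have phiP F : cplx_rep F (phi (Linfty_pi F)).
  have [x Fx] := cplx_rep_ex F.
  suff -> : phi (Linfty_pi F) = x by [].
  by apply: cplx_rep_uniq (f0P _) Fx _; rewrite /Linfty_pi quot_piK.
have surj (X : Linfty R) : exists F, Linfty_pi F = X by exists (repr X); exact: quot_piK.
exists phi; split => //; split.
- move=> k X Y; have [F <-] := surj X; have [G <-] := surj Y.
  have E : k *: Linfty_pi F + Linfty_pi G = Linfty_pi (k *: F + G).
    by rewrite /Linfty_pi quot_piD quot_piZ.
  rewrite E; apply: cplx_rep_uniq (phiP _) (cplx_rep_lin k (phiP F) (phiP G)) _; reflexivity.
- move=> X Y; have [F <-] := surj X; have [G <-] := surj Y.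
  rewrite /Linfty_pi -quot_piM.
  apply: cplx_rep_uniq (phiP _) (cplx_rep_mul (phiP F) (phiP G)) _; reflexivity.
- move=> X; have [F <-] := surj X; rewrite /Linfty_pi -quot_pi_star.
  apply: cplx_rep_uniq (phiP _) (cplx_rep_star (phiP F)) _; reflexivity.
Qed.

Lemma cplx_rep_comm F x a : cplx_rep F x ->
  (forall t, 0 <= t -> t <= 1 -> Q t ** a = a ** Q t) ->
  x ** a = a ** x.
Proof.
move=> [b [c [rb rc ->]]] H.
by rewrite smulDl smulDr smulZl smulZr (ess_rep_comm rb H) (ess_rep_comm rc H).
Qed.

Lemma cplx_rep_tr F x a tau : cplx_rep F x -> lt_trace tau ->
  (forall t, 0 <= t -> t <= 1 -> tau (a ** Q t) = t%:C%C * tau a) ->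
  tau (a ** x) = tau a * integral01 (val F).
Proof.
move=> [b [c [rb rc ->]]] tauP H.
have [mr _] := ess_bounded_Re F; have [mi _] := ess_bounded_Im F.
rewrite smulDr smulZr (limtrD tauP) (limtrZ tauP) (ess_rep_tr mr rb tauP H)
  (ess_rep_tr mi rc tauP H).
rewrite mulrCA -mulrDr; congr (_ * _).
by apply/eqP; rewrite eq_complex /=; apply/andP; split; apply/eqP;
  rewrite ?mul0r ?mul1r ?subr0 ?addr0 ?add0r.
Qed.

Lemma cplx_rep_unit F x : (forall t, val F t = 1) -> cplx_rep F x -> x = u.
Proof.
move=> F1 [a [b [ra rb ->]]].
have ae_eq f g : (forall t, f t = g t) -> ae01 f g by move=> fg; apply: nearW => t _.
rewrite (ess_rep_uniq ra ess_rep1); last by apply: ae_eq => t; rewrite F1.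
rewrite (ess_rep_uniq rb ess_rep0); last by apply: ae_eq => t; rewrite F1.
by rewrite scaler0 addr0.
Qed.
End Calculus.
End LinftyCalculus.

(** * Equivalence of the three properties *)

Section Main.
Context {R : realType} (omega : freeUltrafilter) {A : cstarAlgType R}.
Local Notation U := (ultrapower omega A).
Local Notation lt_trace := (limit_traces (omega := omega) (A := A)).
Local Notation iota := (@const_embed R omega A).
Hypotheses (sepA : separable_space A) (T0 : traces A !=set0) (Tc : traces_compact A).

Definition has_factor_projection := exists lambda : R, 0 < lambda < 1 /\
  exists p : U, [/\ is_projection p, commutant (range iota) p &
    forall (a : A) tau, lt_trace tau -> tau (iota a ** p) = lambda%:C%C * tau (iota a)].

Lemma factor_chain (S : set U) : has_factor_projection -> is_subalgebra S ->
  norm2_separable lt_trace S -> exists u (Q : R -> U),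
  [/\ is_identity u /\ (forall tau, lt_trace tau -> tau u = 1),
      forall t, 0 <= t -> t <= 1 -> is_projection (Q t) /\
        forall a, S a -> Q t ** a = a ** Q t,
      forall s t, 0 <= s -> s <= t -> t <= 1 -> Q s ** Q t = Q s,
      forall a t tau, S a -> 0 <= t -> t <= 1 -> lt_trace tau ->
        tau (a ** Q t) = t%:C%C * tau a &
      forall t tau, 0 <= t -> t <= 1 -> lt_trace tau -> tau (Q t) = t%:C%C].
Proof.
move=> [lam [/andP[lam0 lam1] [p [pP pC pT]]]] [S0 _ _] sepS.
have [d dS] := separable_seq S0 sepS.
have [u [uI _ u1]] := ultrapower_unit omega Tc.
have ext := @reindexed_projection R omega A T0 lam p pP
  (fun y => pC _ (ex_intro2 _ _ y I erefl)) pT.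
have [Q [Q1 Q2 Q3 Q4]] := projection_chain T0 uI u1 lam0 lam1 ext d.
exists u, Q; split => //.
- move=> t t0 t1; have [Qp Qd] := Q1 t t0 t1; split => // a Sa.
  exact: (closure_comm T0 (dS a Sa) Qd).
- move=> a t tau Sa t0 t1 tauP; apply: (closure_trace T0 (dS a Sa) tauP) => k.
  exact: Q3.
Qed.

Lemma gamma_factor : uniform_property_Gamma omega A -> has_factor_projection.
Proof.
move=> /(_ 2%N isT)[p [pP _ pT]]; exists (2^-1); split.
  by rewrite invr_gt0 ltr0n /= invf_lt1 ?ltr1n.
have [p1 p2] := pP ord0; exists (p ord0); split => // a tau tauP.
by rewrite pT // fmorphV /= rmorph_nat.
Qed.

(** The projections of the n cells of length 1/n. *)
Lemma factor_gamma : has_factor_projection -> uniform_property_Gamma omega A.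
Proof.
move=> fac; rewrite /uniform_property_Gamma; cbv zeta => n n0.
have [u [Q [[uI u1] Qproj Qmul Qtr Qu]]] := factor_chain fac (range_iota_subalgebra omega)
  (range_iota_separable omega T0 sepA).
have Qp t : 0 <= t -> t <= 1 -> is_projection (Q t) by move=> t0 t1; case: (Qproj t t0 t1).
have nR : (0 : R) < n%:R by rewrite ltr0n.
have node0 (i : nat) : 0 <= i%:R / n%:R :> R by rewrite divr_ge0.
have node1 (i : nat) : (i <= n)%N -> i%:R / n%:R <= 1 :> R.
  by move=> ni; rewrite ler_pdivrMr // mul1r ler_nat.
exists (fun i : 'I_n => cell Q n i); split.
- move=> i; split; first split.
  + exact: (cell_star Qp n0).
  + by rewrite (cell_mul Qp Qmul n0) // eqxx.
  + move=> a ra; rewrite /cell smulBl smulBr.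
    have [_ ->//] := Qproj _ (node0 i.+1) (node1 _ (ltn_ord i)).
    by have [_ ->//] := Qproj _ (node0 i) (node1 _ (ltnW (ltn_ord i))).
- have -> : \sum_(i < n) cell Q n i = u - Q 0 by exact: (cell_sum T0 uI u1 Qp Qu n0).
  suff -> : Q 0 = 0 by rewrite subr0.
  apply: (n2_eq0 T0); apply: (n2_le T0) => // tau tauP.
  have [-> ->] := Qp 0 (lexx _) ler01.
  by rewrite (Qu 0 tau) ?lexx ?ler01 // expr0n.
- move=> a tau i tauP.
  have ra : range (const_embed omega (A := A)) (iota a) by exists a.
  have tr_node k : (k <= n)%N ->
      tau (iota a ** Q (k%:R / n%:R)) = (k%:R / n%:R)%:C%C * tau (iota a).
    by move=> kn; exact: Qtr (node0 k) (node1 _ kn) tauP.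
  rewrite /cell smulBr (limtrB tauP).
  rewrite (tr_node _ (ltn_ord i)) (tr_node _ (ltnW (ltn_ord i))).
  rewrite -mulrBl -rmorphB /= -mulrBl -natrB // subSnn mul1r.
  by rewrite fmorphV /= rmorph_nat.
Qed.

Lemma factor_Linfty : has_factor_projection ->
  forall S : set U, is_subalgebra S -> norm2_separable lt_trace S ->
    exists phi : Linfty R -> U,
      [/\ is_star_morphism phi, is_identity (phi (Linfty1 R)),
          forall f : Linfty R, commutant S (phi f) &
          forall (a : U) (f : ess_bounded R) (tau : U -> R[i]), S a -> lt_trace tau ->
            tau (a ** phi (Linfty_pi f)) = tau a * integral01 (subalg_val f)].
Proof.
move=> fac S Sa sepS; have [u [Q [[uI u1] Qproj Qmul Qtr Qu]]] := factor_chain fac Sa sepS.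
have Qp t : 0 <= t -> t <= 1 -> is_projection (Q t) by move=> t0 t1; case: (Qproj t t0 t1).
have [phi [phi_hom phiP]] := Linfty_hom T0 uI u1 Qp Qmul Qu.
exists phi; split => //.
- have -> : phi (Linfty1 R) = u; last by [].
  exact: (cplx_rep_unit T0 uI u1 Qp Qmul Qu _ (phiP _)).
- move=> X a aS; have [F <-] : exists F, Linfty_pi F = X by exists (repr X); exact: quot_piK.
  by apply: (cplx_rep_comm T0 (phiP F)) => t t0 t1; have [_ ->] := Qproj t t0 t1.
- by move=> a f tau aS tauP; apply: (cplx_rep_tr T0 (phiP f) tauP) => t t0 t1; exact: Qtr.
Qed.

(** The image of the indicator function of [0, 1/2[, for S the image of A. *)
Lemma Linfty_factor : (forall S : set U, is_subalgebra S -> norm2_separable lt_trace S ->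
    exists phi : Linfty R -> U,
      [/\ is_star_morphism phi, is_identity (phi (Linfty1 R)),
          forall f : Linfty R, commutant S (phi f) &
          forall (a : U) (f : ess_bounded R) (tau : U -> R[i]), S a -> lt_trace tau ->
            tau (a ** phi (Linfty_pi f)) = tau a * integral01 (subalg_val f)]) ->
  has_factor_projection.
Proof.
move=> /(_ _ (range_iota_subalgebra omega) (range_iota_separable omega T0 sepA)).
move=> [phi [[_ phiM phiS] _ phiC phiT]].
pose h : R -> R[i] := fun t => ((t < 2^-1)%R%:R : R)%:C%C.
have hB : ess_bounded_funs h.
  split.
  - by have [] := bmeas_ind (2^-1 : R).
  - exact: measurable_cst.
  - exists 1; apply: nearW => t _; rewrite /h; case: (t < _); rewrite ?normr1 //.
    by rewrite normr0 ler01.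
have [F FE] : exists F : ess_bounded R, subalg_val F = h.
  by exists (insubd 0 h); apply: insubdK; exact: (mem_set hB).
have Ft t : val F t = h t by rewrite -FE.
have FM : F ** F = F.
  apply/val_inj/funext => t; apply: (etrans (ess_bounded_mul F F t)); rewrite !Ft /h.
  by case: (t < _); rewrite ?mulr1 ?mulr0.
have FS : F^# = F.
  by apply/val_inj/funext => t; apply: (etrans (ess_bounded_star F t));
    rewrite !Ft /h conjc_real.
exists (2^-1); split; first by rewrite invr_gt0 ltr0n /= invf_lt1 ?ltr1n.
exists (phi (Linfty_pi F)); split.
- split; first by rewrite -phiS /Linfty_pi -quot_pi_star FS.
  by rewrite -phiM /Linfty_pi -quot_piM FM.
- exact: phiC.
- move=> a tau tauP; rewrite phiT //.
  rewrite mulrC; congr (_ * _); rewrite FE.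
  apply/eqP; rewrite eq_complex /=; apply/andP; split; apply/eqP.
    apply: (int01_ind (s := 2^-1)); rewrite invr_ge0 ler0n /=.
    by rewrite invf_le1 // ler1n.
  exact: (int01_cst 0).
Qed.
End Main.

Theorem proposition2p3 (R : realType) (omega : freeUltrafilter)
    (A : cstarAlgType R) (sepA : separable_space A)
    (T_nonempty : traces A !=set0) (T_compact : traces_compact A) :
  let i := uniform_property_Gamma omega A in
  let ii := exists lambda : R, 0 < lambda < 1 /\
    exists p : ultrapower omega A,
      [/\ is_projection p,
          commutant (range (const_embed omega (A := A))) p &
          forall (a : A) (tau : ultrapower omega A -> R[i]),
            limit_traces tau ->
            tau (const_embed omega a ** p)
              = lambda%:C%C * tau (const_embed omega a)] in
  let iii := forall S : set (ultrapower omega A),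
    is_subalgebra S -> norm2_separable (limit_traces (A := A)) S ->
    exists phi : Linfty R -> ultrapower omega A,
      [/\ is_star_morphism phi,
          is_identity (phi (Linfty1 R)),
          forall f : Linfty R, commutant S (phi f) &
          forall (a : ultrapower omega A) (f : ess_bounded R)
              (tau : ultrapower omega A -> R[i]),
            S a -> limit_traces tau ->
            tau (a ** phi (Linfty_pi f))
              = tau a * integral01 (subalg_val f)] in
  (i <-> ii) /\ (ii <-> iii).
Proof.
split; split.
- exact: gamma_factor.
- exact: factor_gamma.
- exact: factor_Linfty.
- exact: Linfty_factor.
Qed.
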